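(* Let $\Omega$ be a strip domain of width $\gamma$, and let $f$ be a slice regular function on $\Omega$, continuous on $\overline\Omega$. Suppose that $|f(q)|\le N\exp(e^{k|q|})$ for all $q\in\Omega$, for some positive constants $N$ and $k<\pi/\gamma$. If there exists $M\ge0$ such that $|f|\le M$ on $\partial\Omega$, then $|f|\le M$ on $\Omega$.
   Context: $\mathbb{H}$ denotes the quaternions with Euclidean norm $|q|$; $\mathbb{S}=\{ix_1+jx_2+kx_3: x_1^2+x_2^2+x_3^2=1\}$; for $I\in\mathbb{S}$, $L_I=\mathbb{R}+\mathbb{R}I$ and $\Omega_I=\Omega\cap L_I$. A function $f:\Omega\to\mathbb{H}$ on an open set $\Omega$ is slice regular if for every $I\in\mathbb{S}$ its restriction $f_I$ to $\Omega_I$ satisfies $\frac12\left(\frac{\partial}{\partial x}+I\frac{\partial}{\partial y}\right)f_I(x+yI)=0$. A domain $\Omega$ is a slice domain if $\Omega\cap\mathbb{R}\ne\emptyset$ and each $\Omega_I$ is a domain in $L_I$. A slice domain $\Omega$ is a strip domain if for every $I\in\mathbb{S}$ there exist a (real) line $\ell_I$ in the plane $L_I$ and $\gamma_I>0$ such that $\Omega_I=\{z\in L_I: \mathrm{dist}(z,\ell_I)<\gamma_I/2\}$; its width is $\sup_{I\in\mathbb{S}}\gamma_I$. *)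

(* Defs.v *)
From Stdlib Require Import Reals.
Open Scope R_scope.

Record quat := Quat { qr : R; qi : R; qj : R; qk : R }.

Definition qadd (p q : quat) : quat :=
  Quat (qr p + qr q) (qi p + qi q) (qj p + qj q) (qk p + qk q).
Definition qsub (p q : quat) : quat :=
  Quat (qr p - qr q) (qi p - qi q) (qj p - qj q) (qk p - qk q).
Definition qmul (p q : quat) : quat :=
  Quat (qr p * qr q - qi p * qi q - qj p * qj q - qk p * qk q)
       (qr p * qi q + qi p * qr q + qj p * qk q - qk p * qj q)
       (qr p * qj q - qi p * qk q + qj p * qr q + qk p * qi q)
       (qr p * qk q + qi p * qj q - qj p * qi q + qk p * qr q).
Definition qzero : quat := Quat 0 0 0 0.
Definition qreal (x : R) : quat := Quat x 0 0 0.
Definition qscal (a : R) (q : quat) : quat :=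
  Quat (a * qr q) (a * qi q) (a * qj q) (a * qk q).

Definition qnorm (q : quat) : R :=
  sqrt (qr q ^ 2 + qi q ^ 2 + qj q ^ 2 + qk q ^ 2).

Definition in_S (I : quat) : Prop :=
  qr I = 0 /\ qi I ^ 2 + qj I ^ 2 + qk I ^ 2 = 1.

Definition slice (I : quat) (x y : R) : quat := qadd (qreal x) (qscal y I).

Definition qderiv_lim (h : R -> quat) (t : R) (d : quat) : Prop :=
  derivable_pt_lim (fun s => qr (h s)) t (qr d) /\
  derivable_pt_lim (fun s => qi (h s)) t (qi d) /\
  derivable_pt_lim (fun s => qj (h s)) t (qj d) /\
  derivable_pt_lim (fun s => qk (h s)) t (qk d).

Definition qopen (Om : quat -> Prop) : Prop :=
  forall q, Om q -> exists eps, eps > 0 /\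
    forall p, qnorm (qsub p q) < eps -> Om p.

Definition slice_regular (Om : quat -> Prop) (f : quat -> quat) : Prop :=
  forall I, in_S I -> forall x y, Om (slice I x y) ->
    exists dx dy,
      qderiv_lim (fun s => f (slice I s y)) x dx /\
      qderiv_lim (fun s => f (slice I x s)) y dy /\
      qscal (1/2) (qadd dx (qmul I dy)) = qzero.

(* Subsets of the plane R^2 (the plane L_I via coordinates (x,y) <-> x+yI) *)
Definition dist2 (a b c d : R) : R := sqrt ((a - c) ^ 2 + (b - d) ^ 2).
Definition open2 (U : R -> R -> Prop) : Prop :=
  forall x y, U x y -> exists eps, eps > 0 /\
    forall x' y', dist2 x' y' x y < eps -> U x' y'.
Definition connected2 (D : R -> R -> Prop) : Prop :=
  ~ exists U V : R -> R -> Prop,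
      open2 U /\ open2 V /\
      (forall x y, D x y -> U x y \/ V x y) /\
      (exists x y, D x y /\ U x y) /\
      (exists x y, D x y /\ V x y) /\
      (forall x y, D x y -> U x y -> V x y -> False).
Definition domain2 (D : R -> R -> Prop) : Prop := open2 D /\ connected2 D.

Definition slice_set (Om : quat -> Prop) (I : quat) : R -> R -> Prop :=
  fun x y => Om (slice I x y).

Definition slice_domain (Om : quat -> Prop) : Prop :=
  qopen Om /\ (exists x, Om (qreal x)) /\
  forall I, in_S I -> domain2 (slice_set Om I).

Definition line_dist (a b c x y : R) : R :=
  Rabs (a * x + b * y - c) / sqrt (a ^ 2 + b ^ 2).

Definition strip_slice (Om : quat -> Prop) (I : quat) (g : R) : Prop :=
  g > 0 /\ exists a b c, (a <> 0 \/ b <> 0) /\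
    forall x y, Om (slice I x y) <-> line_dist a b c x y < g / 2.

Definition strip_domain (Om : quat -> Prop) : Prop :=
  slice_domain Om /\ forall I, in_S I -> exists g, strip_slice Om I g.

Definition strip_width (Om : quat -> Prop) (gam : R) : Prop :=
  strip_domain Om /\
  is_lub (fun g => exists I, in_S I /\ strip_slice Om I g) gam.

Definition closure (Om : quat -> Prop) (q : quat) : Prop :=
  forall eps, eps > 0 -> exists p, Om p /\ qnorm (qsub p q) < eps.
Definition boundary (Om : quat -> Prop) (q : quat) : Prop :=
  closure Om q /\ ~ Om q.

Definition continuous_on_closure (Om : quat -> Prop) (f : quat -> quat) : Prop :=
  forall q, closure Om q -> forall eps, eps > 0 -> exists del, del > 0 /\
    forall p, closure Om p -> qnorm (qsub p q) < del ->
      qnorm (qsub (f p) (f q)) < eps.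

(* Main.v *)
Require Import Defs.
From Stdlib Require Import Reals Lra Lia Classical ClassicalEpsilon.
From Coquelicot Require Import Coquelicot.
Open Scope R_scope.

(** On a slice [L_I], pair [f] with [c = f q] and [I c]: this gives a complex function of modulus at most [|f| |c|], with equality at [q], whose real and imaginary parts satisfy the Cauchy-Riemann equations on a planar strip. Multiplying by [exp (- delta cos (kappa zeta))], where [zeta] is an affine coordinate adapted to the strip and [k < kappa < PI / gamma], makes it tend to zero along the strip, so the maximum principle applies on long rectangles, and [delta] tends to [0].

The hypothesis only provides partial derivatives, neither continuous nor accompanied by differentiability, so the maximum principle rests on the Looman-Menchoff theorem: a continuous field [(p, q)] having partial derivatives with [p_x + q_y = 0] has no flux through rectangles. Fix [eps] and let [E] be the set of points near which [|flux R| <= eps * area R] fails. By Baire, on a portion of [E] the difference quotients of [p] and [q] are uniformly bounded by some [N] and those of the divergence by [eps]. Comparing [p], [q] with Lipschitz extensions of their restrictions to this portion gives [|flux R| <= eps * area R + C N area (R \ E)] for rectangles [R] meeting it; summing over a fine subdivision removes the last term, and [E] is empty.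

Zero flux yields a double primitive, whose second difference quotients are smooth holomorphic functions converging uniformly to the given one; this gives the maximum principle. *)

(** * Rectangles and flux *)

(** The vector [c] changes with the point [q]: equality of the moduli there carries [M] over without
    a constant. The rate [kappa] meets two demands: [kappa] times the half width stays below
    [PI / 2], so that the real part of [cos (kappa zeta)] dominates a multiple of [exp (kappa |t|)]
    uniformly in the strip, [t] being the coordinate along it; and [kappa > k] makes this beat the
    allowed growth. In the flux estimate the difficulty is the area of [R \ E], where [E] is only
    closed and the integrals are Riemann integrals. That area is replaced by integrals of Lipschitz
    functions that vanish on [E] and equal 1 away from it. These integrals are bounded and increase
    as the scale decreases, so beyond some scale they hardly change; hence the contributions of the
    small rectangles meeting [E] have a small sum. The subdivision keeps the proportions of the
    rectangle, on which [C] depends. The maximum principle survives the passage to smooth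
    approximations because it is stated with a quadratic margin, which absorbs a small uniform
    error. *)

Definition near (d x y x' y' : R) : Prop := Rabs (x' - x) < d /\ Rabs (y' - y) < d.

Definition in_rect (a b c d x y : R) : Prop := a <= x <= b /\ c <= y <= d.

(** Compactness gives a size [e] below which every rectangle falls under the local hypothesis;
    bisection then climbs back from size [e] to size [e * 2 ^ n]. Serves both for additive bounds on
    the flux and for suprema of functions. *)
Lemma rect_induction (P : R -> R -> R -> R -> Prop) (a b c d : R) :
  (forall a' m b' c' d', a <= a' -> a' <= m -> m <= b' -> b' <= b ->
     c <= c' -> c' <= d' -> d' <= d ->
     P a' m c' d' -> P m b' c' d' -> P a' b' c' d') ->
  (forall a' b' c' m d', a <= a' -> a' <= b' -> b' <= b ->
     c <= c' -> c' <= m -> m <= d' -> d' <= d ->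
     P a' b' c' m -> P a' b' m d' -> P a' b' c' d') ->
  (forall x y, in_rect a b c d x y -> exists del, 0 < del /\
     forall a' b' c' d', a <= a' -> a' <= b' -> b' <= b ->
       c <= c' -> c' <= d' -> d' <= d ->
       near del x y a' c' -> near del x y b' d' -> P a' b' c' d') ->
  a <= b -> c <= d -> P a b c d.
Proof.
  intros Hx Hy Hloc Hab Hcd.
  (* The factor 2: compactness puts only the corner [(a', c')] within [del] of the point, and the
     opposite corner is less than [e <= del] further away in each coordinate. *)
  assert (Hd : forall x y, exists del : posreal, in_rect a b c d x y ->
     forall a' b' c' d', a <= a' -> a' <= b' -> b' <= b ->
       c <= c' -> c' <= d' -> d' <= d ->
       near (2 * del) x y a' c' -> near (2 * del) x y b' d' -> P a' b' c' d').
  { intros x y. destruct (classic (in_rect a b c d x y)) as [Hin|Hin].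
    - destruct (Hloc x y Hin) as [del [Hdel H]].
      assert (H2 : 0 < del / 2) by lra.
      exists (mkposreal _ H2). intros _ a' b' c' d'. simpl.
      replace (2 * (del / 2)) with del by field. apply H.
    - exists (mkposreal 1 Rlt_0_1). intros H; contradiction. }
  pose (delta := fun x y => proj1_sig (constructive_indefinite_description _ (Hd x y))).
  destruct (compactness_value_2d a b c d delta) as [e He].
  assert (Hsmall : forall n a' b' c' d', a <= a' -> a' <= b' -> b' <= b ->
     c <= c' -> c' <= d' -> d' <= d ->
     b' - a' < e * 2 ^ n -> d' - c' < e * 2 ^ n -> P a' b' c' d').
  { induction n as [|n IH]; intros a' b' c' d' H1 H2 H3 H4 H5 H6 H7 H8.
    - simpl in H7, H8. rewrite Rmult_1_r in H7, H8.
      apply NNPP. intro Hn.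
      apply (He a' c'); [lra|lra|]. intros [u [v [Hu [Hv [H9 [H10 H11]]]]]].
      apply Hn.
      assert (Hin : in_rect a b c d u v) by (split; lra).
      unfold delta in H9, H10, H11.
      destruct (constructive_indefinite_description _ (Hd u v)) as [del Hdel].
      simpl in *.
      apply (Hdel Hin); try lra;
      unfold near; split; apply Rabs_def1; apply Rabs_def2 in H9; apply Rabs_def2 in H10; lra.
    - simpl in H7, H8.
      set (m := (a' + b') / 2). set (m2 := (c' + d') / 2).
      assert (a' <= m <= b') by (unfold m; lra).
      assert (c' <= m2 <= d') by (unfold m2; lra).
      assert (m - a' < e * 2 ^ n /\ b' - m < e * 2 ^ n) by (unfold m; lra).
      assert (m2 - c' < e * 2 ^ n /\ d' - m2 < e * 2 ^ n) by (unfold m2; lra).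
      apply (Hx a' m b' c' d'); try lra; apply (Hy _ _ c' m2 d'); try lra; apply IH; lra. }
  destruct (Pow_x_infinity 2) with (b := (b - a + d - c + 1) / e) as [n Hn].
  { rewrite Rabs_right; lra. }
  specialize (Hn n (le_n n)).
  rewrite Rabs_right in Hn by (apply Rle_ge, pow_le; lra).
  assert (He0 := cond_pos e).
  assert (b - a + d - c + 1 <= e * 2 ^ n).
  { apply Rge_le in Hn. apply (Rmult_le_compat_l e) in Hn; [|lra].
    replace (e * ((b - a + d - c + 1) / e)) with (b - a + d - c + 1) in Hn by (field; lra). exact Hn. }
  apply (Hsmall n); lra.
Qed.

(* Semicontinuity suffices, so this also picks extremal points of closed sets. *)
Lemma usc_attains_max (F : R -> R -> R) (a b c d : R) :
  a <= b -> c <= d ->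
  (forall x y B, in_rect a b c d x y -> F x y < B -> exists del, 0 < del /\
     forall x' y', in_rect a b c d x' y' -> near del x y x' y' -> F x' y' < B) ->
  exists x y, in_rect a b c d x y /\
    forall x' y', in_rect a b c d x' y' -> F x' y' <= F x y.
Proof.
  intros Hab Hcd Husc.
  assert (Hbd : exists B, forall x y, in_rect a b c d x y -> F x y <= B).
  { apply (rect_induction (fun a b c d => exists B, forall x y, in_rect a b c d x y -> F x y <= B) a b c d); auto.
    - intros a' m b' c' d' _ _ _ _ _ _ _ [B1 H1] [B2 H2].
      exists (Rmax B1 B2). intros x y [Hx Hy].
      destruct (Rle_dec x m).
      + eapply Rle_trans; [apply H1; split; lra|apply Rmax_l].
      + eapply Rle_trans; [apply H2; split; lra|apply Rmax_r].
    - intros a' b' c' m d' _ _ _ _ _ _ _ [B1 H1] [B2 H2].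
      exists (Rmax B1 B2). intros x y [Hx Hy].
      destruct (Rle_dec y m).
      + eapply Rle_trans; [apply H1; split; lra|apply Rmax_l].
      + eapply Rle_trans; [apply H2; split; lra|apply Rmax_r].
    - intros x y Hin. destruct (Husc x y (F x y + 1) Hin) as [del [Hdel H]]; [lra|].
      exists del; split; auto. intros a' b' c' d' H1 H2 H3 H4 H5 H6 [N1 N2] [N3 N4].
      apply Rabs_def2 in N1, N2, N3, N4.
      exists (F x y + 1). intros x' y' [Hx' Hy']. apply Rlt_le, H.
      + split; lra.
      + split; apply Rabs_def1; lra. }
  destruct (completeness (fun v => exists x y, in_rect a b c d x y /\ v = F x y)) as [S [HS1 HS2]].
  { destruct Hbd as [B HB]. exists B. intros v [x [y [Hin ->]]]. auto. }
  { exists (F a c), a, c. split; [split; lra|auto]. }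
  apply NNPP. intro Hno.
  assert (Hlt : forall x y, in_rect a b c d x y -> F x y < S).
  { intros x y Hin. destruct (Rle_lt_or_eq_dec (F x y) S) as [H|H]; auto.
    - apply HS1. exists x, y; auto.
    - exfalso. apply Hno. exists x, y. split; auto. intros x' y' Hin'. rewrite H.
      apply HS1. exists x', y'; auto. }
  (* A supremum that is not attained is missed by a definite amount near every point, hence by a
     definite amount on the whole rectangle. *)
  assert (Hbd2 : exists B, B < S /\ forall x y, in_rect a b c d x y -> F x y <= B).
  { apply (rect_induction (fun a b c d => exists B, B < S /\ forall x y, in_rect a b c d x y -> F x y <= B) a b c d); auto.
    - intros a' m b' c' d' _ _ _ _ _ _ _ [B1 [L1 H1]] [B2 [L2 H2]].
      exists (Rmax B1 B2). split; [apply Rmax_lub_lt; auto|]. intros x y [Hx Hy].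
      destruct (Rle_dec x m).
      + eapply Rle_trans; [apply H1; split; lra|apply Rmax_l].
      + eapply Rle_trans; [apply H2; split; lra|apply Rmax_r].
    - intros a' b' c' m d' _ _ _ _ _ _ _ [B1 [L1 H1]] [B2 [L2 H2]].
      exists (Rmax B1 B2). split; [apply Rmax_lub_lt; auto|]. intros x y [Hx Hy].
      destruct (Rle_dec y m).
      + eapply Rle_trans; [apply H1; split; lra|apply Rmax_l].
      + eapply Rle_trans; [apply H2; split; lra|apply Rmax_r].
    - intros x y Hin. assert (L := Hlt x y Hin).
      destruct (Husc x y ((F x y + S) / 2) Hin) as [del [Hdel H]]; [lra|].
      exists del; split; auto. intros a' b' c' d' H1 H2 H3 H4 H5 H6 [N1 N2] [N3 N4].
      apply Rabs_def2 in N1, N2, N3, N4.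
      exists ((F x y + S) / 2). split; [lra|]. intros x' y' [Hx' Hy']. apply Rlt_le, H.
      + split; lra.
      + split; apply Rabs_def1; lra. }
  destruct Hbd2 as [B [HB1 HB2]].
  assert (S <= B); [|lra]. apply HS2. intros v [x [y [Hin ->]]]. auto.
Qed.

(** Continuity is asked on the whole plane, so that all integrals below exist without side
    conditions; functions controlled on a rectangle only are first composed with [clamp]. *)
Definition cont2 (f : R -> R -> R) : Prop := forall x y, continuity_2d_pt f x y.

Lemma cont2_near (f : R -> R -> R) (x y eps : R) :
  continuity_2d_pt f x y -> 0 < eps -> exists del, 0 < del /\
    forall x' y', near del x y x' y' -> Rabs (f x' y' - f x y) < eps.
Proof.
  intros H He. destruct (H (mkposreal eps He)) as [del Hd].
  exists del. split; [apply cond_pos|]. intros x' y' [H1 H2]. apply Hd; auto.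
Qed.

Lemma near_cont2 (f : R -> R -> R) (x y : R) :
  (forall eps, 0 < eps -> exists del, 0 < del /\
    forall x' y', near del x y x' y' -> Rabs (f x' y' - f x y) < eps) ->
  continuity_2d_pt f x y.
Proof.
  intros H eps. destruct (H eps (cond_pos eps)) as [del [Hd H']].
  exists (mkposreal del Hd). simpl. intros u v H1 H2. apply H'. split; auto.
Qed.

Lemma continuous_of_eps (f : R -> R) (x : R) :
  (forall eps, 0 < eps -> exists del, 0 < del /\
    forall x', Rabs (x' - x) < del -> Rabs (f x' - f x) < eps) ->
  continuous f x.
Proof.
  intros H. apply (proj2 (filterlim_locally f (f x))). intros eps.
  destruct (H eps (cond_pos eps)) as [del [Hd H']].
  exists (mkposreal del Hd). intros y Hy. apply H'. exact Hy.
Qed.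

Lemma cont2_x (f : R -> R -> R) (y x : R) : cont2 f -> continuous (fun t => f t y) x.
Proof.
  intros H. apply continuous_of_eps. intros eps He.
  destruct (cont2_near f x y eps (H x y) He) as [del [Hd Hn]].
  exists del; split; auto. intros x' Hx'. apply Hn. split; auto.
  rewrite Rminus_diag, Rabs_R0; auto.
Qed.

Lemma cont2_y (f : R -> R -> R) (x y : R) : cont2 f -> continuous (fun t => f x t) y.
Proof.
  intros H. apply continuous_of_eps. intros eps He.
  destruct (cont2_near f x y eps (H x y) He) as [del [Hd Hn]].
  exists del; split; auto. intros y' Hy'. apply Hn. split; auto.
  rewrite Rminus_diag, Rabs_R0; auto.
Qed.

Lemma ex_RInt_cont (f : R -> R) (a b : R) :
  (forall x, continuous f x) -> ex_RInt f a b.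
Proof. intros H. apply (ex_RInt_continuous (V := R_CompleteNormedModule)). auto. Qed.

Lemma cont2_ex_x (f : R -> R -> R) (y a b : R) : cont2 f -> ex_RInt (fun t => f t y) a b.
Proof. intros H. apply ex_RInt_cont. intros. apply cont2_x; auto. Qed.

Lemma cont2_ex_y (f : R -> R -> R) (x a b : R) : cont2 f -> ex_RInt (fun t => f x t) a b.
Proof. intros H. apply ex_RInt_cont. intros. apply cont2_y; auto. Qed.

Lemma RInt_add (f g : R -> R) (a b : R) : ex_RInt f a b -> ex_RInt g a b ->
  RInt (fun x => f x + g x) a b = RInt f a b + RInt g a b.
Proof. intros. apply (RInt_plus (V := R_CompleteNormedModule)); auto. Qed.

Lemma RInt_sub (f g : R -> R) (a b : R) : ex_RInt f a b -> ex_RInt g a b ->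
  RInt (fun x => f x - g x) a b = RInt f a b - RInt g a b.
Proof. intros. apply (RInt_minus (V := R_CompleteNormedModule)); auto. Qed.

Lemma RInt_mult (k : R) (f : R -> R) (a b : R) : ex_RInt f a b ->
  RInt (fun x => k * f x) a b = k * RInt f a b.
Proof. intros. apply (RInt_scal (V := R_CompleteNormedModule)); auto. Qed.

Lemma RInt_cst (k a b : R) : RInt (fun _ => k) a b = (b - a) * k.
Proof. exact (RInt_const (V := R_CompleteNormedModule) a b k). Qed.

Lemma RInt_same (f : R -> R) (a : R) : RInt f a a = 0.
Proof. exact (RInt_point (V := R_CompleteNormedModule) a f). Qed.

Lemma RInt_eq (f g : R -> R) (a b : R) : (forall x, f x = g x) -> RInt f a b = RInt g a b.
Proof. intros H. apply (RInt_ext (V := R_CompleteNormedModule)). intros x _. apply H. Qed.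

Lemma RInt_split (f : R -> R) (a b c : R) : ex_RInt f a b -> ex_RInt f b c ->
  RInt f a c = RInt f a b + RInt f b c.
Proof. intros. symmetry. apply (RInt_Chasles (V := R_CompleteNormedModule)); auto. Qed.

Lemma ex_RInt_add (f g : R -> R) (a b : R) : ex_RInt f a b -> ex_RInt g a b ->
  ex_RInt (fun x => f x + g x) a b.
Proof. intros. apply (ex_RInt_plus (V := R_NormedModule)); auto. Qed.

Lemma ex_RInt_sub (f g : R -> R) (a b : R) : ex_RInt f a b -> ex_RInt g a b ->
  ex_RInt (fun x => f x - g x) a b.
Proof. intros. apply (ex_RInt_minus (V := R_NormedModule)); auto. Qed.

Lemma ex_RInt_mult (k : R) (f : R -> R) (a b : R) : ex_RInt f a b ->
  ex_RInt (fun x => k * f x) a b.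
Proof. intros. apply (ex_RInt_scal (V := R_NormedModule)); auto. Qed.

Lemma ex_RInt_cst (k a b : R) : ex_RInt (fun _ => k) a b.
Proof. apply (ex_RInt_const (V := R_NormedModule)). Qed.

#[local] Hint Resolve cont2_ex_x cont2_ex_y ex_RInt_add ex_RInt_sub ex_RInt_mult ex_RInt_cst : rint.

Lemma RInt_abs_le (f g : R -> R) (a b : R) : a <= b -> ex_RInt f a b -> ex_RInt g a b ->
  (forall x, a <= x <= b -> Rabs (f x) <= g x) -> Rabs (RInt f a b) <= RInt g a b.
Proof.
  intros Hab Hf Hg H. apply Rabs_le. split.
  - replace (- RInt g a b) with (RInt (fun x => (-1) * g x) a b).
    2: { rewrite RInt_mult by auto. lra. }
    apply RInt_le; auto with rint. intros x Hx.
    assert (H' := H x ltac:(lra)). apply Rabs_le_between in H'. lra.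
  - apply RInt_le; auto. intros x Hx. assert (H' := H x ltac:(lra)). apply Rabs_le_between in H'. lra.
Qed.

(** Outward flux of the field [(p, q)] through the boundary of the rectangle, opposite sides being
    paired in one integral. *)
Definition flux (p q : R -> R -> R) (a b c d : R) : R :=
  RInt (fun y => p b y - p a y) c d + RInt (fun x => q x d - q x c) a b.

Lemma flux_split_x (p q : R -> R -> R) (a m b c d : R) : cont2 p -> cont2 q ->
  flux p q a b c d = flux p q a m c d + flux p q m b c d.
Proof.
  intros Hp Hq. unfold flux.
  rewrite (RInt_split _ a m b) by auto with rint.
  rewrite !RInt_sub by auto with rint. ring.
Qed.

Lemma flux_split_y (p q : R -> R -> R) (a b c m d : R) : cont2 p -> cont2 q ->
  flux p q a b c d = flux p q a b c m + flux p q a b m d.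
Proof.
  intros Hp Hq. unfold flux.
  rewrite (RInt_split _ c m d) by auto with rint.
  rewrite !RInt_sub by auto with rint. ring.
Qed.

Lemma cont2_bounded (f : R -> R -> R) (a b c d : R) : cont2 f -> exists B, 0 <= B /\
  forall x y, in_rect a b c d x y -> Rabs (f x y) <= B.
Proof.
  intros Hf. destruct (Rle_dec a b) as [Hab|Hab].
  2: { exists 0; split; [lra|]. intros x y [Hx Hy]; lra. }
  destruct (Rle_dec c d) as [Hcd|Hcd].
  2: { exists 0; split; [lra|]. intros x y [Hx Hy]; lra. }
  destruct (usc_attains_max (fun x y => Rabs (f x y)) a b c d Hab Hcd) as [x [y [Hin H]]].
  - intros x y B Hin HB. destruct (cont2_near f x y (B - Rabs (f x y)) (Hf x y) ltac:(lra)) as [del [Hd H]].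
    exists del; split; auto. intros x' y' _ Hn. specialize (H x' y' Hn).
    assert (H' := Rabs_triang_inv (f x' y') (f x y)). lra.
  - exists (Rabs (f x y)). split; [apply Rabs_pos|auto].
Qed.

(** The two vertical sides nearly cancel, by [e1], and the horizontal ones have length at most [w].
    Meant for the strips trimmed off in [flux_shrink]. *)
Lemma flux_thin (p q : R -> R -> R) (a b c d w e1 B : R) : cont2 p -> cont2 q ->
  a <= b -> c <= d -> b - a <= w ->
  (forall y, c <= y <= d -> Rabs (p b y - p a y) <= e1) ->
  (forall x, a <= x <= b -> Rabs (q x d - q x c) <= B) ->
  Rabs (flux p q a b c d) <= (d - c) * e1 + w * B.
Proof.
  intros Hp Hq Hab Hcd Hw H1 H2. unfold flux.
  eapply Rle_trans; [apply Rabs_triang|]. apply Rplus_le_compat.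
  - apply abs_RInt_le_const; auto with rint.
  - eapply Rle_trans; [apply abs_RInt_le_const with (M := B); auto with rint|].
    apply Rmult_le_compat_r; auto. eapply Rle_trans; [apply Rabs_pos|]. apply (H2 a); lra.
Qed.

Definition swap (f : R -> R -> R) : R -> R -> R := fun x y => f y x.

(** Reflection in the diagonal exchanges the two components, so an estimate for vertical strips also
    serves for horizontal ones. *)
Lemma flux_swap (p q : R -> R -> R) (a b c d : R) :
  flux p q a b c d = flux (swap q) (swap p) c d a b.
Proof. unfold flux, swap. ring. Qed.

Lemma cont2_swap (f : R -> R -> R) : cont2 f -> cont2 (swap f).
Proof.
  intros H x y. apply near_cont2. intros eps He.
  destruct (cont2_near f y x eps (H y x) He) as [del [Hd Hn]].
  exists del; split; auto. intros x' y' [H1 H2]. apply Hn. split; auto.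
Qed.

Lemma flux_shrink (p q : R -> R -> R) (a b c d eta : R) : cont2 p -> cont2 q ->
  a <= b -> c <= d -> 0 < eta -> exists del, 0 < del /\
  forall a' b' c' d', a <= a' -> a' <= b' -> b' <= b -> c <= c' -> c' <= d' -> d' <= d ->
    a' - a < del -> b - b' < del -> c' - c < del -> d - d' < del ->
    Rabs (flux p q a b c d - flux p q a' b' c' d') <= eta.
Proof.
  intros Hp Hq Hab Hcd Heta.
  destruct (cont2_bounded p a b c d Hp) as [Bp [Bp0 HBp]].
  destruct (cont2_bounded q a b c d Hq) as [Bq [Bq0 HBq]].
  (* [L] dominates the side lengths and the oscillations [2 * Bp], [2 * Bq]. With
     [e1 = eta / (8 * L)] both terms of [flux_thin] are at most [eta / 8], and each of the four
     trimmed strips costs at most [eta / 4]. *)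
  set (L := b - a + (d - c) + 2 * Bp + 2 * Bq + 1).
  assert (HL : 0 < L) by (unfold L; lra).
  assert (He : 0 < eta / (8 * L)) by (apply Rdiv_lt_0_compat; lra).
  destruct (uniform_continuity_2d p a b c d (fun x y _ _ => Hp x y) (mkposreal _ He)) as [d1 H1].
  destruct (uniform_continuity_2d q a b c d (fun x y _ _ => Hq x y) (mkposreal _ He)) as [d2 H2].
  simpl in H1, H2.
  assert (Hd1 := cond_pos d1). assert (Hd2 := cond_pos d2).
  set (del := Rmin (eta / (8 * L)) (Rmin d1 d2)).
  assert (Hdel : 0 < del) by (unfold del; repeat apply Rmin_pos; auto).
  assert (D1 : del <= eta / (8 * L)) by (unfold del; apply Rmin_l).
  assert (D2 : del <= d1) by (unfold del; eapply Rle_trans; [apply Rmin_r|apply Rmin_l]).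
  assert (D3 : del <= d2) by (unfold del; eapply Rle_trans; [apply Rmin_r|apply Rmin_r]).
  set (e1 := eta / (8 * L)) in *.
  assert (HeL : e1 * L = eta / 8) by (unfold e1; field; lra).
  exists del; split; auto. intros a' b' c' d' A1 A2 A3 A4 A5 A6 S1 S2 S3 S4.
  assert (Tx : forall u v, a <= u -> u <= v -> v <= b -> v - u < del ->
     Rabs (flux p q u v c d) <= eta / 4).
  { intros u v U1 U2 U3 U4.
    eapply Rle_trans; [apply (flux_thin p q u v c d e1 e1 (2 * Bq)); auto; try lra|].
    - intros y Hy. apply Rlt_le, H1; try lra; [rewrite Rabs_right|rewrite Rminus_diag, Rabs_R0]; lra.
    - intros x Hx. assert (Q1 := HBq x d ltac:(split; lra)). assert (Q2 := HBq x c ltac:(split; lra)).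
      apply Rabs_le. apply Rabs_le_between in Q1, Q2. lra.
    - assert ((d - c) * e1 <= L * e1) by (apply Rmult_le_compat_r; unfold L; lra).
      assert (e1 * (2 * Bq) <= e1 * L) by (apply Rmult_le_compat_l; unfold L; lra). lra. }
  assert (Ty : forall u v, c <= u -> u <= v -> v <= d -> v - u < del ->
     Rabs (flux p q a' b' u v) <= eta / 4).
  { intros u v U1 U2 U3 U4. rewrite flux_swap.
    eapply Rle_trans; [apply (flux_thin (swap q) (swap p) u v a' b' e1 e1 (2 * Bp)); auto using cont2_swap; try lra|]; unfold swap.
    - intros y Hy. apply Rlt_le, H2; try lra; [rewrite Rminus_diag, Rabs_R0|rewrite Rabs_right]; lra.
    - intros x Hx. assert (Q1 := HBp a' x ltac:(split; lra)). assert (Q2 := HBp b' x ltac:(split; lra)).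
      apply Rabs_le. apply Rabs_le_between in Q1, Q2. lra.
    - assert ((b' - a') * e1 <= L * e1) by (apply Rmult_le_compat_r; unfold L; lra).
      assert (e1 * (2 * Bp) <= e1 * L) by (apply Rmult_le_compat_l; unfold L; lra). lra. }
  rewrite (flux_split_x p q a a' b), (flux_split_x p q a' b' b) by auto.
  rewrite (flux_split_y p q a' b' c c' d), (flux_split_y p q a' b' c' d' d) by auto.
  assert (T1 := Tx a a' ltac:(lra) ltac:(lra) ltac:(lra) ltac:(lra)).
  assert (T2 := Tx b' b ltac:(lra) ltac:(lra) ltac:(lra) ltac:(lra)).
  assert (T3 := Ty c c' ltac:(lra) ltac:(lra) ltac:(lra) ltac:(lra)).
  assert (T4 := Ty d' d ltac:(lra) ltac:(lra) ltac:(lra) ltac:(lra)).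
  apply Rabs_le_between in T1, T2, T3, T4. apply Rabs_le. lra.
Qed.

(* Local bounds are needed in the open rectangle only: its sides are reached by continuity. *)
Lemma flux_local_bound (p q : R -> R -> R) (eps a b c d : R) : cont2 p -> cont2 q ->
  0 <= eps -> a <= b -> c <= d ->
  (forall x y, a < x < b -> c < y < d -> exists del, 0 < del /\
     forall a' b' c' d', a' <= b' -> c' <= d' ->
       near del x y a' c' -> near del x y b' d' ->
       Rabs (flux p q a' b' c' d') <= eps * ((b' - a') * (d' - c'))) ->
  Rabs (flux p q a b c d) <= eps * ((b - a) * (d - c)).
Proof.
  intros Hp Hq Heps Hab Hcd Hloc.
  destruct (Req_dec a b) as [->|Hab'].
  { unfold flux. rewrite RInt_same, (RInt_eq _ (fun _ => 0)) by (intros; ring).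
    rewrite RInt_cst, !Rminus_diag, Rmult_0_l, !Rmult_0_r, Rplus_0_r, Rabs_R0; lra. }
  destruct (Req_dec c d) as [->|Hcd'].
  { unfold flux. rewrite RInt_same, (RInt_eq _ (fun _ => 0)) by (intros; ring).
    rewrite RInt_cst, !Rminus_diag, !Rmult_0_r, Rplus_0_r, Rabs_R0; lra. }
  apply Rle_plus_epsilon. intros eta Heta.
  destruct (flux_shrink p q a b c d eta Hp Hq Hab Hcd Heta) as [del [Hdel Hs]].
  set (t := Rmin (del / 2) (Rmin ((b - a) / 4) ((d - c) / 4))).
  assert (0 < t) by (unfold t; repeat apply Rmin_pos; lra).
  assert (t <= del / 2) by (unfold t; apply Rmin_l).
  assert (t <= (b - a) / 4) by (unfold t; eapply Rle_trans; [apply Rmin_r|apply Rmin_l]).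
  assert (t <= (d - c) / 4) by (unfold t; eapply Rle_trans; [apply Rmin_r|apply Rmin_r]).
  specialize (Hs (a + t) (b - t) (c + t) (d - t)).
  assert (Hs' := Hs ltac:(lra) ltac:(lra) ltac:(lra) ltac:(lra) ltac:(lra) ltac:(lra) ltac:(lra) ltac:(lra) ltac:(lra) ltac:(lra)).
  assert (Hin : Rabs (flux p q (a + t) (b - t) (c + t) (d - t)) <= eps * ((b - t - (a + t)) * (d - t - (c + t)))).
  { apply (rect_induction (fun a b c d => Rabs (flux p q a b c d) <= eps * ((b - a) * (d - c)))); try lra.
    - intros a' m b' c' d' _ _ _ _ _ _ _ I1 I2. rewrite (flux_split_x p q a' m b') by auto.
      eapply Rle_trans; [apply Rabs_triang|]. lra.
    - intros a' b' c' m d' _ _ _ _ _ _ _ I1 I2. rewrite (flux_split_y p q a' b' c' m d') by auto.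
      eapply Rle_trans; [apply Rabs_triang|]. lra.
    - intros x y [Hx Hy]. destruct (Hloc x y ltac:(lra) ltac:(lra)) as [e [He H']].
      exists e; split; auto. }
  assert (eps * ((b - t - (a + t)) * (d - t - (c + t))) <= eps * ((b - a) * (d - c))).
  { apply Rmult_le_compat_l; auto. apply Rmult_le_compat; lra. }
  assert (H' := Rabs_triang_inv (flux p q a b c d) (flux p q (a + t) (b - t) (c + t) (d - t))). lra.
Qed.

(** * Lipschitz extensions and iterated integrals *)

(** Increments of [p] and [q] are controlled along one axis at a time, and such bounds add up
    exactly to this distance. *)
Definition l1 (x y x' y' : R) : R := Rabs (x - x') + Rabs (y - y').

Definition lip (L : R) (F : R -> R -> R) : Prop :=
  forall x y x' y', Rabs (F x y - F x' y') <= L * l1 x y x' y'.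

(** McShane's formula for the largest extension of [u] from [K] with Lipschitz constant [N]. [real]
    sends an infinite infimum to 0; [mcshane_glb] excludes that case when [K] is nonempty and [u] is
    Lipschitz on it. *)
Definition mcshane (K : R -> R -> Prop) (u : R -> R -> R) (N : R) (x y : R) : R :=
  real (Glb_Rbar (fun v => exists x' y', K x' y' /\ v = u x' y' + N * l1 x y x' y')).

Lemma l1_triang x y x1 y1 x2 y2 : l1 x y x2 y2 <= l1 x y x1 y1 + l1 x1 y1 x2 y2.
Proof.
  unfold l1. assert (H1 := Rabs_triang (x - x1) (x1 - x2)).
  assert (H2 := Rabs_triang (y - y1) (y1 - y2)).
  replace (x - x1 + (x1 - x2)) with (x - x2) in H1 by ring.
  replace (y - y1 + (y1 - y2)) with (y - y2) in H2 by ring. lra.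
Qed.

Lemma l1_pos x y x' y' : 0 <= l1 x y x' y'.
Proof. unfold l1. assert (H1 := Rabs_pos (x - x')). assert (H2 := Rabs_pos (y - y')). lra. Qed.

Lemma l1_sym x y x' y' : l1 x y x' y' = l1 x' y' x y.
Proof. unfold l1. rewrite (Rabs_minus_sym x), (Rabs_minus_sym y). reflexivity. Qed.

Lemma l1_refl x y : l1 x y x y = 0.
Proof. unfold l1. rewrite !Rminus_diag, Rabs_R0. ring. Qed.

Lemma lip_cont2 (L : R) (F : R -> R -> R) : 0 <= L -> lip L F -> cont2 F.
Proof.
  intros HL HF x y. apply near_cont2. intros eps He.
  exists (eps / (2 * L + 1)). assert (0 < eps / (2 * L + 1)) by (apply Rdiv_lt_0_compat; lra).
  split; auto. intros x' y' [H1 H2]. eapply Rle_lt_trans; [apply HF|].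
  assert (eps / (2 * L + 1) * (2 * L + 1) = eps) by (field; lra).
  unfold l1. nra.
Qed.

Lemma lip_swap (L : R) (F : R -> R -> R) : lip L F -> lip L (swap F).
Proof.
  intros H x y x' y'. unfold swap. eapply Rle_trans; [apply H|]. right. unfold l1. ring.
Qed.

Lemma lip_shift (L : R) (F : R -> R -> R) (h k : R) : lip L F -> lip L (fun x y => F (x + h) (y + k)).
Proof.
  intros H x y x' y'. eapply Rle_trans; [apply H|]. right. unfold l1. f_equal. f_equal; f_equal; ring.
Qed.

Section McShane.

Variables (K : R -> R -> Prop) (u : R -> R -> R) (N : R).
Hypothesis HN : 0 <= N.
Hypothesis HK : exists x y, K x y.
Hypothesis Hu : forall x y x' y', K x y -> K x' y' -> Rabs (u x y - u x' y') <= N * l1 x y x' y'.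

(** The infimum is finite: one point of [K] bounds it above, and the Lipschitz condition on [K] with
    the triangle inequality bounds it below. *)
Lemma mcshane_glb (x y : R) :
  (forall x' y', K x' y' -> mcshane K u N x y <= u x' y' + N * l1 x y x' y') /\
  (forall eta, 0 < eta -> exists x' y', K x' y' /\ u x' y' + N * l1 x y x' y' < mcshane K u N x y + eta).
Proof.
  unfold mcshane.
  set (S := fun v => exists x' y', K x' y' /\ v = u x' y' + N * l1 x y x' y').
  destruct (Glb_Rbar_correct S) as [H1 H2].
  destruct HK as [x0 [y0 H0]].
  assert (Hl : Rbar_le (u x0 y0 - N * l1 x y x0 y0) (Glb_Rbar S)).
  { apply H2. intros v [x' [y' [Hk ->]]]. simpl.
    assert (H' := Hu x0 y0 x' y' H0 Hk). apply Rabs_le_between in H'.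
    assert (T := l1_triang x0 y0 x y x' y'). rewrite (l1_sym x0 y0 x y) in T.
    apply (Rmult_le_compat_l N) in T; auto. lra. }
  assert (Hr : Rbar_le (Glb_Rbar S) (u x0 y0 + N * l1 x y x0 y0)).
  { apply H1. exists x0, y0; auto. }
  destruct (Glb_Rbar S) as [g| |] eqn:Hg; simpl in *; try contradiction.
  split.
  - intros x' y' Hk. apply (H1 (u x' y' + N * l1 x y x' y')). exists x', y'; auto.
  - intros eta Heta. apply NNPP. intro Hn.
    assert (g + eta <= g); [|lra]. apply (H2 (g + eta)). intros v [x' [y' [Hk ->]]]. simpl.
    apply Rnot_lt_le. intro Hlt. apply Hn. exists x', y'; auto.
Qed.

Lemma mcshane_lip : lip N (mcshane K u N).
Proof.
  assert (H : forall x y x' y', mcshane K u N x y <= mcshane K u N x' y' + N * l1 x y x' y').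
  { intros x y x' y'. apply Rle_plus_epsilon. intros eta Heta.
    destruct (proj2 (mcshane_glb x' y') eta Heta) as [x1 [y1 [Hk H1]]].
    assert (H2 := proj1 (mcshane_glb x y) x1 y1 Hk).
    assert (T := l1_triang x y x' y' x1 y1). apply (Rmult_le_compat_l N) in T; auto. lra. }
  intros x y x' y'. assert (H1 := H x y x' y'). assert (H2 := H x' y' x y).
  rewrite (l1_sym x' y' x y) in H2. apply Rabs_le. lra.
Qed.

Lemma mcshane_ext (x y : R) : K x y -> mcshane K u N x y = u x y.
Proof.
  intros Hk. apply Rle_antisym.
  - assert (H := proj1 (mcshane_glb x y) x y Hk). rewrite l1_refl in H. lra.
  - apply Rle_plus_epsilon. intros eta Heta.
    destruct (proj2 (mcshane_glb x y) eta Heta) as [x1 [y1 [Hk1 H1]]].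
    assert (H' := Hu x y x1 y1 Hk Hk1). apply Rabs_le_between in H'. lra.
Qed.

End McShane.

(** The distance to [K], written as a McShane extension of zero so as to inherit its Lipschitz
    bound. *)
Definition dist_set (K : R -> R -> Prop) : R -> R -> R := mcshane K (fun _ _ => 0) 1.

(* Approximates from below the indicator function of the complement of [K] as [eta -> 0]. *)
Definition cut (K : R -> R -> Prop) (eta x y : R) : R := Rmin 1 (dist_set K x y / eta).

Section Cut.

Variable K : R -> R -> Prop.
Hypothesis HK : exists x y, K x y.

Lemma dist_set_glb (x y : R) :
  (forall x' y', K x' y' -> dist_set K x y <= l1 x y x' y') /\
  (forall eta, 0 < eta -> exists x' y', K x' y' /\ l1 x y x' y' < dist_set K x y + eta).
Proof.
  destruct (mcshane_glb K (fun _ _ => 0) 1 ltac:(lra) HK) with (x := x) (y := y) as [H1 H2].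
  { intros. rewrite Rminus_diag, Rabs_R0, Rmult_1_l. apply l1_pos. }
  fold (dist_set K) in *. split.
  - intros x' y' Hk. assert (H := H1 x' y' Hk). simpl in H. lra.
  - intros eta Heta. destruct (H2 eta Heta) as [x' [y' [Hk H]]]. exists x', y'. split; auto. simpl in H. lra.
Qed.

Lemma dist_set_pos (x y : R) : 0 <= dist_set K x y.
Proof.
  apply Rle_plus_epsilon. intros eta Heta.
  destruct (proj2 (dist_set_glb x y) eta Heta) as [x' [y' [_ H]]].
  assert (H' := l1_pos x y x' y'). lra.
Qed.

Lemma cut_bounds (eta x y : R) : 0 < eta -> 0 <= cut K eta x y <= 1.
Proof.
  intros He. unfold cut. split.
  - apply Rmin_glb; [lra|]. apply Rdiv_le_0_compat; auto. apply dist_set_pos.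
  - apply Rmin_l.
Qed.

Lemma cut_lip (eta : R) : 0 < eta -> lip (/ eta) (cut K eta).
Proof.
  intros He x y x' y'.
  assert (H : Rabs (dist_set K x y - dist_set K x' y') <= 1 * l1 x y x' y').
  { apply mcshane_lip; auto; try lra. intros. rewrite Rminus_diag, Rabs_R0, Rmult_1_l. apply l1_pos. }
  assert (0 < / eta) by (apply Rinv_0_lt_compat; auto).
  assert (H' : Rabs (dist_set K x y / eta - dist_set K x' y' / eta) <= / eta * l1 x y x' y').
  { replace (dist_set K x y / eta - dist_set K x' y' / eta) with (/ eta * (dist_set K x y - dist_set K x' y')) by (field; lra).
    rewrite Rabs_mult, (Rabs_right (/ eta)) by lra. apply Rmult_le_compat_l; lra. }
  unfold cut. revert H'. generalize (dist_set K x y / eta) (dist_set K x' y' / eta) (/ eta * l1 x y x' y').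
  intros r s t Hr. apply Rabs_le_between in Hr.
  apply Rabs_le. unfold Rmin. destruct (Rle_dec 1 r), (Rle_dec 1 s); lra.
Qed.

Lemma cut_lt_1 (eta x y : R) : 0 < eta -> cut K eta x y < 1 -> exists x' y', K x' y' /\ l1 x y x' y' < eta.
Proof.
  intros He H. unfold cut in H.
  assert (Hd : dist_set K x y < eta).
  { apply Rnot_le_lt. intro Hle. unfold Rmin in H. destruct (Rle_dec 1 (dist_set K x y / eta)) as [h|h]; [lra|].
    apply h. apply (Rmult_le_reg_r eta); auto. unfold Rdiv. rewrite Rmult_assoc, Rinv_l; lra. }
  destruct (proj2 (dist_set_glb x y) (eta - dist_set K x y) ltac:(lra)) as [x' [y' [Hk H']]].
  exists x', y'. split; auto. lra.
Qed.

Lemma cut_le (eta x y x' y' : R) : 0 < eta -> K x' y' -> cut K eta x y <= l1 x y x' y' / eta.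
Proof.
  intros He Hk. unfold cut. eapply Rle_trans; [apply Rmin_r|].
  apply Rmult_le_compat_r. apply Rlt_le, Rinv_0_lt_compat; auto. apply (proj1 (dist_set_glb x y)); auto.
Qed.

(** In [quartering_bound] this keeps the difference of the integrals for [eta] and [e] nonnegative
    on rectangles that miss [K]. *)
Lemma cut_mono (eta eta' x y : R) : 0 < eta' -> eta' <= eta -> cut K eta x y <= cut K eta' x y.
Proof.
  intros He Hle. unfold cut. apply Rle_min_compat_l.
  apply Rmult_le_compat_l; [apply dist_set_pos|]. apply Rinv_le_contravar; auto.
Qed.

End Cut.

Definition iter_int (F : R -> R -> R) (a b c d : R) : R :=
  RInt (fun x => RInt (fun y => F x y) c d) a b.

(* Summing both orders of integration spares Fubini's theorem. *)
Definition sym_int (F : R -> R -> R) (a b c d : R) : R :=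
  iter_int F a b c d + iter_int (swap F) c d a b.

(** The inner integral is again Lipschitz in the parameter, which gives existence of the outer one.
    For this reason iterated integrals are only taken of Lipschitz functions. *)
Lemma lip_param (L : R) (F : R -> R -> R) (c d x x' : R) : 0 <= L -> lip L F -> c <= d ->
  Rabs (RInt (fun y => F x y) c d - RInt (fun y => F x' y) c d) <= (L * (d - c)) * Rabs (x - x').
Proof.
  intros HL HF Hcd. assert (HC := lip_cont2 L F HL HF).
  rewrite <- RInt_sub by auto with rint.
  eapply Rle_trans; [apply abs_RInt_le_const with (M := L * Rabs (x - x')); auto with rint|].
  - intros y _. eapply Rle_trans; [apply HF|]. unfold l1. rewrite Rminus_diag, Rabs_R0, Rplus_0_r. lra.
  - right; ring.
Qed.

Lemma lipschitz_continuous (L : R) (f : R -> R) : 0 <= L ->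
  (forall x x', Rabs (f x - f x') <= L * Rabs (x - x')) -> forall x, continuous f x.
Proof.
  intros HL H x. apply continuous_of_eps. intros eps He.
  assert (0 < eps / (L + 1)) by (apply Rdiv_lt_0_compat; lra).
  exists (eps / (L + 1)). split; auto.
  intros x' Hx'. eapply Rle_lt_trans; [apply H|].
  assert (eps / (L + 1) * (L + 1) = eps) by (field; lra). assert (H' := Rabs_pos (x' - x)). nra.
Qed.

Lemma iter_ex (L : R) (F : R -> R -> R) (a b c d : R) : 0 <= L -> lip L F ->
  ex_RInt (fun x => RInt (fun y => F x y) c d) a b.
Proof.
  intros HL HF. assert (HC := lip_cont2 L F HL HF).
  apply ex_RInt_cont. destruct (Rle_dec c d) as [Hcd|Hcd].
  - apply (lipschitz_continuous (L * (d - c))).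
    + apply Rmult_le_pos; lra.
    + intros. apply lip_param; auto.
  - apply (lipschitz_continuous (L * (c - d))).
    + apply Rmult_le_pos; lra.
    + intros x x'. assert (H := lip_param L F d c x x' HL HF ltac:(lra)).
      rewrite <- (opp_RInt_swap (V := R_CompleteNormedModule) (fun y => F x y) d c) by auto with rint.
      rewrite <- (opp_RInt_swap (V := R_CompleteNormedModule) (fun y => F x' y) d c) by auto with rint.
      revert H. unfold opp; simpl.
      match goal with |- Rabs (?u - ?v) <= _ -> _ => replace (- u - - v) with (- (u - v)) by ring end.
      rewrite Rabs_Ropp. auto.
Qed.

Lemma iter_le (L L' : R) (F G : R -> R -> R) (a b c d : R) : 0 <= L -> lip L F -> 0 <= L' -> lip L' G ->
  a <= b -> c <= d -> (forall x y, in_rect a b c d x y -> F x y <= G x y) ->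
  iter_int F a b c d <= iter_int G a b c d.
Proof.
  intros HL HF HL' HG Hab Hcd H.
  assert (HC := lip_cont2 L F HL HF). assert (HC' := lip_cont2 L' G HL' HG).
  apply RInt_le; auto.
  - apply (iter_ex L); auto.
  - apply (iter_ex L'); auto.
  - intros x Hx. apply RInt_le; auto with rint. intros y Hy. apply H. split; lra.
Qed.

Lemma iter_cst (k a b c d : R) : iter_int (fun _ _ => k) a b c d = k * ((b - a) * (d - c)).
Proof. unfold iter_int. rewrite (RInt_eq _ (fun _ => (d - c) * k)) by (intros; apply RInt_cst). rewrite RInt_cst. ring. Qed.

Lemma lip_cst (k : R) : lip 0 (fun _ _ => k).
Proof. intros x y x' y'. rewrite Rminus_diag, Rabs_R0. lra. Qed.

Lemma iter_split_x (L : R) (F : R -> R -> R) (a m b c d : R) : 0 <= L -> lip L F ->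
  iter_int F a b c d = iter_int F a m c d + iter_int F m b c d.
Proof. intros HL HF. apply RInt_split; apply (iter_ex L); auto. Qed.

Lemma iter_split_y (L : R) (F : R -> R -> R) (a b c m d : R) : 0 <= L -> lip L F ->
  iter_int F a b c d = iter_int F a b c m + iter_int F a b m d.
Proof.
  intros HL HF. assert (HC := lip_cont2 L F HL HF). unfold iter_int.
  rewrite <- RInt_add by (apply (iter_ex L); auto).
  apply RInt_eq. intros x. apply RInt_split; auto with rint.
Qed.

Lemma sym_split_x (L : R) (F : R -> R -> R) (a m b c d : R) : 0 <= L -> lip L F ->
  sym_int F a b c d = sym_int F a m c d + sym_int F m b c d.
Proof.
  intros HL HF. unfold sym_int.
  rewrite (iter_split_x L F a m b), (iter_split_y L (swap F) c d a m b) by auto using lip_swap. ring.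
Qed.

Lemma sym_split_y (L : R) (F : R -> R -> R) (a b c m d : R) : 0 <= L -> lip L F ->
  sym_int F a b c d = sym_int F a b c m + sym_int F a b m d.
Proof.
  intros HL HF. unfold sym_int.
  rewrite (iter_split_y L F a b c m d), (iter_split_x L (swap F) c m d) by auto using lip_swap. ring.
Qed.

Lemma sym_le (L L' : R) (F G : R -> R -> R) (a b c d : R) : 0 <= L -> lip L F -> 0 <= L' -> lip L' G ->
  a <= b -> c <= d -> (forall x y, in_rect a b c d x y -> F x y <= G x y) ->
  sym_int F a b c d <= sym_int G a b c d.
Proof.
  intros HL HF HL' HG Hab Hcd H. apply Rplus_le_compat.
  - apply (iter_le L L'); auto.
  - apply (iter_le L L'); auto using lip_swap. intros x y [Hx Hy]. apply H. split; lra.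
Qed.

Lemma sym_cst (k a b c d : R) : sym_int (fun _ _ => k) a b c d = 2 * (k * ((b - a) * (d - c))).
Proof. unfold sym_int, swap. rewrite !iter_cst. ring. Qed.

Lemma sym_sub (L L' : R) (F : R -> R -> R) (a b c d a' b' c' d' : R) : 0 <= L -> lip L F ->
  (forall x y, 0 <= F x y) -> a <= a' -> a' <= b' -> b' <= b -> c <= c' -> c' <= d' -> d' <= d ->
  sym_int F a' b' c' d' <= sym_int F a b c d.
Proof.
  intros HL HF HP H1 H2 H3 H4 H5 H6.
  assert (P : forall a b c d, a <= b -> c <= d -> 0 <= sym_int F a b c d).
  { intros. replace 0 with (2 * (0 * ((b0 - a0) * (d0 - c0)))) by ring. rewrite <- sym_cst.
    apply (sym_le 0 L); auto using lip_cst; lra. }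
  rewrite (sym_split_x L F a a' b), (sym_split_x L F a' b' b), (sym_split_y L F a' b' c c' d), (sym_split_y L F a' b' c' d' d) by auto.
  assert (Q1 := P a a' c d ltac:(lra) ltac:(lra)).
  assert (Q2 := P b' b c d ltac:(lra) ltac:(lra)).
  assert (Q3 := P a' b' c c' ltac:(lra) ltac:(lra)).
  assert (Q4 := P a' b' d' d ltac:(lra) ltac:(lra)). lra.
Qed.

Lemma RInt_shift (f : R -> R) (h a b : R) : (forall x, continuous f x) ->
  RInt (fun x => f (x + h)) a b = RInt f (a + h) (b + h).
Proof.
  intros H. assert (E := RInt_comp_lin (V := R_CompleteNormedModule) f 1 h a b).
  rewrite !Rmult_1_l in E. rewrite <- E by (apply ex_RInt_cont; auto).
  apply (RInt_ext (V := R_CompleteNormedModule)). intros x _. unfold scal; simpl; unfold mult; simpl.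
  rewrite !Rmult_1_l. reflexivity.
Qed.

(** The integral telescopes to the one over [[b, b + h]] minus the one over [[a, a + h]], and [f]
    varies by at most [L * h] on each of these intervals. *)
Lemma RInt_difference_quotient (L : R) (f : R -> R) (h a b : R) : 0 <= L -> 0 < h ->
  (forall x x', Rabs (f x - f x') <= L * Rabs (x - x')) ->
  Rabs (RInt (fun x => f (x + h) - f x) a b - h * (f b - f a)) <= 2 * L * h * h.
Proof.
  intros HL Hh Hf. assert (HC := lipschitz_continuous L f HL Hf).
  assert (Hex : forall u v, ex_RInt f u v) by (intros; apply ex_RInt_cont; auto).
  assert (Hs : forall x, continuous (fun x => f (x + h)) x).
  { apply (lipschitz_continuous L); auto. intros x x'. eapply Rle_trans; [apply Hf|]. right. f_equal. f_equal. ring. }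
  rewrite RInt_sub by (apply ex_RInt_cont; auto). rewrite RInt_shift by auto.
  assert (E1 := RInt_split f (a + h) b (b + h) (Hex _ _) (Hex _ _)).
  assert (E2 := RInt_split f a (a + h) b (Hex _ _) (Hex _ _)).
  assert (T : forall u, Rabs (RInt f u (u + h) - h * f u) <= L * h * h).
  { intros u. assert (E : h * f u = RInt (fun _ => f u) u (u + h)) by (rewrite RInt_cst; lra).
    rewrite E.
    rewrite <- RInt_sub by auto with rint.
    eapply Rle_trans; [apply abs_RInt_le_const with (M := L * h); auto with rint; try lra|].
    - intros t Ht. eapply Rle_trans; [apply Hf|]. apply Rmult_le_compat_l; auto. rewrite Rabs_right; lra.
    - right; ring. }
  assert (T1 := T a). assert (T2 := T b). apply Rabs_le_between in T1, T2. apply Rabs_le. lra.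
Qed.

(** A divergence theorem without derivatives: [h] times the flux is the double integral of the
    increments of step [h], up to layers of thickness [h] at the sides. A Lipschitz field need not
    have partial derivatives everywhere, so the step stays positive. *)
Lemma lip_flux_bound (N L h : R) (F G W : R -> R -> R) (a b c d : R) :
  0 <= N -> lip N F -> lip N G -> 0 <= L -> lip L W -> 0 < h -> a <= b -> c <= d ->
  (forall x y, in_rect a b c d x y ->
     Rabs (F (x + h) y - F x y + (G x (y + h) - G x y)) <= h * W x y) ->
  Rabs (flux F G a b c d) <= iter_int W a b c d + 2 * N * h * (b - a + (d - c)).
Proof.
  intros HN HF HG HL HW Hh Hab Hcd H.
  assert (CF := lip_cont2 N F HN HF). assert (CG := lip_cont2 N G HN HG). assert (CW := lip_cont2 L W HL HW).
  assert (HFh := lip_shift N F h 0 HF). assert (HGh := lip_shift N G 0 h HG).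
  assert (CFh : cont2 (fun x y => F (x + h) (y + 0))) by (apply (lip_cont2 N); auto).
  assert (CGh : cont2 (fun x y => G (x + 0) (y + h))) by (apply (lip_cont2 N); auto).
  set (D1 := fun x => RInt (fun y => F (x + h) y) c d - RInt (fun y => F x y) c d).
  set (D2 := fun x => RInt (fun y => G x (y + h)) c d - RInt (fun y => G x y) c d).
  assert (EF : ex_RInt (fun x => RInt (fun y => F (x + h) y) c d) a b).
  { apply (ex_RInt_ext (V := R_NormedModule) (fun x => RInt (fun y => F (x + h) (y + 0)) c d)).
    - intros x _. apply RInt_eq. intros y. rewrite Rplus_0_r. reflexivity.
    - apply (iter_ex N (fun x y => F (x + h) (y + 0))); auto. }
  assert (EG : ex_RInt (fun x => RInt (fun y => G x (y + h)) c d) a b).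
  { apply (ex_RInt_ext (V := R_NormedModule) (fun x => RInt (fun y => G (x + 0) (y + h)) c d)).
    - intros x _. apply RInt_eq. intros y. rewrite Rplus_0_r. reflexivity.
    - apply (iter_ex N (fun x y => G (x + 0) (y + h))); auto. }
  assert (ED1 : ex_RInt D1 a b).
  { apply ex_RInt_sub; auto. apply (iter_ex N); auto. }
  assert (ED2 : ex_RInt D2 a b).
  { apply ex_RInt_sub; auto. apply (iter_ex N); auto. }
  (* For increments in [x], telescoping is applied to the column integrals, which have Lipschitz
     constant [N * (d - c)]; for increments in [y], in [S2], it is applied inside each column. Thus
     no exchange of integrals occurs. *)
  assert (S1 : Rabs (RInt D1 a b - h * RInt (fun y => F b y - F a y) c d) <= 2 * N * h * h * (d - c)).
  { rewrite (RInt_sub (fun y => F b y)) by auto with rint.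
    assert (T := RInt_difference_quotient (N * (d - c)) (fun x => RInt (fun y => F x y) c d) h a b
      ltac:(apply Rmult_le_pos; lra) Hh ltac:(intros; apply lip_param; auto)).
    cbv beta in T. replace (2 * N * h * h * (d - c)) with (2 * (N * (d - c)) * h * h) by ring.
    exact T. }
  assert (S2 : Rabs (RInt D2 a b - h * RInt (fun x => G x d - G x c) a b) <= 2 * N * h * h * (b - a)).
  { rewrite <- RInt_mult by auto with rint. rewrite <- RInt_sub by auto with rint.
    eapply Rle_trans; [apply abs_RInt_le_const with (M := 2 * N * h * h); auto with rint|right; ring].
    intros x _. unfold D2.
    rewrite <- RInt_sub.
    - apply (RInt_difference_quotient N (fun y => G x y)); auto.
      intros y y'. eapply Rle_trans; [apply HG|]. unfold l1. rewrite Rminus_diag, Rabs_R0, Rplus_0_l. lra.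
    - apply ex_RInt_cont. intros y. apply (continuous_ext (fun y => G (x + 0) (y + h))).
      + intros; rewrite Rplus_0_r; auto.
      + apply (cont2_y (fun x y => G (x + 0) (y + h))); auto.
    - auto with rint. }
  assert (S3 : Rabs (RInt (fun x => D1 x + D2 x) a b) <= h * iter_int W a b c d).
  { unfold iter_int. rewrite <- RInt_mult by (apply (iter_ex L); auto).
    apply RInt_abs_le; auto with rint.
    - apply ex_RInt_mult. apply (iter_ex L); auto.
    - intros x Hx. rewrite <- RInt_mult by auto with rint. unfold D1, D2.
      assert (ex_RInt (fun y => G x (y + h)) c d).
      { apply ex_RInt_cont. intros y. apply (continuous_ext (fun y => G (x + 0) (y + h))).
        - intros; rewrite Rplus_0_r; auto.
        - apply (cont2_y (fun x y => G (x + 0) (y + h))); auto. }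
      rewrite <- !RInt_sub, <- RInt_add by auto with rint.
      apply RInt_abs_le; auto with rint. intros y Hy. apply H. split; auto. }
  rewrite RInt_add in S3 by auto.
  assert (Hfl : Rabs (h * flux F G a b c d) <= h * (iter_int W a b c d + 2 * N * h * (b - a + (d - c)))).
  { unfold flux. apply Rabs_le_between in S1, S2, S3. apply Rabs_le. lra. }
  rewrite Rabs_mult, (Rabs_right h) in Hfl by lra.
  apply Rmult_le_reg_l in Hfl; auto.
Qed.

(** * Flux through rectangles meeting a closed set *)

Definition closed_in_rect (K : R -> R -> Prop) (a b c d : R) : Prop :=
  forall x y, in_rect a b c d x y ->
    (forall del, 0 < del -> exists x' y', K x' y' /\ near del x y x' y') -> K x y.

(** Giving [f] a value below its range at the points off [K] leaves it upper semicontinuous because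
    [K] is closed, so [usc_attains_max] applies. *)
Lemma closed_set_max (K : R -> R -> Prop) (f : R -> R -> R) (a b c d : R) : cont2 f ->
  closed_in_rect K a b c d -> (exists x y, K x y /\ in_rect a b c d x y) ->
  exists x y, K x y /\ in_rect a b c d x y /\
    forall x' y', K x' y' -> in_rect a b c d x' y' -> f x' y' <= f x y.
Proof.
  intros Hf HK [x0 [y0 [H0 Hin0]]].
  destruct (cont2_bounded f a b c d Hf) as [B [HB0 HB]].
  set (F := fun x y => if excluded_middle_informative (K x y) then f x y else - (B + 1)).
  destruct (usc_attains_max F a b c d) as [x [y [Hin Hmax]]].
  - destruct Hin0; lra.
  - destruct Hin0; lra.
  - intros x y v Hin Hv. unfold F in Hv. destruct (excluded_middle_informative (K x y)) as [Hk|Hk].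
    + destruct (cont2_near f x y (v - f x y) (Hf x y) ltac:(lra)) as [del [Hd H]].
      exists del; split; auto. intros x' y' Hin' Hn. unfold F.
      destruct (excluded_middle_informative (K x' y')).
      * assert (H' := H x' y' Hn). apply Rabs_def2 in H'. lra.
      * assert (H' := HB x y Hin). apply Rabs_le_between in H'. lra.
    + apply NNPP. intro Hno. apply Hk, HK; auto. intros del Hdel. apply NNPP. intro Hno'.
      apply Hno. exists del; split; auto. intros x' y' Hin' Hn. unfold F.
      destruct (excluded_middle_informative (K x' y')); auto.
      exfalso. apply Hno'. exists x', y'; auto.
  - exists x, y. assert (H := Hmax x0 y0 Hin0). unfold F in H, Hmax.
    destruct (excluded_middle_informative (K x0 y0)) as [_|]; [|contradiction].
    destruct (excluded_middle_informative (K x y)) as [Hk|Hk].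
    + repeat split; try apply Hin; auto. intros x' y' Hk' Hin'. assert (H' := Hmax x' y' Hin').
      destruct (excluded_middle_informative (K x' y')); auto; contradiction.
    + assert (H' := HB x0 y0 Hin0). apply Rabs_le_between in H'. lra.
Qed.

(* On a column avoiding the [eta]-neighbourhood of [K] the integral of [chi] is the full height [d - c]; otherwise [K] comes within about that integral of the side. *)
Lemma side_bound (K : R -> R -> Prop) (g gt chi : R -> R -> R) (N kap eta om a b c d A B C D x y0 x1 : R) :
  cont2 chi -> (forall x y, 0 <= chi x y) -> 0 < eta ->
  (forall x y, chi x y < 1 -> exists x' y', K x' y' /\ l1 x y x' y' < eta) ->
  0 <= N -> lip N gt -> (forall x y, K x y -> gt x y = g x y) ->
  (forall x y, K x y -> in_rect A B C D x y) ->
  (forall x y x', K x y -> A <= x' <= B -> Rabs (g x' y - g x y) <= N * Rabs (x' - x)) ->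
  (forall x y y', K x y -> C <= y' <= D -> Rabs (g x y' - g x y) <= N * Rabs (y' - y)) ->
  A <= a -> b <= B -> C <= c -> d <= D -> c <= d ->
  1 <= kap -> b - a <= kap * (d - c) ->
  a <= x <= b -> c <= y0 <= d -> a <= x1 <= b -> K x1 y0 ->
  (forall x', A <= x' <= B -> Rabs (x - x') < eta -> Rabs (g x y0 - g x' y0) <= om) ->
  0 <= om ->
  Rabs (g x y0 - gt x y0) <= 2 * N * kap * RInt (fun y => chi x y) c d + 5 * N * eta + om.
Proof.
  intros Hchi Hpos Heta Hlt HN Hgt Hext HKQ HX HY HA HB HC HD Hcd Hkap Hab Hx Hy0 Hx1 HK1 Hom Hom0.
  set (m := RInt (fun y => chi x y) c d).
  assert (Hm : 0 <= m).
  { unfold m. apply RInt_ge_0; auto with rint. }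
  assert (HNe : 0 <= N * eta) by (apply Rmult_le_pos; lra).
  assert (Hsub : forall u v, c <= u -> u <= v -> v <= d -> (forall y, u < y < v -> 1 <= chi x y) -> v - u <= m).
  { intros u v U1 U2 U3 U4. unfold m.
    rewrite (RInt_split _ c u d), (RInt_split _ u v d) by auto with rint.
    assert (0 <= RInt (fun y => chi x y) c u) by (apply RInt_ge_0; auto with rint).
    assert (0 <= RInt (fun y => chi x y) v d) by (apply RInt_ge_0; auto with rint).
    assert (RInt (fun _ => 1) u v <= RInt (fun y => chi x y) u v) by (apply RInt_le; auto with rint).
    rewrite RInt_cst in H1. lra. }
  destruct (classic (exists y, c <= y <= d /\ chi x y < 1)) as [[y [Hy Hlt1]]|Hno].
  (* Otherwise [chi] would be at least 1 on a segment of length [m + eta] starting at [y0], although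
     its integral over the column is only [m]. *)
  - assert (Hnear : exists y, c <= y <= d /\ chi x y < 1 /\ Rabs (y - y0) <= m + eta).
    { apply NNPP. intro Hno.
      assert (Hfar : m + eta < Rabs (y - y0)).
      { apply Rnot_le_lt. intro. apply Hno. exists y; auto. }
      assert (H1 : forall y', c <= y' <= d -> Rabs (y' - y0) <= m + eta -> 1 <= chi x y').
      { intros y' Hy' Hd. apply Rnot_lt_le. intro. apply Hno. exists y'; auto. }
      destruct (Rle_dec y0 y) as [Hle|Hle].
      - rewrite Rabs_right in Hfar by lra.
        assert (y0 + (m + eta) - y0 <= m); [|lra].
        apply Hsub; try lra. intros y' Hy'. apply H1; try lra. rewrite Rabs_right; lra.
      - rewrite Rabs_left in Hfar by lra.
        assert (y0 - (y0 - (m + eta)) <= m); [|lra].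
        apply Hsub; try lra. intros y' Hy'. apply H1; try lra. rewrite Rabs_left; lra. }
    clear y Hy Hlt1. destruct Hnear as [y [Hy [Hlt1 Hd]]].
    destruct (Hlt x y Hlt1) as [x' [y' [HK' Hl]]].
    assert (HQ := HKQ x' y' HK'). destruct HQ as [HQ1 HQ2].
    unfold l1 in Hl. assert (P1 := Rabs_pos (x - x')). assert (P2 := Rabs_pos (y - y')).
    (* From [g] to [gt] at [(x, y0)]: move to the column of [x'] at cost [om], follow it to the
       point [(x', y')] of [K], where [g] and [gt] agree, and return by the Lipschitz bound of [gt].
       The lengths, at most [m + 2 * eta] and [m + 3 * eta], explain the constants 2 and 5. *)
    assert (T1 := Hom x' HQ1 ltac:(lra)).
    assert (T2 := HY x' y' y0 HK' ltac:(lra)).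
    assert (T3 := Hgt x' y' x y0). rewrite (Hext x' y' HK') in T3. unfold l1 in T3.
    assert (D1 : Rabs (y' - y0) <= m + 2 * eta).
    { replace (y' - y0) with ((y - y0) - (y - y')) by ring.
      eapply Rle_trans; [apply Rabs_triang|]. rewrite Rabs_Ropp. lra. }
    rewrite Rabs_minus_sym in T2. rewrite (Rabs_minus_sym y0) in T2.
    assert (Q1 : N * Rabs (y' - y0) <= N * (m + 2 * eta)) by (apply Rmult_le_compat_l; auto).
    assert (Q2 : N * (Rabs (x' - x) + Rabs (y' - y0)) <= N * (eta + (m + 2 * eta))).
    { apply Rmult_le_compat_l; auto. rewrite (Rabs_minus_sym x' x). lra. }
    assert (Q3 : N * m <= N * kap * m).
    { rewrite Rmult_assoc. apply Rmult_le_compat_l; auto. rewrite <- (Rmult_1_l m) at 1. apply Rmult_le_compat_r; lra. }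
    apply Rabs_le_between in T1, T2, T3. apply Rabs_le. lra.
  (* Now the comparison goes through [(x1, y0)], at distance at most
     [b - a <= kap * (d - c) <= kap * m]. This is where the proportions of the rectangle enter. *)
  - assert (Hfull : d - c <= m).
    { apply Hsub; try lra. intros y Hy. apply Rnot_lt_le. intro. apply Hno. exists y. split; lra. }
    assert (T1 := HX x1 y0 x HK1 ltac:(lra)).
    assert (T3 := Hgt x1 y0 x y0). rewrite (Hext x1 y0 HK1) in T3. unfold l1 in T3.
    rewrite Rminus_diag, Rabs_R0, Rplus_0_r, (Rabs_minus_sym x1) in T3.
    assert (Hs : Rabs (x - x1) <= kap * m).
    { apply Rle_trans with (b - a); [apply Rabs_le; lra|]. apply Rle_trans with (kap * (d - c)); auto.
      apply Rmult_le_compat_l; lra. }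
    assert (N * Rabs (x - x1) <= N * (kap * m)) by (apply Rmult_le_compat_l; auto).
    apply Rabs_le_between in T1, T3. apply Rabs_le. lra.
Qed.

Lemma lip_add (L L' : R) (F G : R -> R -> R) : lip L F -> lip L' G -> lip (L + L') (fun x y => F x y + G x y).
Proof.
  intros HF HG x y x' y'. replace (F x y + G x y - (F x' y' + G x' y')) with
    ((F x y - F x' y') + (G x y - G x' y')) by ring.
  eapply Rle_trans; [apply Rabs_triang|]. assert (H1 := HF x y x' y'). assert (H2 := HG x y x' y'). lra.
Qed.

Lemma lip_scale (L k : R) (F : R -> R -> R) : 0 <= k -> lip L F -> lip (k * L) (fun x y => k * F x y).
Proof.
  intros Hk HF x y x' y'. rewrite <- Rmult_minus_distr_l, Rabs_mult, (Rabs_right k) by lra.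
  rewrite Rmult_assoc. apply Rmult_le_compat_l; auto.
Qed.

Lemma iter_add (L L' : R) (F G : R -> R -> R) (a b c d : R) : 0 <= L -> lip L F -> 0 <= L' -> lip L' G ->
  iter_int (fun x y => F x y + G x y) a b c d = iter_int F a b c d + iter_int G a b c d.
Proof.
  intros HL HF HL' HG. assert (HC := lip_cont2 L F HL HF). assert (HC' := lip_cont2 L' G HL' HG).
  unfold iter_int. rewrite <- RInt_add by (eapply iter_ex; [|eassumption]; auto).
  apply RInt_eq. intros x. apply RInt_add; auto with rint.
Qed.

Lemma iter_scale (L k : R) (F : R -> R -> R) (a b c d : R) : 0 <= L -> lip L F ->
  iter_int (fun x y => k * F x y) a b c d = k * iter_int F a b c d.
Proof.
  intros HL HF. assert (HC := lip_cont2 L F HL HF).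
  unfold iter_int. rewrite <- RInt_mult by (eapply iter_ex; [|eassumption]; auto).
  apply RInt_eq. intros x. apply RInt_mult; auto with rint.
Qed.

Lemma RInt_shift_le (f : R -> R) (s M u v : R) : (forall x, continuous f x) -> 0 < s -> u <= v ->
  (forall x, 0 <= f x <= M) -> RInt (fun x => f (x + s)) u v <= RInt f u v + s * M.
Proof.
  intros Hf Hs Huv HM. rewrite RInt_shift by auto.
  assert (Hex : forall u v, ex_RInt f u v) by (intros; apply ex_RInt_cont; auto).
  assert (E1 := RInt_split f u (u + s) (v + s) (Hex _ _) (Hex _ _)).
  assert (E2 := RInt_split f u v (v + s) (Hex _ _) (Hex _ _)).
  assert (H1 : 0 <= RInt f u (u + s)) by (apply RInt_ge_0; auto; [lra|intros; apply HM]).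
  assert (H2 : RInt f v (v + s) <= RInt (fun _ => M) v (v + s)) by (apply RInt_le; auto with rint; [lra|intros; apply HM]).
  rewrite RInt_cst in H2. lra.
Qed.

Lemma iter_shift_x (L s : R) (F : R -> R -> R) (a b c d : R) : 0 <= L -> lip L F ->
  (forall x y, 0 <= F x y <= 1) -> a <= b -> c <= d -> 0 < s ->
  iter_int (fun x y => F (x + s) y) a b c d <= iter_int F a b c d + s * (d - c).
Proof.
  intros HL HF HB Hab Hcd Hs. assert (HC := lip_cont2 L F HL HF).
  apply (RInt_shift_le (fun x => RInt (fun y => F x y) c d)); auto.
  - apply (lipschitz_continuous (L * (d - c))); [apply Rmult_le_pos; lra|].
    intros; apply lip_param; auto.
  - intros x. split; [apply RInt_ge_0; auto with rint; intros; apply HB|].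
    assert (H : RInt (fun y => F x y) c d <= RInt (fun _ => 1) c d)
      by (apply RInt_le; auto with rint; intros; apply HB).
    rewrite RInt_cst in H. lra.
Qed.

Lemma lip_shift_x (L s : R) (F : R -> R -> R) : lip L F -> lip L (fun x y => F (x + s) y).
Proof. intros H x y x' y'. eapply Rle_trans; [apply H|]. right. unfold l1. f_equal. f_equal; f_equal; ring. Qed.

Lemma lip_shift_y (L s : R) (F : R -> R -> R) : lip L F -> lip L (fun x y => F x (y + s)).
Proof. intros H x y x' y'. eapply Rle_trans; [apply H|]. right. unfold l1. f_equal. f_equal; f_equal; ring. Qed.

Lemma iter_shift_y (L s : R) (F : R -> R -> R) (a b c d : R) : 0 <= L -> lip L F ->
  (forall x y, 0 <= F x y <= 1) -> a <= b -> c <= d -> 0 < s ->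
  iter_int (fun x y => F x (y + s)) a b c d <= iter_int F a b c d + s * (b - a).
Proof.
  intros HL HF HB Hab Hcd Hs. assert (HC := lip_cont2 L F HL HF).
  assert (HFs := lip_shift_y L s F HF).
  assert (E : ex_RInt (fun x => RInt (fun y => F x y) c d) a b) by (apply (iter_ex L); auto).
  apply Rle_trans with (RInt (fun x => RInt (fun y => F x y) c d + s) a b).
  - apply RInt_le; auto with rint.
    + apply (iter_ex L (fun x y => F x (y + s))); auto.
    + intros x _. apply Rle_trans with (RInt (fun y => F x y) c d + s * 1); [|lra].
      apply (RInt_shift_le (fun y => F x y)); auto.
      intros; apply cont2_y; auto.
  - rewrite RInt_add by auto with rint. rewrite RInt_cst. unfold iter_int. lra.
Qed.

(** * The flux estimate on a portion where the difference quotients are uniformly bounded *)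

Section Key.

Variables (p q : R -> R -> R) (K : R -> R -> Prop) (A B C D N eps : R).
Hypothesis Hp : cont2 p.
Hypothesis Hq : cont2 q.
Hypothesis HN : 0 <= N.
Hypothesis Heps : 0 <= eps.
Hypothesis HKne : exists x y, K x y.
Hypothesis HKQ : forall x y, K x y -> in_rect A B C D x y.
Hypothesis HKcl : closed_in_rect K A B C D.
Hypothesis HpX : forall x y x', K x y -> A <= x' <= B -> Rabs (p x' y - p x y) <= N * Rabs (x' - x).
Hypothesis HpY : forall x y y', K x y -> C <= y' <= D -> Rabs (p x y' - p x y) <= N * Rabs (y' - y).
Hypothesis HqX : forall x y x', K x y -> A <= x' <= B -> Rabs (q x' y - q x y) <= N * Rabs (x' - x).
Hypothesis HqY : forall x y y', K x y -> C <= y' <= D -> Rabs (q x y' - q x y) <= N * Rabs (y' - y).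
Hypothesis Hdiv : forall x y h, K x y -> 0 < h -> x + h <= B -> y + h <= D ->
  Rabs (p (x + h) y - p x y + (q x (y + h) - q x y)) <= eps * h.
Hypothesis Hfree : forall a b c d, A <= a -> a <= b -> b <= B -> C <= c -> c <= d -> d <= D ->
  (forall x y, a < x < b -> c < y < d -> ~ K x y) ->
  Rabs (flux p q a b c d) <= eps * ((b - a) * (d - c)).

(** The path between two points of [K] turns at [(x', y)], which may lie off [K]; each leg is still
    controlled, because it starts at its own end point in [K]. *)
Let cross_lip (g : R -> R -> R) :
  (forall x y x', K x y -> A <= x' <= B -> Rabs (g x' y - g x y) <= N * Rabs (x' - x)) ->
  (forall x y y', K x y -> C <= y' <= D -> Rabs (g x y' - g x y) <= N * Rabs (y' - y)) ->
  forall x y x' y', K x y -> K x' y' -> Rabs (g x y - g x' y') <= N * l1 x y x' y'.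
Proof.
  intros HX HY x y x' y' H H'.
  assert (Q := HKQ x y H). assert (Q' := HKQ x' y' H').
  assert (T1 := HX x y x' H (proj1 Q')). assert (T2 := HY x' y' y H' (proj2 Q)).
  unfold l1. rewrite (Rabs_minus_sym x x').
  apply Rabs_le_between in T1, T2. apply Rabs_le. lra.
Qed.

Let pt := mcshane K p N.
Let qt := mcshane K q N.

Let pt_lip : lip N pt.
Proof. apply mcshane_lip; auto. Qed.
Let qt_lip : lip N qt.
Proof. apply mcshane_lip; auto. Qed.
Let pt_ext x y : K x y -> pt x y = p x y.
Proof. apply mcshane_ext; auto. Qed.
Let qt_ext x y : K x y -> qt x y = q x y.
Proof. apply mcshane_ext; auto. Qed.
Let Cpt : cont2 pt.
Proof. apply (lip_cont2 N); auto. Qed.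
Let Cqt : cont2 qt.
Proof. apply (lip_cont2 N); auto. Qed.

(* Near [K] the difference quotients of the extensions are those of [p] and [q] up to the modulus of continuity [om]; elsewhere they are at most [2 N]. *)
Lemma extension_divergence (x y h eta om : R) : 0 < h -> 0 < eta -> 0 <= om ->
  x + h + eta <= B -> y + h + eta <= D ->
  (forall x y x' y', in_rect A B C D x y -> in_rect A B C D x' y' -> l1 x y x' y' < 2 * eta ->
     Rabs (p x y - p x' y') <= om /\ Rabs (q x y - q x' y') <= om) ->
  Rabs (pt (x + h) y - pt x y + (qt x (y + h) - qt x y)) <=
    h * (eps + (4 * N * eta + 2 * om) / h +
      2 * N * (cut K eta x y + cut K eta (x + h) y + cut K eta x (y + h))).
Proof.
  intros Hh He Hom0 HxB HyD Hom.
  assert (B0 := cut_bounds K HKne eta x y He).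
  assert (B1 := cut_bounds K HKne eta (x + h) y He).
  assert (B2 := cut_bounds K HKne eta x (y + h) He).
  assert (E0 : h * (eps + (4 * N * eta + 2 * om) / h +
      2 * N * (cut K eta x y + cut K eta (x + h) y + cut K eta x (y + h))) =
      eps * h + (4 * N * eta + 2 * om) +
      N * h * (2 * (cut K eta x y + cut K eta (x + h) y + cut K eta x (y + h)))) by (field; lra).
  rewrite E0. clear E0.
  assert (HNe : 0 <= N * eta) by (apply Rmult_le_pos; lra).
  assert (HNh : 0 <= N * h) by (apply Rmult_le_pos; lra).
  assert (Heh : 0 <= eps * h) by (apply Rmult_le_pos; lra).
  assert (G1 : Rabs (pt (x + h) y - pt x y) <= N * h).
  { eapply Rle_trans; [apply pt_lip|]. unfold l1. rewrite Rminus_diag, Rabs_R0.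
    replace (x + h - x) with h by ring. rewrite Rabs_right; lra. }
  assert (G2 : Rabs (qt x (y + h) - qt x y) <= N * h).
  { eapply Rle_trans; [apply qt_lip|]. unfold l1. rewrite Rminus_diag, Rabs_R0.
    replace (y + h - y) with h by ring. rewrite (Rabs_right h); lra. }
  destruct (Rlt_dec (cut K eta x y) 1) as [L0|L0];
    [destruct (Rlt_dec (cut K eta (x + h) y) 1) as [L1|L1];
      [destruct (Rlt_dec (cut K eta x (y + h)) 1) as [L2|L2]|]|].
  (* All three points lie within [eta] of [K]. The nearby points of [K] do not form an exact step of
     length [h]: those attached to the shifted points are replaced by [(x0 + h, y0)] and
     [(x0, y0 + h)], at distance less than [2 * eta]. This costs [om] twice, and the four passages
     from the extensions to [p] and [q] cost [N * eta] each. *)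
  { destruct (cut_lt_1 K HKne eta _ _ He L0) as [x0 [y0 [K0 N0]]].
    destruct (cut_lt_1 K HKne eta _ _ He L1) as [x1 [y1 [K1 N1]]].
    destruct (cut_lt_1 K HKne eta _ _ He L2) as [x2 [y2 [K2 N2]]].
    assert (Q0 := HKQ _ _ K0). assert (Q1 := HKQ _ _ K1). assert (Q2 := HKQ _ _ K2).
    assert (Z0 : Rabs (x - x0) < eta /\ Rabs (y - y0) < eta).
    { unfold l1 in N0. assert (U := Rabs_pos (x - x0)). assert (V := Rabs_pos (y - y0)). lra. }
    destruct Z0 as [Z1 Z2]. apply Rabs_def2 in Z1, Z2.
    assert (Hd := Hdiv x0 y0 h K0 Hh ltac:(lra) ltac:(lra)).
    assert (M1 : l1 x1 y1 (x0 + h) y0 < 2 * eta).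
    { eapply Rle_lt_trans; [apply (l1_triang _ _ (x + h) y)|]. rewrite l1_sym.
      replace (l1 (x + h) y (x0 + h) y0) with (l1 x y x0 y0) by (unfold l1; do 2 f_equal; ring). lra. }
    assert (M2 : l1 x2 y2 x0 (y0 + h) < 2 * eta).
    { eapply Rle_lt_trans; [apply (l1_triang _ _ x (y + h))|]. rewrite l1_sym.
      replace (l1 x (y + h) x0 (y0 + h)) with (l1 x y x0 y0) by (unfold l1; do 2 f_equal; ring). lra. }
    destruct Q0 as [Q0 Q0'].
    destruct (Hom _ _ (x0 + h) y0 Q1 ltac:(split; lra) M1) as [O1 _].
    destruct (Hom _ _ x0 (y0 + h) Q2 ltac:(split; lra) M2) as [_ O2].
    assert (P0 := pt_lip x y x0 y0). assert (P1 := pt_lip (x + h) y x1 y1).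
    assert (R0 := qt_lip x y x0 y0). assert (R1 := qt_lip x (y + h) x2 y2).
    rewrite (pt_ext x0 y0 K0) in P0. rewrite (pt_ext x1 y1 K1) in P1.
    rewrite (qt_ext x0 y0 K0) in R0. rewrite (qt_ext x2 y2 K2) in R1.
    assert (N * l1 x y x0 y0 <= N * eta) by (apply Rmult_le_compat_l; lra).
    assert (N * l1 (x + h) y x1 y1 <= N * eta) by (apply Rmult_le_compat_l; lra).
    assert (N * l1 x (y + h) x2 y2 <= N * eta) by (apply Rmult_le_compat_l; lra).
    assert (0 <= N * h * (2 * (cut K eta x y + cut K eta (x + h) y + cut K eta x (y + h)))).
    { apply Rmult_le_pos; lra. }
    apply Rabs_le_between in Hd, O1, O2, P0, P1, R0, R1. apply Rabs_le. lra. }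
  (* Otherwise one of the three values of [cut] is 1, and its term alone covers the trivial bound
     [2 * N * h]. *)
  all: assert (N * h * (2 * 1) <= N * h * (2 * (cut K eta x y + cut K eta (x + h) y + cut K eta x (y + h))))
    by (apply Rmult_le_compat_l; lra).
  all: apply Rabs_le_between in G1, G2; apply Rabs_le; lra.
Qed.

(** The three translates of [cut] in the majorant have the same integral up to [h] times a side,
    which gives [6 * N]. These layers and the error of [lip_flux_bound] contribute equally to the
    last term. *)
Lemma extension_flux (a b c d h eta om : R) : 0 < h -> 0 < eta -> 0 <= om ->
  A <= a -> a <= b -> b + h + eta <= B -> C <= c -> c <= d -> d + h + eta <= D ->
  (forall x y x' y', in_rect A B C D x y -> in_rect A B C D x' y' -> l1 x y x' y' < 2 * eta ->
     Rabs (p x y - p x' y') <= om /\ Rabs (q x y - q x' y') <= om) ->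
  Rabs (flux pt qt a b c d) <= (eps + (4 * N * eta + 2 * om) / h) * ((b - a) * (d - c)) +
    6 * N * iter_int (cut K eta) a b c d + 4 * N * h * (b - a + (d - c)).
Proof.
  intros Hh He Hom0 Ha Hab Hb Hc Hcd Hd Hom.
  assert (He' : 0 <= / eta) by (apply Rlt_le, Rinv_0_lt_compat; auto).
  assert (HL := cut_lip K HKne eta He).
  assert (HB : forall x y, 0 <= cut K eta x y <= 1) by (intros; apply cut_bounds; auto).
  assert (HLx := lip_shift_x _ h _ HL). assert (HLy := lip_shift_y _ h _ HL).
  assert (HS := lip_add _ _ _ _ (lip_add _ _ _ _ HL HLx) HLy).
  set (k := eps + (4 * N * eta + 2 * om) / h).
  assert (HS2 := lip_scale _ (2 * N) _ ltac:(lra) HS).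
  assert (HW := lip_add _ _ _ _ (lip_cst k) HS2).
  assert (HS0 : 0 <= / eta + / eta + / eta) by lra.
  assert (HW0 : 0 <= 2 * N * (/ eta + / eta + / eta)) by (apply Rmult_le_pos; lra).
  eapply Rle_trans.
  - apply (lip_flux_bound N _ h pt qt _ a b c d HN pt_lip qt_lip (Rplus_le_le_0_compat _ _ (Rle_refl 0) HW0) HW Hh Hab Hcd).
    intros x y [Hx Hy]. apply extension_divergence; auto; lra.
  - rewrite (iter_add 0 (2 * N * (/ eta + / eta + / eta))) by (auto using lip_cst; lra).
    rewrite (iter_scale (/ eta + / eta + / eta)) by auto.
    rewrite (iter_add (/ eta + / eta) (/ eta)) by (auto using lip_add; lra).
    rewrite (iter_add (/ eta) (/ eta)) by auto.
    rewrite iter_cst.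
    assert (T1 := iter_shift_x _ h _ a b c d He' HL HB Hab Hcd Hh).
    assert (T2 := iter_shift_y _ h _ a b c d He' HL HB Hab Hcd Hh).
    assert (T3 := Rplus_le_compat _ _ _ _ T1 T2).
    apply (Rmult_le_compat_l (2 * N)) in T3; [|lra].
    change (iter_int (fun x y : R => cut K eta x y) a b c d) with (iter_int (cut K eta) a b c d).
    lra.
Qed.

(** The rectangle is cut down to the bounding box of its part of [K]; the frame around it is free of
    [K]. On the box, [p] and [q] are replaced by their extensions: the flux of these accounts for
    [6 * N], and the change on two opposite sides for [4 * N * kap]. Horizontal and vertical sides
    produce different orders of integration, whence [sym_int]. The margin [t0] leaves room for steps
    beyond the right and top sides. *)
Lemma key_bound (a b c d kap tau t0 : R) : 0 < t0 -> A <= a -> a <= b -> b + t0 <= B ->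
  C <= c -> c <= d -> d + t0 <= D -> 1 <= kap -> b - a <= kap * (d - c) -> d - c <= kap * (b - a) ->
  (exists x y, K x y /\ in_rect a b c d x y) -> 0 < tau ->
  exists eta0, 0 < eta0 /\ forall eta, 0 < eta -> eta <= eta0 ->
    Rabs (flux p q a b c d) <= eps * ((b - a) * (d - c)) +
      (6 * N + 4 * N * kap) * sym_int (cut K eta) a b c d + tau.
Proof.
  intros Ht0 Ha Hab Hb Hc Hcd Hd Hkap Hr1 Hr2 Hmeet Htau.
  assert (Hcl : closed_in_rect K a b c d).
  { intros x y [Hx Hy] H. apply HKcl; auto. split; lra. }
  assert (Cx : cont2 (fun x _ => x)) by (intros x y; apply continuity_2d_pt_id1).
  assert (Cy : cont2 (fun _ y => y)) by (intros x y; apply continuity_2d_pt_id2).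
  assert (Cx' : cont2 (fun x _ => - x)) by (intros x y; apply continuity_2d_pt_opp, Cx).
  assert (Cy' : cont2 (fun _ y => - y)) by (intros x y; apply continuity_2d_pt_opp, Cy).
  destruct (closed_set_max K _ a b c d Cx' Hcl Hmeet) as [a' [ya [Ka [Ia Ma]]]].
  destruct (closed_set_max K _ a b c d Cx Hcl Hmeet) as [b' [yb [Kb [Ib Mb]]]].
  destruct (closed_set_max K _ a b c d Cy' Hcl Hmeet) as [xc [c' [Kc [Ic Mc]]]].
  destruct (closed_set_max K _ a b c d Cy Hcl Hmeet) as [xd [d' [Kd [Id Md]]]].
  assert (Ea := Ma b' yb Kb Ib). assert (Ec := Mc xd d' Kd Id). simpl in Ea, Ec.
  assert (Eya := Mc a' ya Ka Ia). assert (Eya' := Md a' ya Ka Ia).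
  assert (Eyb := Mc b' yb Kb Ib). assert (Eyb' := Md b' yb Kb Ib).
  assert (Exc := Ma xc c' Kc Ic). assert (Exc' := Mb xc c' Kc Ic).
  assert (Exd := Ma xd d' Kd Id). assert (Exd' := Mb xd d' Kd Id). simpl in *.
  destruct Ia as [Ia Ia'], Ib as [Ib Ib'], Ic as [Ic Ic'], Id as [Id Id'].
  assert (F1 : Rabs (flux p q a a' c d) <= eps * ((a' - a) * (d - c))).
  { apply Hfree; try lra. intros x y Hx Hy HK'. assert (T := Ma x y HK' ltac:(split; lra)). simpl in T. lra. }
  assert (F2 : Rabs (flux p q b' b c d) <= eps * ((b - b') * (d - c))).
  { apply Hfree; try lra. intros x y Hx Hy HK'. assert (T := Mb x y HK' ltac:(split; lra)). simpl in T. lra. }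
  assert (F3 : Rabs (flux p q a' b' c c') <= eps * ((b' - a') * (c' - c))).
  { apply Hfree; try lra. intros x y Hx Hy HK'. assert (T := Mc x y HK' ltac:(split; lra)). simpl in T. lra. }
  assert (F4 : Rabs (flux p q a' b' d' d) <= eps * ((b' - a') * (d - d'))).
  { apply Hfree; try lra. intros x y Hx Hy HK'. assert (T := Md x y HK' ltac:(split; lra)). simpl in T. lra. }
  set (S := b - a + (d - c)). assert (HS : 0 <= S) by (unfold S; lra).
  (* Order of choices: [h] makes the layer error small, then [om] is chosen against [h] since it
     gets divided by it, and finally [eta] against [om], with [N * eta <= om] and [2 * eta] at most
     both moduli of continuity. Then [4 * N * eta + 2 * om <= 6 * om] and
     [5 * N * eta + om <= 6 * om]. *)
  set (h := Rmin (t0 / 2) (tau / (4 * (4 * N * S + 1)))).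
  assert (HNS : 0 <= N * S) by (apply Rmult_le_pos; auto).
  assert (Hh : 0 < h) by (apply Rmin_pos; [lra|apply Rdiv_lt_0_compat; lra]).
  assert (Hh1 : h <= t0 / 2) by apply Rmin_l.
  assert (Hh2 : 4 * N * h * S <= tau / 4).
  { apply Rle_trans with (tau / (4 * (4 * N * S + 1)) * (4 * N * S + 1)); [|right; field; lra].
    apply Rle_trans with (h * (4 * N * S + 1)); [lra|]. apply Rmult_le_compat_r; [lra|]. apply Rmin_r. }
  set (om := Rmin (h * tau / (24 * (S * S + 1))) (tau / (48 * (S + 1)))).
  assert (HSS : 0 <= S * S) by (apply Rmult_le_pos; auto).
  assert (Hom : 0 < om).
  { apply Rmin_pos; apply Rdiv_lt_0_compat; try lra. apply Rmult_lt_0_compat; auto. }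
  assert (Hom1 : 6 * om / h * (S * S + 1) <= tau / 4).
  { apply Rle_trans with (6 * (h * tau / (24 * (S * S + 1))) / h * (S * S + 1)); [|right; field; lra].
    apply Rmult_le_compat_r; [lra|]. apply Rmult_le_compat_r; [apply Rlt_le, Rinv_0_lt_compat; auto|].
    apply Rmult_le_compat_l; [lra|]. apply Rmin_l. }
  assert (Hom2 : 12 * om * (S + 1) <= tau / 4).
  { apply Rle_trans with (12 * (tau / (48 * (S + 1))) * (S + 1)); [|right; field; lra].
    apply Rmult_le_compat_r; [lra|]. apply Rmult_le_compat_l; [lra|]. apply Rmin_r. }
  destruct (uniform_continuity_2d p A B C D (fun x y _ _ => Hp x y) (mkposreal _ Hom)) as [d1 H1].
  destruct (uniform_continuity_2d q A B C D (fun x y _ _ => Hq x y) (mkposreal _ Hom)) as [d2 H2].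
  simpl in H1, H2. assert (Hd1 := cond_pos d1). assert (Hd2 := cond_pos d2).
  set (eta0 := Rmin (Rmin (d1 / 2) (d2 / 2)) (Rmin (t0 / 2) (om / (N + 1)))).
  assert (He0 : 0 < eta0).
  { repeat apply Rmin_pos; try lra. apply Rdiv_lt_0_compat; lra. }
  assert (He1 : eta0 <= d1 / 2) by (eapply Rle_trans; [apply Rmin_l|apply Rmin_l]).
  assert (He2 : eta0 <= d2 / 2) by (eapply Rle_trans; [apply Rmin_l|apply Rmin_r]).
  assert (He3 : eta0 <= t0 / 2) by (eapply Rle_trans; [apply Rmin_r|apply Rmin_l]).
  assert (He4 : eta0 <= om / (N + 1)) by (eapply Rle_trans; [apply Rmin_r|apply Rmin_r]).
  exists eta0. split; auto. intros eta He Hle. clearbody eta0.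
  assert (HNe : N * eta <= om).
  { apply Rle_trans with (om / (N + 1) * (N + 1)); [|right; field; lra].
    apply Rle_trans with (eta * (N + 1)); [lra|]. apply Rmult_le_compat_r; lra. }
  assert (Hmod : forall x y x' y', in_rect A B C D x y -> in_rect A B C D x' y' -> l1 x y x' y' < 2 * eta ->
     Rabs (p x y - p x' y') <= om /\ Rabs (q x y - q x' y') <= om).
  { intros x y x' y' [Q1 Q2] [Q3 Q4] Hl. unfold l1 in Hl.
    assert (U := Rabs_pos (x - x')). assert (V := Rabs_pos (y - y')).
    split; apply Rlt_le; [apply H1|apply H2]; auto; lra. }
  assert (He' : 0 <= / eta) by (apply Rlt_le, Rinv_0_lt_compat; auto).
  assert (HL := cut_lip K HKne eta He). assert (HLs := lip_swap _ _ HL).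
  assert (HB : forall x y, 0 <= cut K eta x y <= 1) by (intros; apply cut_bounds; auto).
  assert (HC := lip_cont2 _ _ He' HL).
  assert (HCs := cont2_swap _ HC).
  assert (FE : Rabs (flux pt qt a' b' c' d') <= eps * ((b' - a') * (d' - c')) +
      6 * N * sym_int (cut K eta) a b c d + tau / 2).
  { eapply Rle_trans; [apply (extension_flux a' b' c' d' h eta om); auto; lra|].
    assert (X1 : (4 * N * eta + 2 * om) / h * ((b' - a') * (d' - c')) <= tau / 4).
    { eapply Rle_trans; [|apply Hom1].
      assert (0 <= / h) by (apply Rlt_le, Rinv_0_lt_compat; auto).
      assert (0 <= N * eta) by (apply Rmult_le_pos; lra).
      apply Rmult_le_compat.
      - apply Rmult_le_pos; lra.
      - apply Rmult_le_pos; lra.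
      - apply Rmult_le_compat_r; lra.
      - assert ((b' - a') * (d' - c') <= S * S) by (apply Rmult_le_compat; unfold S; lra). lra. }
    assert (X2 : 4 * N * h * (b' - a' + (d' - c')) <= tau / 4).
    { eapply Rle_trans; [|apply Hh2]. apply Rmult_le_compat_l; [|unfold S; lra].
      apply Rmult_le_pos; lra. }
    assert (X3 : iter_int (cut K eta) a' b' c' d' <= sym_int (cut K eta) a b c d).
    { apply Rle_trans with (sym_int (cut K eta) a' b' c' d').
      - unfold sym_int. assert (0 <= iter_int (swap (cut K eta)) c' d' a' b'); [|lra].
        replace 0 with (0 * ((d' - c') * (b' - a'))) by ring. rewrite <- iter_cst.
        apply (iter_le 0 (/ eta)); auto using lip_cst; try lra. intros; apply HB.
      - apply (sym_sub (/ eta)); auto; try lra. intros; apply HB. }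
    apply (Rmult_le_compat_l (6 * N)) in X3; [|lra]. lra. }
  (* Each side of the bounding box touches [K], as [side_bound] requires. That lemma is applied with
     the columns of the full rectangle, whose proportions [kap] controls; the box itself may be
     arbitrarily thin. *)
  assert (Gx : forall x y0 x1, a <= x <= b -> c <= y0 <= d -> a <= x1 <= b -> K x1 y0 ->
     Rabs (q x y0 - qt x y0) <= 2 * N * kap * RInt (fun y => cut K eta x y) c d + 6 * om).
  { intros x y0 x1 X1 X2 X3 X4. eapply Rle_trans.
    - apply (side_bound K q qt (cut K eta) N kap eta om a b c d A B C D x y0 x1); auto; try lra.
      + intros; apply HB.
      + intros x2 y2 Hl. apply cut_lt_1; auto.
      + intros x' Hx' Hl. apply Hmod; try (split; lra). unfold l1. rewrite Rminus_diag, Rabs_R0. lra.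
    - lra. }
  assert (Gy : forall y x0 y1, c <= y <= d -> a <= x0 <= b -> c <= y1 <= d -> K x0 y1 ->
     Rabs (p x0 y - pt x0 y) <= 2 * N * kap * RInt (fun x => cut K eta x y) a b + 6 * om).
  { intros y x0 y1 X1 X2 X3 X4. eapply Rle_trans.
    - apply (side_bound (fun x y => K y x) (swap p) (swap pt) (swap (cut K eta)) N kap eta om c d a b C D A B y x0 y1); auto; try lra; unfold swap.
      + intros; apply HB.
      + intros x2 y2 Hl. destruct (cut_lt_1 K HKne eta _ _ He Hl) as [x' [y' [Hk Hn]]].
        exists y', x'. split; auto. unfold l1 in *. lra.
      + apply lip_swap; auto.
      + intros; apply pt_ext; auto.
      + intros x2 y2 Hk. destruct (HKQ _ _ Hk). split; auto.
      + intros x2 y2 x' Hk Hx'. apply HpY; auto.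
      + intros x2 y2 y' Hk Hy'. apply HpX; auto.
      + intros y' Hy' Hl. apply Hmod; try (split; lra). unfold l1. rewrite Rminus_diag, Rabs_R0. lra.
    - unfold swap; lra. }
  assert (EI : ex_RInt (fun x => RInt (fun y => cut K eta x y) c d) a b) by (apply (iter_ex (/ eta)); auto).
  assert (EIs : ex_RInt (fun y => RInt (fun x => cut K eta x y) a b) c d) by (apply (iter_ex (/ eta) (swap (cut K eta))); auto).
  assert (Hk0 : 0 <= 4 * N * kap) by (apply Rmult_le_pos; lra).
  assert (FY : Rabs (RInt (fun x => q x d' - qt x d' - (q x c' - qt x c')) a' b') <=
     4 * N * kap * iter_int (cut K eta) a b c d + 12 * om * (b - a)).
  { apply Rle_trans with (RInt (fun x => 4 * N * kap * RInt (fun y => cut K eta x y) c d + 12 * om) a' b').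
    - apply RInt_abs_le; auto 6 with rint; try lra.
      + apply ex_RInt_add; auto with rint. apply ex_RInt_mult. apply (iter_ex (/ eta)); auto.
      + intros x Hx. assert (U1 := Gx x d' xd ltac:(lra) ltac:(lra) ltac:(lra) Kd).
        assert (U2 := Gx x c' xc ltac:(lra) ltac:(lra) ltac:(lra) Kc).
        apply Rabs_le_between in U1, U2. apply Rabs_le. lra.
    - assert (EI' : ex_RInt (fun x => RInt (fun y => cut K eta x y) c d) a' b') by (apply (iter_ex (/ eta)); auto).
      rewrite RInt_add, RInt_mult, RInt_cst by auto with rint.
      change (RInt (fun x => RInt (fun y => cut K eta x y) c d) a' b') with (iter_int (cut K eta) a' b' c d).
      assert (Hsub : iter_int (cut K eta) a' b' c d <= iter_int (cut K eta) a b c d).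
      { rewrite (iter_split_x (/ eta) _ a a' b), (iter_split_x (/ eta) _ a' b' b) by auto.
        assert (P : forall u v, u <= v -> 0 <= iter_int (cut K eta) u v c d).
        { intros u v Huv. replace 0 with (0 * ((v - u) * (d - c))) by ring. rewrite <- iter_cst.
          apply (iter_le 0 (/ eta)); auto using lip_cst; try lra. intros; apply HB. }
        assert (P1 := P a a' ltac:(lra)). assert (P2 := P b' b ltac:(lra)). lra. }
      apply (Rmult_le_compat_l (4 * N * kap)) in Hsub; auto.
      assert ((b' - a') * (12 * om) <= (b - a) * (12 * om)) by (apply Rmult_le_compat_r; lra). lra. }
  assert (FX : Rabs (RInt (fun y => p b' y - pt b' y - (p a' y - pt a' y)) c' d') <=
     4 * N * kap * iter_int (swap (cut K eta)) c d a b + 12 * om * (d - c)).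
  { apply Rle_trans with (RInt (fun y => 4 * N * kap * RInt (fun x => cut K eta x y) a b + 12 * om) c' d').
    - apply RInt_abs_le; auto 6 with rint; try lra.
      + apply ex_RInt_add; auto with rint. apply ex_RInt_mult. apply (iter_ex (/ eta) (swap (cut K eta))); auto.
      + intros y Hy. assert (U1 := Gy y b' yb ltac:(lra) ltac:(lra) ltac:(lra) Kb).
        assert (U2 := Gy y a' ya ltac:(lra) ltac:(lra) ltac:(lra) Ka).
        apply Rabs_le_between in U1, U2. apply Rabs_le. lra.
    - assert (EI' : ex_RInt (fun y => RInt (fun x => cut K eta x y) a b) c' d') by (apply (iter_ex (/ eta) (swap (cut K eta))); auto).
      rewrite RInt_add, RInt_mult, RInt_cst by auto with rint.
      change (RInt (fun y => RInt (fun x => cut K eta x y) a b) c' d') with (iter_int (swap (cut K eta)) c' d' a b).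
      assert (Hsub : iter_int (swap (cut K eta)) c' d' a b <= iter_int (swap (cut K eta)) c d a b).
      { rewrite (iter_split_x (/ eta) _ c c' d), (iter_split_x (/ eta) _ c' d' d) by auto.
        assert (P : forall u v, u <= v -> 0 <= iter_int (swap (cut K eta)) u v a b).
        { intros u v Huv. replace 0 with (0 * ((v - u) * (b - a))) by ring. rewrite <- iter_cst.
          apply (iter_le 0 (/ eta)); auto using lip_cst; try lra. intros; apply HB. }
        assert (P1 := P c c' ltac:(lra)). assert (P2 := P d' d ltac:(lra)). lra. }
      apply (Rmult_le_compat_l (4 * N * kap)) in Hsub; auto.
      assert ((d' - c') * (12 * om) <= (d - c) * (12 * om)) by (apply Rmult_le_compat_r; lra). lra. }
  assert (FD : flux p q a' b' c' d' = flux pt qt a' b' c' d' +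
     (RInt (fun y => p b' y - pt b' y - (p a' y - pt a' y)) c' d' +
      RInt (fun x => q x d' - qt x d' - (q x c' - qt x c')) a' b')).
  { unfold flux. rewrite !RInt_sub by auto 6 with rint. ring. }
  rewrite (flux_split_x p q a a' b), (flux_split_x p q a' b' b) by auto.
  rewrite (flux_split_y p q a' b' c c' d), (flux_split_y p q a' b' c' d' d) by auto.
  rewrite FD.
  assert (Hom3 : 12 * om * (b - a) + 12 * om * (d - c) <= tau / 4).
  { eapply Rle_trans; [|apply Hom2]. unfold S. lra. }
  unfold sym_int in *.
  apply Rabs_le_between in F1, F2, F3, F4, FE, FX, FY. apply Rabs_le. lra.
Qed.


(** On a small rectangle meeting [K] the function [cut K e] is at most the half perimeter over [e],
    so its integral may be subtracted for a small compensation; on one missing [K] the flux needs no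
    such term and the difference of integrals is nonnegative. Quartering preserves the proportions,
    hence the coefficient, and halves the perimeters, whence [2 ^ n]. *)
Lemma quartering_bound (kap t0 e : R) (n : nat) : 0 < t0 -> 1 <= kap -> 0 < e ->
  forall a b c d tau, A <= a -> a <= b -> b + t0 <= B -> C <= c -> c <= d -> d + t0 <= D ->
  b - a <= kap * (d - c) -> d - c <= kap * (b - a) -> 0 < tau ->
  exists eta0, 0 < eta0 /\ forall eta, 0 < eta -> eta <= eta0 ->
    Rabs (flux p q a b c d) <= eps * ((b - a) * (d - c)) +
      (6 * N + 4 * N * kap) * (sym_int (cut K eta) a b c d - sym_int (cut K e) a b c d +
        2 * ((b - a) * (d - c)) * ((b - a + (d - c)) / e / 2 ^ n)) + tau.
Proof.
  intros Ht0 Hkap He.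
  assert (HM : 0 <= 6 * N + 4 * N * kap).
  { assert (0 <= N * kap) by (apply Rmult_le_pos; lra). lra. }
  assert (HLe := cut_lip K HKne e He).
  assert (He' : 0 <= / e) by (apply Rlt_le, Rinv_0_lt_compat; auto).
  induction n as [|n IH]; intros a b c d tau Ha Hab Hb Hc Hcd Hd Hr1 Hr2 Htau.
  - assert (Har : 0 <= (b - a) * (d - c)) by (apply Rmult_le_pos; lra).
    assert (HSe : 0 <= (b - a + (d - c)) / e) by (apply Rmult_le_pos; lra).
    destruct (classic (exists x y, K x y /\ in_rect a b c d x y)) as [Hmeet|Hno].
    + destruct (key_bound a b c d kap tau t0) as [eta0 [He0 H]]; auto.
      exists eta0. split; auto. intros eta H1 H2. eapply Rle_trans; [apply (H eta H1 H2)|].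
      apply Rplus_le_compat_r, Rplus_le_compat_l, Rmult_le_compat_l; auto.
      (* Any point is within the half perimeter of the given point of [K]; the factor 2 counts the
         two orders of integration. *)
      assert (sym_int (cut K e) a b c d <= 2 * ((b - a + (d - c)) / e * ((b - a) * (d - c)))).
      { rewrite <- sym_cst. apply (sym_le (/ e) 0); auto using lip_cst; try lra.
        intros x y [Hx Hy]. destruct Hmeet as [x' [y' [Hk [Hx' Hy']]]].
        eapply Rle_trans; [apply (cut_le K HKne e x y x' y' He Hk)|]. apply Rmult_le_compat_r; auto.
        unfold l1. apply Rplus_le_compat; apply Rabs_le; lra. }
      rewrite pow_O. lra.
    + exists e. split; auto. intros eta H1 H2.
      assert (Rabs (flux p q a b c d) <= eps * ((b - a) * (d - c))).
      { apply Hfree; auto; try lra. intros x y Hx Hy Hk. apply Hno. exists x, y. split; auto. split; lra. }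
      assert (He1 : 0 <= / eta) by (apply Rlt_le, Rinv_0_lt_compat; auto).
      assert (sym_int (cut K e) a b c d <= sym_int (cut K eta) a b c d).
      { apply (sym_le (/ e) (/ eta)); auto using cut_lip. intros. apply cut_mono; auto. }
      assert (0 <= 2 * ((b - a) * (d - c)) * ((b - a + (d - c)) / e / 2 ^ 0)).
      { rewrite pow_O. unfold Rdiv at 1. rewrite Rinv_1, Rmult_1_r. apply Rmult_le_pos; lra. }
      assert (0 <= (6 * N + 4 * N * kap) * (sym_int (cut K eta) a b c d - sym_int (cut K e) a b c d +
        2 * ((b - a) * (d - c)) * ((b - a + (d - c)) / e / 2 ^ 0))) by (apply Rmult_le_pos; lra).
      lra.
  - set (u := (a + b) / 2). set (v := (c + d) / 2).
    assert (Eu : u - a = (b - a) / 2 /\ b - u = (b - a) / 2) by (unfold u; lra).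
    assert (Ev : v - c = (d - c) / 2 /\ d - v = (d - c) / 2) by (unfold v; lra).
    assert (Hs : forall a' b' c' d', b' - a' = (b - a) / 2 -> d' - c' = (d - c) / 2 ->
      b' - a' <= kap * (d' - c') /\ d' - c' <= kap * (b' - a')).
    { intros a' b' c' d' X Y. rewrite X, Y. lra. }
    destruct Eu as [Eu1 Eu2], Ev as [Ev1 Ev2].
    destruct (Hs a u c v) as [Y1 Z1]; auto. destruct (Hs u b c v) as [Y2 Z2]; auto.
    destruct (Hs a u v d) as [Y3 Z3]; auto. destruct (Hs u b v d) as [Y4 Z4]; auto.
    destruct (IH a u c v (tau / 4)) as [e1 [P1 H1]]; try lra.
    destruct (IH u b c v (tau / 4)) as [e2 [P2 H2]]; try lra.
    destruct (IH a u v d (tau / 4)) as [e3 [P3 H3]]; try lra.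
    destruct (IH u b v d (tau / 4)) as [e4 [P4 H4]]; try lra.
    exists (Rmin (Rmin e1 e2) (Rmin e3 e4)). split; [repeat apply Rmin_pos; auto|].
    intros eta Heta Hle.
    assert (L1 := Rmin_l (Rmin e1 e2) (Rmin e3 e4)). assert (L2 := Rmin_r (Rmin e1 e2) (Rmin e3 e4)).
    assert (L3 := Rmin_l e1 e2). assert (L4 := Rmin_r e1 e2).
    assert (L5 := Rmin_l e3 e4). assert (L6 := Rmin_r e3 e4).
    specialize (H1 eta Heta ltac:(lra)). specialize (H2 eta Heta ltac:(lra)).
    specialize (H3 eta Heta ltac:(lra)). specialize (H4 eta Heta ltac:(lra)).
    rewrite Eu1, Ev1 in H1. rewrite Eu2, Ev1 in H2. rewrite Eu1, Ev2 in H3. rewrite Eu2, Ev2 in H4.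
    assert (HL := cut_lip K HKne eta Heta).
    assert (Heta' : 0 <= / eta) by (apply Rlt_le, Rinv_0_lt_compat; auto).
    rewrite (flux_split_x p q a u b), (flux_split_y p q a u c v d), (flux_split_y p q u b c v d) by auto.
    rewrite (sym_split_x _ _ a u b c d Heta' HL), (sym_split_y _ _ a u c v d Heta' HL), (sym_split_y _ _ u b c v d Heta' HL).
    rewrite (sym_split_x _ _ a u b c d He' HLe), (sym_split_y _ _ a u c v d He' HLe), (sym_split_y _ _ u b c v d He' HLe).
    assert (Hpow : (b - a + (d - c)) / e / 2 ^ S n = ((b - a) / 2 + (d - c) / 2) / e / 2 ^ n).
    { simpl. field. split; [lra|apply pow_nonzero; lra]. }
    rewrite Hpow. set (w := ((b - a) / 2 + (d - c) / 2) / e / 2 ^ n) in *.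
    apply Rabs_le_between in H1, H2, H3, H4. apply Rabs_le. lra.
Qed.

(** First [e] is fixed so that no [eta] gives an integral of [cut K eta] exceeding that of [cut K e]
    by more than [sig], then [n] so that the compensation in [quartering_bound] is at most [sig].
    The coefficient [M] depends on neither. *)
Lemma portion_bound (a b c d t0 : R) : 0 < t0 -> A <= a -> a <= b -> b + t0 <= B ->
  C <= c -> c <= d -> d + t0 <= D -> Rabs (flux p q a b c d) <= eps * ((b - a) * (d - c)).
Proof.
  intros Ht0 Ha Hab Hb Hc Hcd Hd.
  destruct (Req_dec a b) as [Eab|Nab].
  { apply Hfree; auto; try lra. intros; lra. }
  destruct (Req_dec c d) as [Ecd|Ncd].
  { apply Hfree; auto; try lra. intros; lra. }
  set (kap := 1 + (b - a) / (d - c) + (d - c) / (b - a)).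
  assert (0 < (b - a) / (d - c)) by (apply Rdiv_lt_0_compat; lra).
  assert (0 < (d - c) / (b - a)) by (apply Rdiv_lt_0_compat; lra).
  assert (Hkap : 1 <= kap) by (unfold kap; lra).
  assert (Hr1 : b - a <= kap * (d - c)).
  { apply Rle_trans with ((b - a) / (d - c) * (d - c)); [right; field; lra|].
    apply Rmult_le_compat_r; unfold kap; lra. }
  assert (Hr2 : d - c <= kap * (b - a)).
  { apply Rle_trans with ((d - c) / (b - a) * (b - a)); [right; field; lra|].
    apply Rmult_le_compat_r; unfold kap; lra. }
  set (M := 6 * N + 4 * N * kap).
  assert (HM : 0 <= M).
  { unfold M. assert (0 <= N * kap) by (apply Rmult_le_pos; lra). lra. }
  apply Rle_plus_epsilon. intros tau Htau.
  set (sig := tau / (4 * (M + 1))). assert (Hsig : 0 < sig) by (apply Rdiv_lt_0_compat; lra).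
  assert (HMs : M * sig <= tau / 4).
  { apply Rle_trans with ((M + 1) * sig); [apply Rmult_le_compat_r; lra|]. right; unfold sig; field; lra. }
  (* These integrals are bounded by twice the area of the rectangle; [e] nearly attains their
     supremum. *)
  assert (Hex : exists e, 0 < e /\ forall eta, 0 < eta -> sym_int (cut K eta) a b c d <= sym_int (cut K e) a b c d + sig).
  { destruct (completeness (fun v => exists eta, 0 < eta /\ v = sym_int (cut K eta) a b c d)) as [s [Hs1 Hs2]].
    - exists (2 * (1 * ((b - a) * (d - c)))). intros v [eta [He ->]]. rewrite <- sym_cst.
      apply (sym_le (/ eta) 0); auto using lip_cst, cut_lip; try lra.
      + apply Rlt_le, Rinv_0_lt_compat; auto.
      + intros. apply cut_bounds; auto.
    - exists (sym_int (cut K 1) a b c d), 1. split; auto; lra.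
    - apply NNPP. intro Hno. assert (s <= s - sig); [|lra]. apply Hs2. intros v [eta [He ->]].
      apply Rnot_lt_le. intro Hlt. apply Hno. exists eta. split; auto. intros eta' He'.
      assert (sym_int (cut K eta') a b c d <= s) by (apply Hs1; exists eta'; auto). lra. }
  destruct Hex as [e [He Hes]].
  set (w := 2 * ((b - a) * (d - c)) * ((b - a + (d - c)) / e)).
  assert (Hw : 0 <= w).
  { unfold w. apply Rmult_le_pos; [|apply Rdiv_le_0_compat; lra].
    assert (0 <= (b - a) * (d - c)) by (apply Rmult_le_pos; lra). lra. }
  destruct (Pow_x_infinity 2 ltac:(rewrite Rabs_right; lra) (w / sig)) as [n Hn].
  specialize (Hn n (le_n n)). rewrite Rabs_right in Hn by (apply Rle_ge, pow_le; lra).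
  assert (Hpow : 0 < 2 ^ n) by (apply pow_lt; lra).
  assert (Hwn : w / 2 ^ n <= sig).
  { apply Rle_div_l; auto. apply Rge_le in Hn. apply Rle_div_l in Hn; auto. lra. }
  destruct (quartering_bound kap t0 e n Ht0 Hkap He a b c d (tau / 4)) as [eta0 [He0 H']]; auto; try lra.
  eapply Rle_trans; [apply (H' eta0); lra|]. fold M.
  assert (Hb1 := Hes eta0 He0).
  assert (Ew : 2 * ((b - a) * (d - c)) * ((b - a + (d - c)) / e / 2 ^ n) = w / 2 ^ n) by (unfold w; field; lra).
  rewrite Ew.
  assert (M * (sym_int (cut K eta0) a b c d - sym_int (cut K e) a b c d + w / 2 ^ n) <= M * (2 * sig))
    by (apply Rmult_le_compat_l; lra).
  lra.
Qed.

End Key.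

(** * The Looman-Menchoff theorem *)

(** [X n] encodes the centre and the half side of a square; the last two hypotheses express that the
    squares are nested, coordinate by coordinate. *)
Lemma nested_boxes (X : nat -> R * R * R) :
  (forall n, 0 < snd (X n)) -> (forall n, snd (X (S n)) <= snd (X n) / 2) ->
  (forall n, Rabs (fst (fst (X (S n))) - fst (fst (X n))) + snd (X (S n)) <= snd (X n)) ->
  (forall n, Rabs (snd (fst (X (S n))) - snd (fst (X n))) + snd (X (S n)) <= snd (X n)) ->
  (forall eps, 0 < eps -> exists n, snd (X n) < eps) /\
  exists x y, forall n, Rabs (x - fst (fst (X n))) <= snd (X n) /\ Rabs (y - snd (fst (X n))) <= snd (X n).
Proof.
  intros Hpos Hhalf Hx Hy.
  assert (Hsmall : forall eps, 0 < eps -> exists n, snd (X n) < eps).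
  { intros eps He.
    assert (Hn : forall n, snd (X n) * 2 ^ n <= snd (X O)).
    { induction n as [|n IH]; [simpl; lra|]. simpl.
      assert (P : 0 < 2 ^ n) by (apply pow_lt; lra). assert (T := Hhalf n). nra. }
    destruct (Pow_x_infinity 2 ltac:(rewrite Rabs_right; lra) (snd (X O) / eps + 1)) as [n H].
    specialize (H n (le_n n)). rewrite Rabs_right in H by (apply Rle_ge, pow_le; lra).
    exists n. apply Rnot_le_lt. intro Hle. assert (T := Hn n). assert (P : 0 < 2 ^ n) by (apply pow_lt; lra).
    assert (E : snd (X O) = snd (X O) / eps * eps) by (field; lra).
    assert (P0 := Hpos O). assert (0 < snd (X O) / eps) by (apply Rdiv_lt_0_compat; auto). nra. }
  split; auto.
  assert (Hcv : forall f : nat -> R, (forall n, Rabs (f (S n) - f n) + snd (X (S n)) <= snd (X n)) ->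
    exists l, forall n, Rabs (l - f n) <= snd (X n)).
  { intros f Hf.
    assert (Hm : forall n m, Rabs (f (n + m)%nat - f n) + snd (X (n + m)%nat) <= snd (X n)).
    { intros n. induction m as [|m IH].
      - rewrite Nat.add_0_r, Rminus_diag, Rabs_R0. lra.
      - rewrite Nat.add_succ_r. assert (T := Hf (n + m)%nat).
        assert (U := Rabs_triang (f (S (n + m)) - f (n + m)%nat) (f (n + m)%nat - f n)).
        replace (f (S (n + m)) - f (n + m)%nat + (f (n + m)%nat - f n)) with (f (S (n + m)) - f n) in U by ring. lra. }
    assert (Hle : forall n m, (n <= m)%nat -> Rabs (f m - f n) <= snd (X n)).
    { intros n m Hnm. replace m with (n + (m - n))%nat by lia. assert (T := Hm n (m - n)%nat).
      assert (U := Hpos (n + (m - n))%nat). lra. }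
    destruct (Rcomplete.R_complete f) as [l Hl].
    - intros eps He. destruct (Hsmall (eps / 2) ltac:(lra)) as [n0 Hn0]. exists n0. intros n m Hn Hm'.
      unfold Rdist. replace (f n - f m) with ((f n - f n0) - (f m - f n0)) by ring.
      eapply Rle_lt_trans; [apply Rabs_triang|]. rewrite Rabs_Ropp.
      assert (T1 := Hle n0 n Hn). assert (T2 := Hle n0 m Hm'). lra.
    - exists l. intros n. apply Rle_plus_epsilon. intros eps He. destruct (Hl eps He) as [m0 Hm0].
      assert (T := Hm0 (Nat.max n m0) (Nat.le_max_r _ _)). unfold Rdist in T.
      assert (U := Hle n (Nat.max n m0) (Nat.le_max_l _ _)).
      replace (l - f n) with ((f (Nat.max n m0) - f n) - (f (Nat.max n m0) - l)) by ring.
      eapply Rle_trans; [apply Rabs_triang|]. rewrite Rabs_Ropp. lra. }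
  destruct (Hcv _ Hx) as [x Hlx]. destruct (Hcv _ Hy) as [y Hly].
  exists x, y. intros n. split; auto.
Qed.

(** If no [C n] contained a portion of [E], every square centred on [E] would contain a smaller one,
    centred on [E] and disjoint from [C n]. The common point of such a nested sequence would lie in
    [E] and in no [C n]. *)
Lemma baire_rect (E : R -> R -> Prop) (C : nat -> R -> R -> Prop) (x0 y0 r : R) :
  0 < r -> E x0 y0 -> closed_in_rect E (x0 - r) (x0 + r) (y0 - r) (y0 + r) ->
  (forall n, closed_in_rect (C n) (x0 - r) (x0 + r) (y0 - r) (y0 + r)) ->
  (forall x y, in_rect (x0 - r) (x0 + r) (y0 - r) (y0 + r) x y -> E x y -> exists n, C n x y) ->
  exists n x y del, E x y /\ near r x0 y0 x y /\ 0 < del /\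
    forall x' y', E x' y' -> near del x y x' y' -> C n x' y'.
Proof.
  intros Hr H0 HE HC Hcov. apply NNPP. intro Hno.
  set (valid := fun s : R * R * R => let '(x, y, rho) := s in
     E x y /\ 0 < rho /\ Rabs (x - x0) + rho <= r /\ Rabs (y - y0) + rho <= r).
  assert (Hstep : forall n (s : {s | valid s}), exists s' : {s | valid s},
     let '(x, y, rho) := proj1_sig s in let '(x', y', rho') := proj1_sig s' in
     rho' <= rho / 2 /\ Rabs (x' - x) + rho' <= rho /\ Rabs (y' - y) + rho' <= rho /\
     forall u v, Rabs (u - x') <= rho' -> Rabs (v - y') <= rho' -> ~ C n u v).
  { intros n [[[x y] rho] [V1 [V2 [V3 V4]]]]. cbn [proj1_sig].
    assert (Hex : exists x' y', E x' y' /\ near (rho / 2) x y x' y' /\ ~ C n x' y').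
    { apply NNPP. intro Hn. apply Hno. exists n, x, y, (rho / 2). repeat split; auto; try lra.
      intros x' y' He Hnear. apply NNPP. intro Hc. apply Hn. exists x', y'; auto. }
    destruct Hex as [x' [y' [E' [[N1 N2] Hc]]]].
    assert (T1 := Rabs_triang (x' - x) (x - x0)). replace (x' - x + (x - x0)) with (x' - x0) in T1 by ring.
    assert (T2 := Rabs_triang (y' - y) (y - y0)). replace (y' - y + (y - y0)) with (y' - y0) in T2 by ring.
    assert (Hin : in_rect (x0 - r) (x0 + r) (y0 - r) (y0 + r) x' y').
    { assert (A1 : Rabs (x' - x0) <= r) by lra. assert (A2 : Rabs (y' - y0) <= r) by lra.
      apply Rabs_le_between in A1, A2. split; lra. }
    assert (Hop : exists del, 0 < del /\ forall u v, near del x' y' u v -> ~ C n u v).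
    { apply NNPP. intro Hn. apply Hc, HC; auto. intros del Hd. apply NNPP. intro Hn'.
      apply Hn. exists del; split; auto. intros u v Huv Hcu. apply Hn'. exists u, v; auto. }
    destruct Hop as [del [Hdel Hop]].
    set (rho' := Rmin (rho / 2) (del / 2)).
    assert (P1 : rho' <= rho / 2) by apply Rmin_l. assert (P2 : rho' <= del / 2) by apply Rmin_r.
    assert (P3 : 0 < rho') by (apply Rmin_pos; lra).
    assert (V : valid (x', y', rho')) by (repeat split; auto; lra).
    exists (exist _ _ V). cbn [proj1_sig]. repeat split; try lra.
    intros u v Hu Hv. apply Hop. split; lra. }
  assert (V0 : valid (x0, y0, r)).
  { repeat split; auto; rewrite Rminus_diag, Rabs_R0; lra. }
  set (step := fun n s => proj1_sig (constructive_indefinite_description _ (Hstep n s))).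
  set (X := fix X (n : nat) : {s | valid s} := match n with O => exist _ _ V0 | S m => step m (X m) end).
  assert (HX : forall n, let '(x, y, rho) := proj1_sig (X n) in let '(x', y', rho') := proj1_sig (X (S n)) in
     rho' <= rho / 2 /\ Rabs (x' - x) + rho' <= rho /\ Rabs (y' - y) + rho' <= rho /\
     forall u v, Rabs (u - x') <= rho' -> Rabs (v - y') <= rho' -> ~ C n u v).
  { intros n. exact (proj2_sig (constructive_indefinite_description _ (Hstep n (X n)))). }
  destruct (nested_boxes (fun n => proj1_sig (X n))) as [Hsm [x [y Hxy]]].
  - intros n. assert (T := proj2_sig (X n)). destruct (proj1_sig (X n)) as [[a b] c]. apply T.
  - intros n. assert (T := HX n). destruct (proj1_sig (X n)) as [[a b] c]. destruct (proj1_sig (X (S n))) as [[a' b'] c']. apply T.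
  - intros n. assert (T := HX n). destruct (proj1_sig (X n)) as [[a b] c]. destruct (proj1_sig (X (S n))) as [[a' b'] c']. apply T.
  - intros n. assert (T := HX n). destruct (proj1_sig (X n)) as [[a b] c]. destruct (proj1_sig (X (S n))) as [[a' b'] c']. apply T.
  - assert (Hin : in_rect (x0 - r) (x0 + r) (y0 - r) (y0 + r) x y).
    { destruct (Hxy O) as [A1 A2]. simpl in A1, A2. apply Rabs_le_between in A1, A2. split; lra. }
    assert (HEx : E x y).
    { apply HE; auto. intros del Hd. destruct (Hsm del Hd) as [n Hn]. assert (T := Hxy n).
      assert (V := proj2_sig (X n)). destruct (proj1_sig (X n)) as [[a b] c]. simpl in *.
      exists a, b. split; [apply V|]. split; rewrite Rabs_minus_sym; lra. }
    destruct (Hcov x y Hin HEx) as [n Hn].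
    assert (T := HX n). assert (T' := Hxy (S n)).
    destruct (proj1_sig (X n)) as [[a b] c]. destruct (proj1_sig (X (S n))) as [[a' b'] c'].
    simpl in T'. destruct T as [_ [_ [_ T]]]. apply (T x y); auto; apply T'.
Qed.

Lemma cont2_abs_le_closed (G : R -> R -> R) (c x y : R) : cont2 G ->
  (forall del, 0 < del -> exists x' y', Rabs (G x' y') <= c /\ near del x y x' y') -> Rabs (G x y) <= c.
Proof.
  intros HG H. apply Rle_plus_epsilon. intros eps He.
  destruct (cont2_near G x y eps (HG x y) He) as [del [Hd Hn]].
  destruct (H del Hd) as [x' [y' [H1 H2]]]. specialize (Hn x' y' H2).
  apply Rabs_le_between in H1. apply Rabs_def2 in Hn. apply Rabs_le. lra.
Qed.

Lemma cont2_shift (G : R -> R -> R) (h k : R) : cont2 G -> cont2 (fun x y => G (x + h) (y + k)).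
Proof.
  intros HG x y. apply near_cont2. intros eps He.
  destruct (cont2_near G (x + h) (y + k) eps (HG _ _) He) as [del [Hd Hn]].
  exists del; split; auto. intros x' y' [N1 N2]. apply Hn. split.
  - replace (x' + h - (x + h)) with (x' - x) by ring. auto.
  - replace (y' + k - (y + k)) with (y' - y) by ring. auto.
Qed.

Lemma cont2_minus (F G : R -> R -> R) : cont2 F -> cont2 G -> cont2 (fun x y => F x y - G x y).
Proof. intros HF HG x y. apply continuity_2d_pt_minus; auto. Qed.

Lemma cont2_plus (F G : R -> R -> R) : cont2 F -> cont2 G -> cont2 (fun x y => F x y + G x y).
Proof. intros HF HG x y. apply continuity_2d_pt_plus; auto. Qed.

Lemma cont2_diff_x (G : R -> R -> R) (h : R) : cont2 G -> cont2 (fun x y => G (x + h) y - G x y).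
Proof.
  intros HG. apply cont2_minus; auto. intros x y.
  apply (continuity_2d_pt_ext (fun x y => G (x + h) (y + 0))).
  - intros; rewrite Rplus_0_r; auto.
  - apply cont2_shift; auto.
Qed.

Lemma cont2_diff_y (G : R -> R -> R) (h : R) : cont2 G -> cont2 (fun x y => G x (y + h) - G x y).
Proof.
  intros HG. apply cont2_minus; auto. intros x y.
  apply (continuity_2d_pt_ext (fun x y => G (x + 0) (y + h))).
  - intros; rewrite Rplus_0_r; auto.
  - apply cont2_shift; auto.
Qed.

(** For a fixed step [h] these inequalities pass to limits of points, as [p] and [q] are continuous.
    Hence the set is closed, as Baire's theorem demands; bounds on the derivatives alone would not
    give a closed set. *)
Definition quotients_bounded (p q : R -> R -> R) (eps L rad x y : R) : Prop :=
  forall h, Rabs h <= rad ->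
    Rabs (p (x + h) y - p x y) <= L * Rabs h /\ Rabs (p x (y + h) - p x y) <= L * Rabs h /\
    Rabs (q (x + h) y - q x y) <= L * Rabs h /\ Rabs (q x (y + h) - q x y) <= L * Rabs h /\
    Rabs (p (x + h) y - p x y + (q x (y + h) - q x y)) <= eps * Rabs h.

Lemma quotients_bounded_closed (p q : R -> R -> R) (eps L rad a b c d : R) : cont2 p -> cont2 q ->
  closed_in_rect (quotients_bounded p q eps L rad) a b c d.
Proof.
  intros Hp Hq x y _ H h Hh.
  assert (H' : forall G v, cont2 G -> (forall x' y', quotients_bounded p q eps L rad x' y' -> Rabs (G x' y') <= v) ->
     Rabs (G x y) <= v).
  { intros G v HG Hv. apply cont2_abs_le_closed; auto. intros del Hd.
    destruct (H del Hd) as [x' [y' [Hc Hn]]]. exists x', y'; auto. }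
  repeat split.
  - apply (H' (fun x y => p (x + h) y - p x y)); [apply cont2_diff_x; auto|]. intros x' y' Hc. apply (Hc h Hh).
  - apply (H' (fun x y => p x (y + h) - p x y)); [apply cont2_diff_y; auto|]. intros x' y' Hc. apply (Hc h Hh).
  - apply (H' (fun x y => q (x + h) y - q x y)); [apply cont2_diff_x; auto|]. intros x' y' Hc. apply (Hc h Hh).
  - apply (H' (fun x y => q x (y + h) - q x y)); [apply cont2_diff_y; auto|]. intros x' y' Hc. apply (Hc h Hh).
  - apply (H' (fun x y => p (x + h) y - p x y + (q x (y + h) - q x y))).
    + apply cont2_plus; [apply cont2_diff_x|apply cont2_diff_y]; auto.
    + intros x' y' Hc. apply (Hc h Hh).
Qed.

Lemma derivable_pt_lim_increment (f : R -> R) (x l eps : R) : derivable_pt_lim f x l -> 0 < eps ->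
  exists del, 0 < del /\ forall h, Rabs h < del -> Rabs (f (x + h) - f x - l * h) <= eps * Rabs h.
Proof.
  intros H He. destruct (H eps He) as [del Hd]. exists del. split; [apply cond_pos|].
  intros h Hh. destruct (Req_dec h 0) as [->|Hn].
  - rewrite Rplus_0_r, Rminus_diag, Rmult_0_r, Rminus_0_r, Rabs_R0. lra.
  - replace (f (x + h) - f x - l * h) with (((f (x + h) - f x) / h - l) * h) by (field; auto).
    rewrite Rabs_mult. apply Rmult_le_compat_r; [apply Rabs_pos|]. apply Rlt_le, Hd; auto.
Qed.

Definition divergence_free_at (p q : R -> R -> R) (x y : R) : Prop :=
  exists px py qx qy,
    derivable_pt_lim (fun s => p s y) x px /\ derivable_pt_lim (fun s => p x s) y py /\
    derivable_pt_lim (fun s => q s y) x qx /\ derivable_pt_lim (fun s => q x s) y qy /\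
    px + qy = 0.

Lemma quotients_bounded_ex (p q : R -> R -> R) (eps r x y : R) : 0 < eps -> 0 < r ->
  divergence_free_at p q x y -> exists n, quotients_bounded p q eps (INR n) (r / INR (S n)) x y.
Proof.
  intros He Hr [px [py [qx [qy [H1 [H2 [H3 [H4 Hs]]]]]]]].
  (* Precision 1 keeps the quotients within the derivatives plus 1; [eps / 2] is the share of each
     of the two quotients whose limits cancel in the divergence. *)
  set (e := Rmin 1 (eps / 2)). assert (He' : 0 < e) by (apply Rmin_pos; lra).
  assert (E1 : e <= 1) by apply Rmin_l. assert (E2 : e <= eps / 2) by apply Rmin_r.
  destruct (derivable_pt_lim_increment _ _ _ e H1 He') as [d1 [D1 I1]].
  destruct (derivable_pt_lim_increment _ _ _ e H2 He') as [d2 [D2 I2]].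
  destruct (derivable_pt_lim_increment _ _ _ e H3 He') as [d3 [D3 I3]].
  destruct (derivable_pt_lim_increment _ _ _ e H4 He') as [d4 [D4 I4]].
  set (dd := Rmin (Rmin d1 d2) (Rmin d3 d4)). assert (Hdd : 0 < dd) by (repeat apply Rmin_pos; auto).
  assert (L1 : dd <= d1) by (eapply Rle_trans; [apply Rmin_l|apply Rmin_l]).
  assert (L2 : dd <= d2) by (eapply Rle_trans; [apply Rmin_l|apply Rmin_r]).
  assert (L3 : dd <= d3) by (eapply Rle_trans; [apply Rmin_r|apply Rmin_l]).
  assert (L4 : dd <= d4) by (eapply Rle_trans; [apply Rmin_r|apply Rmin_r]).
  (* The last term makes [r / INR (S n) < dd], so a single index governs both the bound and the
     range of steps. *)
  set (v := Rabs px + Rabs py + Rabs qx + Rabs qy + 1 + r / dd).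
  assert (Q1 := Rabs_pos px). assert (Q2 := Rabs_pos py). assert (Q3 := Rabs_pos qx). assert (Q4 := Rabs_pos qy).
  assert (Q5 : 0 < r / dd) by (apply Rdiv_lt_0_compat; auto).
  destruct (INR_unbounded v) as [n Hn]. exists n. intros h Hh.
  assert (HS : 0 < INR (S n)) by (apply lt_0_INR; lia).
  assert (Hh' : Rabs h < dd).
  { eapply Rle_lt_trans; [apply Hh|]. apply Rlt_div_l; auto. rewrite S_INR.
    assert (r = r / dd * dd) by (field; lra). unfold v in Hn. nra. }
  assert (P := Rabs_pos h).
  assert (G : forall f z l, Rabs (f (z + h) - f z - l * h) <= e * Rabs h -> Rabs l + 1 <= INR n ->
     Rabs (f (z + h) - f z) <= INR n * Rabs h).
  { intros f z l Hf Hl. assert (T := Rabs_triang (f (z + h) - f z - l * h) (l * h)).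
    replace (f (z + h) - f z - l * h + l * h) with (f (z + h) - f z) in T by ring.
    rewrite Rabs_mult in T. nra. }
  specialize (I1 h ltac:(lra)). specialize (I2 h ltac:(lra)). specialize (I3 h ltac:(lra)). specialize (I4 h ltac:(lra)).
  unfold v in Hn.
  repeat split.
  - apply (G (fun s => p s y) x px); auto; lra.
  - apply (G (fun s => p x s) y py); auto; lra.
  - apply (G (fun s => q s y) x qx); auto; lra.
  - apply (G (fun s => q x s) y qy); auto; lra.
  - replace (p (x + h) y - p x y + (q x (y + h) - q x y)) with
      ((p (x + h) y - p x y - px * h) + (q x (y + h) - q x y - qy * h)).
    + eapply Rle_trans; [apply Rabs_triang|]. nra.
    + replace qy with (- px) by lra. ring.
Qed.

Theorem looman_menchoff (p q : R -> R -> R) (A B C D : R) : cont2 p -> cont2 q ->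
  (forall x y, A < x < B -> C < y < D -> divergence_free_at p q x y) ->
  forall a b c d, A <= a -> a <= b -> b <= B -> C <= c -> c <= d -> d <= D -> flux p q a b c d = 0.
Proof.
  intros Hp Hq Hdf.
  set (good := fun eps x y => exists del, 0 < del /\ forall a b c d, a <= b -> c <= d ->
     near del x y a c -> near del x y b d -> Rabs (flux p q a b c d) <= eps * ((b - a) * (d - c))).
  assert (Hgood : forall eps x y, 0 < eps -> A < x < B -> C < y < D -> good eps x y).
  { intros eps x0 y0 He Hx0 Hy0. apply NNPP. intro Hbad.
    set (r := Rmin (Rmin (x0 - A) (B - x0)) (Rmin (y0 - C) (D - y0)) / 4).
    assert (Hr : 0 < r) by (unfold r; assert (0 < Rmin (Rmin (x0 - A) (B - x0)) (Rmin (y0 - C) (D - y0))) by (repeat apply Rmin_pos; lra); lra).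
    assert (R1 : 4 * r <= x0 - A /\ 4 * r <= B - x0 /\ 4 * r <= y0 - C /\ 4 * r <= D - y0).
    { unfold r. assert (T1 := Rmin_l (Rmin (x0 - A) (B - x0)) (Rmin (y0 - C) (D - y0))).
      assert (T2 := Rmin_r (Rmin (x0 - A) (B - x0)) (Rmin (y0 - C) (D - y0))).
      assert (T3 := Rmin_l (x0 - A) (B - x0)). assert (T4 := Rmin_r (x0 - A) (B - x0)).
      assert (T5 := Rmin_l (y0 - C) (D - y0)). assert (T6 := Rmin_r (y0 - C) (D - y0)). lra. }
    clearbody r.
    set (E := fun x y => ~ good eps x y).
    (* Being good is an open condition: half of the radius serves at every point within the other
       half. *)
    assert (HE : forall a b c d, closed_in_rect E a b c d).
    { intros a b c d x y _ H [del [Hd Hg]]. destruct (H (del / 2) ltac:(lra)) as [x' [y' [Hb [N1 N2]]]].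
      apply Hb. exists (del / 2). split; [lra|]. intros a' b' c' d' H1 H2 [M1 M2] [M3 M4].
      apply Rabs_def2 in N1, N2, M1, M2, M3, M4. apply Hg; auto; split; apply Rabs_def1; lra. }
    destruct (baire_rect E (fun n => quotients_bounded p q eps (INR n) (r / INR (S n))) x0 y0 r) as [n [x1 [y1 [del [E1 [[N1 N2] [Hd HC]]]]]]]; auto.
    - intros n. apply quotients_bounded_closed; auto.
    - intros x y [Hx Hy] _. apply quotients_bounded_ex; auto. apply Hdf; lra.
    - assert (HS : 0 < INR (S n)) by (apply lt_0_INR; lia).
      assert (Hrn : 0 < r / INR (S n)) by (apply Rdiv_lt_0_compat; auto).
      (* [del / 2] keeps the square inside the portion found by Baire; half of [r / INR (S n)] makes
         any two of its points differ, in each coordinate, by an admissible step. *)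
      set (rho := Rmin (Rmin (del / 2) (r / INR (S n) / 2)) r).
      assert (H0 : 0 < rho) by (repeat apply Rmin_pos; lra).
      assert (H1 : rho <= del / 2) by (eapply Rle_trans; [apply Rmin_l|apply Rmin_l]).
      assert (H2 : rho <= r / INR (S n) / 2) by (eapply Rle_trans; [apply Rmin_l|apply Rmin_r]).
      assert (H3 : rho <= r) by apply Rmin_r.
      clearbody rho. apply Rabs_def2 in N1, N2.
      set (K := fun x y => E x y /\ in_rect (x1 - rho) (x1 + rho) (y1 - rho) (y1 + rho) x y).
      assert (HK1 : K x1 y1) by (split; auto; split; lra).
      assert (HKC : forall x y, K x y -> quotients_bounded p q eps (INR n) (r / INR (S n)) x y).
      { intros x y [Hk [Hx Hy]]. apply HC; auto. split; apply Rabs_def1; lra. }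
      assert (Hsm : forall x y z, K x y -> x1 - rho <= z <= x1 + rho -> Rabs (z - x) <= r / INR (S n)).
      { intros x y z [_ [Hx Hy]] Hz. apply Rabs_le. lra. }
      assert (Hsm' : forall x y z, K x y -> y1 - rho <= z <= y1 + rho -> Rabs (z - y) <= r / INR (S n)).
      { intros x y z [_ [Hx Hy]] Hz. apply Rabs_le. lra. }
      (* The centre of the portion turns out to be good, a contradiction. Rectangles within
         [rho / 2] of it leave the margin [t0 = rho / 2] inside the square. *)
      apply E1. exists (rho / 2). split; [lra|]. intros a b c d Hab Hcd [M1 M2] [M3 M4].
      apply Rabs_def2 in M1, M2, M3, M4.
      apply (portion_bound p q K (x1 - rho) (x1 + rho) (y1 - rho) (y1 + rho) (INR n) eps) with (t0 := rho / 2); auto; try lra.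
      + apply pos_INR.
      + exists x1, y1; auto.
      + intros x y Hk; apply Hk.
      + intros x y Hin H. split; auto. apply (HE (x1 - rho) (x1 + rho) (y1 - rho) (y1 + rho)); auto.
        intros de Hde. destruct (H de Hde) as [x' [y' [[Hk _] Hn]]]. exists x', y'; auto.
      + intros x y x' Hk Hx'. destruct (HKC x y Hk (x' - x) (Hsm x y x' Hk Hx')) as [T _].
        replace (x + (x' - x)) with x' in T by ring. auto.
      + intros x y x' Hk Hx'. destruct (HKC x y Hk (x' - y) (Hsm' x y x' Hk Hx')) as [_ [T _]].
        replace (y + (x' - y)) with x' in T by ring. auto.
      + intros x y x' Hk Hx'. destruct (HKC x y Hk (x' - x) (Hsm x y x' Hk Hx')) as [_ [_ [T _]]].
        replace (x + (x' - x)) with x' in T by ring. auto.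
      + intros x y x' Hk Hx'. destruct (HKC x y Hk (x' - y) (Hsm' x y x' Hk Hx')) as [_ [_ [_ [T _]]]].
        replace (y + (x' - y)) with x' in T by ring. auto.
      + intros x y h Hk Hh Hx' Hy'. assert (Hk' := Hk). destruct Hk' as [_ [Hx Hy]].
        destruct (HKC x y Hk h) as [_ [_ [_ [_ T]]]].
        * rewrite Rabs_right; lra.
        * rewrite (Rabs_right h) in T by lra. auto.
      (* Inside the square a point off [K] is off [E], hence good, so the local bounds add up. *)
      + intros a' b' c' d' X1 X2 X3 X4 X5 X6 X7. apply flux_local_bound; auto; try lra.
        intros x y Hx Hy. apply NNPP. intro Hn. apply (X7 x y Hx Hy). split; [exact Hn|split; lra]. }
  intros a b c d Ha Hab Hb Hc Hcd Hd.
  assert (Hall : forall eps, 0 < eps -> Rabs (flux p q a b c d) <= eps * ((b - a) * (d - c))).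
  { intros eps He. apply flux_local_bound; auto; try lra. intros x y Hx Hy. apply Hgood; auto; lra. }
  assert (Har : 0 <= (b - a) * (d - c)) by (apply Rmult_le_pos; lra).
  apply Rabs_eq_0. apply Rle_antisym; [|apply Rabs_pos].
  apply Rle_plus_epsilon. intros eps He.
  assert (He' : 0 < eps / ((b - a) * (d - c) + 1)) by (apply Rdiv_lt_0_compat; lra).
  eapply Rle_trans; [apply (Hall _ He')|].
  assert (eps = eps / ((b - a) * (d - c) + 1) * ((b - a) * (d - c) + 1)) by (field; lra). lra.
Qed.

(** * Primitives and local maxima *)

Definition clamp (a b x : R) : R := Rmax a (Rmin b x).

Lemma clamp_in (a b x : R) : a <= b -> a <= clamp a b x <= b.
Proof. intros H. unfold clamp, Rmax, Rmin. repeat destruct Rle_dec; lra. Qed.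

Lemma clamp_id (a b x : R) : a <= x <= b -> clamp a b x = x.
Proof. intros H. unfold clamp, Rmax, Rmin. repeat destruct Rle_dec; lra. Qed.

Lemma clamp_lip (a b x x' : R) : Rabs (clamp a b x - clamp a b x') <= Rabs (x - x').
Proof.
  unfold clamp, Rmax, Rmin. destruct (Rcase_abs (x - x')) as [H|H];
   [rewrite (Rabs_left (x - x')) by auto|rewrite (Rabs_right (x - x')) by auto];
   apply Rabs_le; repeat destruct Rle_dec; lra.
Qed.

Lemma derivable_pt_lim_local (f g : R -> R) (x l del : R) : 0 < del ->
  (forall s, Rabs (s - x) < del -> f s = g s) -> derivable_pt_lim f x l -> derivable_pt_lim g x l.
Proof.
  intros Hd H Hf. apply is_derive_Reals in Hf. apply is_derive_Reals.
  apply (is_derive_ext_loc f); auto. exists (mkposreal del Hd). intros y Hy. apply H. exact Hy.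
Qed.

Lemma derivable_RInt (f : R -> R) (a x : R) : (forall s, continuous f s) ->
  derivable_pt_lim (fun s => RInt f a s) x (f x).
Proof.
  intros Hf. apply is_derive_Reals. apply (is_derive_RInt (V := R_NormedModule) f _ a); auto.
  exists (mkposreal 1 Rlt_0_1). intros y _. apply (RInt_correct (V := R_CompleteNormedModule)).
  apply ex_RInt_cont; auto.
Qed.

Lemma rect_margin (A B x : R) : A < x < B -> exists del, 0 < del /\ forall s, Rabs (s - x) < del -> A < s < B.
Proof.
  intros H. exists (Rmin (x - A) (B - x)). split; [apply Rmin_pos; lra|].
  intros s Hs. apply Rabs_def2 in Hs. assert (T1 := Rmin_l (x - A) (B - x)). assert (T2 := Rmin_r (x - A) (B - x)). lra.
Qed.

(** [S] is the stream function, obtained by integrating along the path that goes right and then up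
    from the corner [(A, C)]. Zero flux says that going up and then right gives the same value, and
    each partial derivative is read off from the path whose last leg has that direction. *)
Lemma flux_primitive (p q : R -> R -> R) (A B C D : R) : cont2 p -> cont2 q -> A <= B -> C <= D ->
  (forall a b c d, A <= a -> a <= b -> b <= B -> C <= c -> c <= d -> d <= D -> flux p q a b c d = 0) ->
  exists S, cont2 S /\ forall x y, A < x < B -> C < y < D ->
    derivable_pt_lim (fun s => S s y) x (- q x y) /\ derivable_pt_lim (fun s => S x s) y (p x y).
Proof.
  intros Hp Hq HAB HCD Hfl.
  set (S := fun x y => RInt (fun t => p x t) C y - RInt (fun s => q s C) A x).
  assert (HS : forall x y, in_rect A B C D x y -> S x y = RInt (fun t => p A t) C y - RInt (fun s => q s y) A x).
  { intros x y [Hx Hy]. assert (T := Hfl A x C y ltac:(lra) ltac:(lra) ltac:(lra) ltac:(lra) ltac:(lra) ltac:(lra)).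
    unfold flux in T. rewrite (RInt_sub (fun t => p x t) (fun t => p A t)), (RInt_sub (fun s => q s y) (fun s => q s C)) in T by auto with rint.
    unfold S. lra. }
  destruct (cont2_bounded p A B C D Hp) as [Bp [Bp0 HBp]].
  destruct (cont2_bounded q A B C D Hq) as [Bq [Bq0 HBq]].
  assert (HI : forall (f : R -> R) lo hi M a b c, (forall s, continuous f s) ->
     (forall s, lo <= s <= hi -> Rabs (f s) <= M) -> lo <= a <= hi -> lo <= b <= hi ->
     Rabs (RInt f c a - RInt f c b) <= M * Rabs (a - b)).
  { intros f lo hi M a b c Hf HM Ha Hb.
    assert (Hex : forall u v, ex_RInt f u v) by (intros; apply ex_RInt_cont; auto).
    destruct (Rle_dec a b) as [H|H].
    - assert (E := RInt_split f c a b (Hex _ _) (Hex _ _)). rewrite Rabs_minus_sym, (Rabs_minus_sym a).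
      rewrite E. replace (RInt f c a + RInt f a b - RInt f c a) with (RInt f a b) by lra.
      rewrite (Rabs_right (b - a)) by lra. rewrite Rmult_comm.
      apply abs_RInt_le_const; auto. intros; apply HM; lra.
    - assert (E := RInt_split f c b a (Hex _ _) (Hex _ _)).
      rewrite E. replace (RInt f c b + RInt f b a - RInt f c b) with (RInt f b a) by lra.
      rewrite (Rabs_right (a - b)) by lra. rewrite Rmult_comm.
      apply abs_RInt_le_const; auto; try lra. intros; apply HM; lra. }
  exists (fun x y => S (clamp A B x) (clamp C D y)). split.
  - apply (lip_cont2 (Bp + Bq)); [lra|]. intros x y x' y'.
    assert (X := clamp_in A B x HAB). assert (X' := clamp_in A B x' HAB).
    assert (Y := clamp_in C D y HCD). assert (Y' := clamp_in C D y' HCD).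
    assert (LX := clamp_lip A B x x'). assert (LY := clamp_lip C D y y').
    set (u := clamp A B x) in *. set (u' := clamp A B x') in *.
    set (v := clamp C D y) in *. set (v' := clamp C D y') in *.
    assert (T1 : Rabs (S u v - S u' v) <= Bq * Rabs (u - u')).
    { rewrite !HS by (split; lra).
      replace (RInt (fun t => p A t) C v - RInt (fun s => q s v) A u - (RInt (fun t => p A t) C v - RInt (fun s => q s v) A u'))
        with (- (RInt (fun s => q s v) A u - RInt (fun s => q s v) A u')) by lra.
      rewrite Rabs_Ropp. apply (HI (fun s => q s v) A B); auto.
      - intros; apply cont2_x; auto.
      - intros s Hs. apply HBq. split; lra. }
    assert (T2 : Rabs (S u' v - S u' v') <= Bp * Rabs (v - v')).
    { unfold S. replace (RInt (fun t => p u' t) C v - RInt (fun s => q s C) A u' - (RInt (fun t => p u' t) C v' - RInt (fun s => q s C) A u'))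
        with (RInt (fun t => p u' t) C v - RInt (fun t => p u' t) C v') by lra.
      apply (HI (fun s => p u' s) C D); auto.
      - intros; apply cont2_y; auto.
      - intros s Hs. apply HBp. split; lra. }
    assert (T3 := Rabs_triang (S u v - S u' v) (S u' v - S u' v')).
    replace (S u v - S u' v + (S u' v - S u' v')) with (S u v - S u' v') in T3 by ring.
    assert (P1 := Rabs_pos (x - x')). assert (P2 := Rabs_pos (y - y')). unfold l1.
    assert (Bq * Rabs (u - u') <= Bq * Rabs (x - x')) by (apply Rmult_le_compat_l; auto).
    assert (Bp * Rabs (v - v') <= Bp * Rabs (y - y')) by (apply Rmult_le_compat_l; auto).
    assert (0 <= Bp * Rabs (x - x')) by (apply Rmult_le_pos; auto).
    assert (0 <= Bq * Rabs (y - y')) by (apply Rmult_le_pos; auto). lra.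
  - intros x y Hx Hy.
    destruct (rect_margin A B x Hx) as [d1 [Hd1 M1]]. destruct (rect_margin C D y Hy) as [d2 [Hd2 M2]]. split.
    + apply (derivable_pt_lim_local (fun s => RInt (fun t => p A t) C y - RInt (fun s => q s y) A s) _ _ _ d1 Hd1).
      * intros s Hs. specialize (M1 s Hs). rewrite !clamp_id by lra. symmetry. apply HS. split; lra.
      * replace (- q x y) with (0 - q x y) by ring.
        apply (derivable_pt_lim_minus (fun _ => RInt (fun t => p A t) C y) (fun s => RInt (fun s => q s y) A s)).
        -- apply derivable_pt_lim_const.
        -- apply (derivable_RInt (fun s => q s y)). intros; apply cont2_x; auto.
    + apply (derivable_pt_lim_local (fun s => RInt (fun t => p x t) C s - RInt (fun s => q s C) A x) _ _ _ d2 Hd2).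
      * intros s Hs. specialize (M2 s Hs). rewrite !clamp_id by lra. reflexivity.
      * replace (p x y) with (p x y - 0) by ring.
        apply (derivable_pt_lim_minus (fun s => RInt (fun t => p x t) C s) (fun _ => RInt (fun s => q s C) A x)).
        -- apply (derivable_RInt (fun s => p x s)). intros; apply cont2_y; auto.
        -- apply derivable_pt_lim_const.
Qed.

Definition weak_CR (u v : R -> R -> R) (x y : R) : Prop :=
  exists ux uy,
    derivable_pt_lim (fun s => u s y) x ux /\ derivable_pt_lim (fun s => u x s) y uy /\
    derivable_pt_lim (fun s => v s y) x (- uy) /\ derivable_pt_lim (fun s => v x s) y ux.

(* [a + i b] has complex derivative [u + i v] at the points of the rectangle. *)
Definition complex_primitive (a b u v : R -> R -> R) (A B C D : R) : Prop :=
  forall x y, A < x < B -> C < y < D ->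
    derivable_pt_lim (fun s => a s y) x (u x y) /\ derivable_pt_lim (fun s => a x s) y (- v x y) /\
    derivable_pt_lim (fun s => b s y) x (v x y) /\ derivable_pt_lim (fun s => b x s) y (u x y).

Lemma cont2_opp (f : R -> R -> R) : cont2 f -> cont2 (fun x y => - f x y).
Proof. intros H x y. apply continuity_2d_pt_opp; auto. Qed.

(** By the Cauchy-Riemann equations the fields [(u, - v)] and [(v, u)] are divergence free; their
    stream functions are the imaginary part and minus the real part of a complex primitive. *)
Lemma weak_CR_primitive (u v : R -> R -> R) (A B C D : R) : cont2 u -> cont2 v -> A <= B -> C <= D ->
  (forall x y, A < x < B -> C < y < D -> weak_CR u v x y) ->
  exists a b, cont2 a /\ cont2 b /\ complex_primitive a b u v A B C D.
Proof.
  intros Hu Hv HAB HCD H. assert (Hv' := cont2_opp v Hv).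
  destruct (flux_primitive u (fun x y => - v x y) A B C D) as [b [Hb Db]]; auto.
  { apply looman_menchoff; auto. intros x y Hx Hy. destruct (H x y Hx Hy) as [ux [uy [H1 [H2 [H3 H4]]]]].
    exists ux, uy, (- - uy), (- ux). repeat split; auto; try ring.
    - apply (derivable_pt_lim_opp (fun s => v s y)); auto.
    - apply (derivable_pt_lim_opp (fun s => v x s)); auto. }
  destruct (flux_primitive v u A B C D) as [a [Ha Da]]; auto.
  { apply looman_menchoff; auto. intros x y Hx Hy. destruct (H x y Hx Hy) as [ux [uy [H1 [H2 [H3 H4]]]]].
    exists (- uy), ux, ux, uy. repeat split; auto; ring. }
  exists (fun x y => - a x y), b. repeat split; auto using cont2_opp.
  - destruct (Da x y H0 H1) as [T _]. rewrite <- (Ropp_involutive (u x y)). apply (derivable_pt_lim_opp (fun s => a s y)); auto.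
  - destruct (Da x y H0 H1) as [_ T]. apply (derivable_pt_lim_opp (fun s => a x s)); auto.
  - destruct (Db x y H0 H1) as [T _]. rewrite Ropp_involutive in T. auto.
  - apply (Db x y H0 H1).
Qed.

Lemma complex_primitive_CR (a b u v : R -> R -> R) (A B C D x y : R) :
  complex_primitive a b u v A B C D -> A < x < B -> C < y < D -> weak_CR a b x y.
Proof.
  intros H Hx Hy. destruct (H x y Hx Hy) as [H1 [H2 [H3 H4]]].
  exists (u x y), (- v x y). repeat split; auto. rewrite Ropp_involutive. auto.
Qed.

Lemma second_derivative_test (f g : R -> R) (x m del : R) : 0 < del ->
  (forall s, Rabs (s - x) < del -> derivable_pt_lim f s (g s)) -> derivable_pt_lim g x m ->
  (forall s, Rabs (s - x) < del -> f s <= f x) -> m <= 0.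
Proof.
  intros Hd Hf Hg Hmax.
  assert (Hx : Rabs (x - x) < del) by (rewrite Rminus_diag, Rabs_R0; auto).
  assert (Hg0 : g x = 0).
  { destruct (Req_dec (g x) 0) as [|Hn]; auto. exfalso.
    assert (Hp : 0 < Rabs (g x)) by (apply Rabs_pos_lt; auto).
    destruct (derivable_pt_lim_increment f x (g x) (Rabs (g x) / 2) (Hf x Hx) ltac:(lra)) as [d [Hd0 H]].
    set (t := Rmin (d / 2) (del / 2)). assert (Ht : 0 < t) by (apply Rmin_pos; lra).
    assert (t <= d / 2) by apply Rmin_l. assert (t <= del / 2) by apply Rmin_r.
    destruct (Rlt_dec 0 (g x)) as [Hs|Hs].
    - specialize (H t ltac:(rewrite Rabs_right; lra)). rewrite (Rabs_right t), (Rabs_right (g x)) in H by lra.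
      assert (T := Hmax (x + t) ltac:(replace (x + t - x) with t by ring; rewrite Rabs_right; lra)).
      apply Rabs_le_between in H. nra.
    - specialize (H (- t) ltac:(rewrite Rabs_Ropp, Rabs_right; lra)). rewrite Rabs_Ropp, (Rabs_right t), (Rabs_left (g x)) in H by lra.
      assert (T := Hmax (x + - t) ltac:(replace (x + - t - x) with (- t) by ring; rewrite Rabs_Ropp, Rabs_right; lra)).
      apply Rabs_le_between in H. nra. }
  apply Rnot_lt_le. intro Hm.
  destruct (derivable_pt_lim_increment g x m (m / 2) Hg ltac:(lra)) as [d [Hd0 H]].
  set (t := Rmin (d / 2) (del / 2)). assert (Ht : 0 < t) by (apply Rmin_pos; lra).
  assert (Ht1 : t <= d / 2) by apply Rmin_l. assert (Ht2 : t <= del / 2) by apply Rmin_r.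
  destruct (MVT_cor2 f g x (x + t) ltac:(lra)) as [c [Hc1 Hc2]].
  { intros c Hc. apply Hf. rewrite Rabs_right; lra. }
  specialize (H (c - x) ltac:(rewrite Rabs_right; lra)). rewrite Hg0, (Rabs_right (c - x)) in H by lra.
  replace (x + (c - x)) with c in H by ring. apply Rabs_le_between in H.
  assert (T := Hmax (x + t) ltac:(replace (x + t - x) with t by ring; rewrite Rabs_right; lra)).
  assert (0 < m * (c - x)) by (apply Rmult_lt_0_compat; lra).
  assert (0 < g c * (x + t - x)) by (apply Rmult_lt_0_compat; lra). lra.
Qed.

Lemma derivable_pt_lim_shift (f : R -> R) (x h l : R) :
  derivable_pt_lim f (x + h) l -> derivable_pt_lim (fun s => f (s + h)) x l.
Proof.
  intros H eps He. destruct (H eps He) as [d Hd]. exists d. intros k Hk1 Hk2.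
  replace (x + k + h) with (x + h + k) by ring. apply Hd; auto.
Qed.

(** Taken in [x] alone, which suffices for a complex derivative: applied to a double primitive of
    [u + i v] it approximates [u + i v], and it is differentiable twice more than [u] and [v] are
    known to be. *)
Definition second_diff (h : R) (f : R -> R -> R) (x y : R) : R :=
  (f (x + h) y - 2 * f x y + f (x + - h) y) / (h * h).

Lemma derivable_pt_lim_comb3 (f g k : R -> R) (x l1 l2 l3 m : R) :
  derivable_pt_lim f x l1 -> derivable_pt_lim g x l2 -> derivable_pt_lim k x l3 ->
  derivable_pt_lim (fun s => (f s - 2 * g s + k s) / m) x ((l1 - 2 * l2 + l3) / m).
Proof.
  intros H1 H2 H3.
  apply (derivable_pt_lim_ext (fun s => / m * (f s - 2 * g s + k s))).
  { intros s. unfold Rdiv. ring. }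
  replace ((l1 - 2 * l2 + l3) / m) with (/ m * (l1 - 2 * l2 + l3)) by (unfold Rdiv; ring).
  apply (derivable_pt_lim_scal (fun s => f s - 2 * g s + k s)).
  apply (derivable_pt_lim_plus (fun s => f s - 2 * g s)); auto.
  apply (derivable_pt_lim_minus f (fun s => 2 * g s)); auto.
  apply (derivable_pt_lim_scal g); auto.
Qed.

Lemma second_diff_dx (h : R) (f fx : R -> R -> R) (x y : R) :
  derivable_pt_lim (fun s => f s y) (x + h) (fx (x + h) y) ->
  derivable_pt_lim (fun s => f s y) x (fx x y) ->
  derivable_pt_lim (fun s => f s y) (x + - h) (fx (x + - h) y) ->
  derivable_pt_lim (fun s => second_diff h f s y) x (second_diff h fx x y).
Proof.
  intros H1 H2 H3. apply (derivable_pt_lim_comb3 (fun s => f (s + h) y) (fun s => f s y) (fun s => f (s + - h) y)); auto.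
  - apply (derivable_pt_lim_shift (fun s => f s y)); auto.
  - apply (derivable_pt_lim_shift (fun s => f s y)); auto.
Qed.

(** Two applications of the mean value theorem. The quotient is a value of [u] within [h], so
    uniform continuity of [u] yields uniform approximation. *)
Lemma second_diff_mean_value (h : R) (c a u : R -> R) (x : R) : 0 < h ->
  (forall s, x - h <= s <= x + h -> derivable_pt_lim c s (a s)) ->
  (forall s, x - h <= s <= x + h -> derivable_pt_lim a s (u s)) ->
  exists z, x - h <= z <= x + h /\ (c (x + h) - 2 * c x + c (x + - h)) / (h * h) = u z.
Proof.
  intros Hh Hc Ha.
  destruct (MVT_cor2 (fun s => c (s + h) - c s) (fun s => a (s + h) - a s) (x - h) x ltac:(lra)) as [t [H1 H2]].
  { intros s Hs. apply (derivable_pt_lim_minus (fun s => c (s + h)) c).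
    - apply derivable_pt_lim_shift. apply Hc; lra.
    - apply Hc; lra. }
  destruct (MVT_cor2 a u t (t + h) ltac:(lra)) as [z [H3 H4]].
  { intros s Hs. apply Ha; lra. }
  exists z. split; [lra|].
  replace (x - h + h) with x in H1 by ring. replace (x - h) with (x + - h) in H1 by ring.
  replace (c (x + h) - 2 * c x + c (x + - h)) with (u z * (h * h)).
  - field; lra.
  - rewrite H3 in H1. replace (x - (x + - h)) with h in H1 by ring. lra.
Qed.

Lemma cont2_second_diff (h : R) (f : R -> R -> R) : cont2 f -> cont2 (second_diff h f).
Proof.
  intros Hf x y. unfold second_diff, Rdiv.
  assert (S : forall k, continuity_2d_pt (fun x y => f (x + k) y) x y).
  { intros k. apply (continuity_2d_pt_ext (fun x y => f (x + k) (y + 0))).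
    - intros; rewrite Rplus_0_r; auto.
    - apply cont2_shift; auto. }
  apply continuity_2d_pt_mult; [|apply continuity_2d_pt_const].
  apply continuity_2d_pt_plus; auto. apply continuity_2d_pt_minus; auto.
  apply continuity_2d_pt_mult; auto. apply continuity_2d_pt_const.
Qed.

Lemma derivable_pt_lim_sum_squares (U V U1 V1 : R -> R) (x al e x0 k : R) :
  derivable_pt_lim U x (U1 x) -> derivable_pt_lim V x (V1 x) ->
  derivable_pt_lim (fun s => U s * U s + V s * V s + (al * (s - x0) + e * ((s - x0) * (s - x0))) + k) x
    (2 * (U x * U1 x + V x * V1 x) + (al + 2 * e * (x - x0))).
Proof.
  intros HU HV. apply is_derive_Reals in HU, HV. apply is_derive_Reals.
  auto_derive.
  - repeat split; auto; eexists; eauto.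
  - assert (DU : Derive (fun s : R => U s) x = U1 x) by exact (is_derive_unique _ _ _ HU).
    assert (DV : Derive (fun s : R => V s) x = V1 x) by exact (is_derive_unique _ _ _ HV).
    rewrite DU, DV. ring.
Qed.

Lemma derivable_pt_lim_sum_squares' (U V U1 V1 U2 V2 : R -> R) (x al e x0 : R) :
  derivable_pt_lim U x (U1 x) -> derivable_pt_lim V x (V1 x) ->
  derivable_pt_lim U1 x (U2 x) -> derivable_pt_lim V1 x (V2 x) ->
  derivable_pt_lim (fun x => 2 * (U x * U1 x + V x * V1 x) + (al + 2 * e * (x - x0))) x
    (2 * (U1 x * U1 x + V1 x * V1 x + U x * U2 x + V x * V2 x) + 2 * e).
Proof.
  intros HU HV HU1 HV1. apply is_derive_Reals in HU, HV, HU1, HV1. apply is_derive_Reals.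
  auto_derive.
  - repeat split; auto; eexists; eauto.
  - assert (DU : Derive (fun s : R => U s) x = U1 x) by exact (is_derive_unique _ _ _ HU).
    assert (DV : Derive (fun s : R => V s) x = V1 x) by exact (is_derive_unique _ _ _ HV).
    assert (DU1 : Derive (fun s : R => U1 s) x = U2 x) by exact (is_derive_unique _ _ _ HU1).
    assert (DV1 : Derive (fun s : R => V1 s) x = V2 x) by exact (is_derive_unique _ _ _ HV1).
    rewrite DU, DV, DU1, DV1. ring.
Qed.

(* Second differences of a double primitive give smooth holomorphic approximations, whose squared modulus is subharmonic. *)
Lemma no_strict_local_max (u v : R -> R -> R) (x0 y0 r al be e : R) : cont2 u -> cont2 v -> 0 < r -> 0 < e ->
  (forall x y, x0 - r < x < x0 + r -> y0 - r < y < y0 + r -> weak_CR u v x y) ->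
  (forall x y, x0 - r < x < x0 + r -> y0 - r < y < y0 + r ->
     u x y * u x y + v x y * v x y + (al * (x - x0) + be * (y - y0)) +
       e * ((x - x0) * (x - x0) + (y - y0) * (y - y0)) <= u x0 y0 * u x0 y0 + v x0 y0 * v x0 y0) -> False.
Proof.
  intros Hu Hv Hr He HCR Hmax.
  destruct (weak_CR_primitive u v (x0 - r) (x0 + r) (y0 - r) (y0 + r)) as [a [b [Ha [Hb Hab]]]]; auto; try lra.
  destruct (weak_CR_primitive a b (x0 - r) (x0 + r) (y0 - r) (y0 + r)) as [c [d [Hc [Hd Hcd]]]]; auto; try lra.
  { intros x y Hx Hy. apply (complex_primitive_CR a b u v (x0 - r) (x0 + r) (y0 - r) (y0 + r)); auto. }
  set (rho := r / 2). assert (Hrho : 0 < rho < r) by (unfold rho; lra).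
  destruct (cont2_bounded u (x0 - r) (x0 + r) (y0 - r) (y0 + r) Hu) as [Bu [Bu0 HBu]].
  destruct (cont2_bounded v (x0 - r) (x0 + r) (y0 - r) (y0 + r) Hv) as [Bv [Bv0 HBv]].
  set (M := Bu + Bv + 1).
  (* Error budget: replacing [u], [v] by approximations within [tau] changes the squared modulus by
     at most [4 * M * tau], an eighth of the margin [e * rho * rho]. *)
  set (tau := Rmin 1 (e * rho * rho / (32 * M))).
  assert (HM : 1 <= M) by (unfold M; lra).
  assert (Her : 0 < e * rho * rho) by (repeat apply Rmult_lt_0_compat; lra).
  assert (Htau : 0 < tau) by (apply Rmin_pos; [lra|apply Rdiv_lt_0_compat; lra]).
  assert (Htau1 : tau <= 1) by apply Rmin_l.
  assert (Htau2 : 4 * M * tau <= e * rho * rho / 8).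
  { apply Rle_trans with (4 * M * (e * rho * rho / (32 * M))); [|right; field; lra].
    apply Rmult_le_compat_l; [lra|apply Rmin_r]. }
  destruct (uniform_continuity_2d u (x0 - r) (x0 + r) (y0 - r) (y0 + r) (fun x y _ _ => Hu x y) (mkposreal _ Htau)) as [d1 H1].
  destruct (uniform_continuity_2d v (x0 - r) (x0 + r) (y0 - r) (y0 + r) (fun x y _ _ => Hv x y) (mkposreal _ Htau)) as [d2 H2].
  simpl in H1, H2. assert (Hd1 := cond_pos d1). assert (Hd2 := cond_pos d2).
  set (h := Rmin (Rmin (d1 / 2) (d2 / 2)) (r / 4)).
  assert (Hh : 0 < h) by (repeat apply Rmin_pos; lra).
  assert (Hh1 : h <= d1 / 2) by (eapply Rle_trans; [apply Rmin_l|apply Rmin_l]).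
  assert (Hh2 : h <= d2 / 2) by (eapply Rle_trans; [apply Rmin_l|apply Rmin_r]).
  assert (Hh3 : h <= r / 4) by apply Rmin_r. clearbody h.
  set (U := second_diff h c). set (V := second_diff h d).
  assert (HU : forall x y, in_rect (x0 - rho) (x0 + rho) (y0 - rho) (y0 + rho) x y -> Rabs (U x y - u x y) <= tau).
  { intros x y [Hx Hy]. unfold rho in Hx, Hy.
    destruct (second_diff_mean_value h (fun s => c s y) (fun s => a s y) (fun s => u s y) x Hh) as [z [Hz1 Hz2]].
    - intros s Hs. apply Hcd; lra.
    - intros s Hs. apply Hab; lra.
    - unfold U, second_diff. rewrite Hz2. apply Rlt_le, H1; try lra; apply Rabs_def1; lra. }
  assert (HV : forall x y, in_rect (x0 - rho) (x0 + rho) (y0 - rho) (y0 + rho) x y -> Rabs (V x y - v x y) <= tau).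
  { intros x y [Hx Hy]. unfold rho in Hx, Hy.
    destruct (second_diff_mean_value h (fun s => d s y) (fun s => b s y) (fun s => v s y) x Hh) as [z [Hz1 Hz2]].
    - intros s Hs. apply Hcd; lra.
    - intros s Hs. apply Hab; lra.
    - unfold V, second_diff. rewrite Hz2. apply Rlt_le, H2; try lra; apply Rabs_def1; lra. }
  set (G := fun x y => u x y * u x y + v x y * v x y).
  assert (HG : forall x y, in_rect (x0 - rho) (x0 + rho) (y0 - rho) (y0 + rho) x y ->
     Rabs (U x y * U x y + V x y * V x y - G x y) <= e * rho * rho / 8).
  { intros x y Hin. assert (T1 := HU x y Hin). assert (T2 := HV x y Hin).
    assert (S1 := HBu x y ltac:(destruct Hin; split; lra)). assert (S2 := HBv x y ltac:(destruct Hin; split; lra)).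
    assert (Sq : forall s t k, Rabs (s - t) <= tau -> Rabs t <= k -> Rabs (s * s - t * t) <= (2 * k + 1) * tau).
    { intros s t k Hs Ht. replace (s * s - t * t) with ((s + t) * (s - t)) by ring. rewrite Rabs_mult.
      apply Rmult_le_compat; auto using Rabs_pos.
      apply Rabs_le_between in Hs, Ht. apply Rabs_le. lra. }
    assert (Q1 := Sq _ _ _ T1 S1). assert (Q2 := Sq _ _ _ T2 S2). unfold G.
    eapply Rle_trans; [|apply Htau2].
    replace (U x y * U x y + V x y * V x y - (u x y * u x y + v x y * v x y)) with
      ((U x y * U x y - u x y * u x y) + (V x y * V x y - v x y * v x y)) by ring.
    eapply Rle_trans; [apply Rabs_triang|]. unfold M. nra. }
  assert (CU : cont2 U) by (apply cont2_second_diff; auto).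
  assert (CV : cont2 V) by (apply cont2_second_diff; auto).
  (* Half of the quadratic term is kept so that the Laplacian of [H] is positive. The other half
     absorbs the two approximation errors and forces the maximum point of [H] into the open disc of
     radius [rho]. *)
  set (H := fun x y => U x y * U x y + V x y * V x y + (al * (x - x0) + be * (y - y0)) +
     e / 2 * ((x - x0) * (x - x0) + (y - y0) * (y - y0))).
  assert (CH : cont2 H).
  { intros x y. unfold H.
    assert (I1 := continuity_2d_pt_id1 x y). assert (I2 := continuity_2d_pt_id2 x y).
    repeat first [exact (CU x y) | exact (CV x y) | exact I1 | exact I2 | apply continuity_2d_pt_const
      | apply continuity_2d_pt_plus | apply continuity_2d_pt_minus | apply continuity_2d_pt_mult]. }
  destruct (usc_attains_max H (x0 - rho) (x0 + rho) (y0 - rho) (y0 + rho)) as [x1 [y1 [Hin Hm]]]; try lra.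
  { intros x y B _ HB. destruct (cont2_near H x y (B - H x y) (CH x y) ltac:(lra)) as [de [Hde Hn]].
    exists de; split; auto. intros x' y' _ Hn'. specialize (Hn x' y' Hn'). apply Rabs_def2 in Hn. lra. }
  assert (H00 := Hm x0 y0 ltac:(split; lra)).
  assert (G00 := HG x0 y0 ltac:(split; lra)). assert (G11 := HG x1 y1 Hin).
  destruct Hin as [Hx1 Hy1].
  assert (M11 := Hmax x1 y1 ltac:(lra) ltac:(lra)).
  fold (G x1 y1) in M11. fold (G x0 y0) in M11. unfold H in H00. rewrite !Rminus_diag in H00.
  apply Rabs_le_between in G00, G11.
  assert (Hsq : (x1 - x0) * (x1 - x0) + (y1 - y0) * (y1 - y0) < rho * rho).
  { apply Rnot_le_lt. intro Hge. apply (Rmult_le_compat_l e) in Hge; [|lra]. lra. }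
  assert (Hx1' : x0 - rho < x1 < x0 + rho).
  { assert (0 <= (y1 - y0) * (y1 - y0)) by apply Rle_0_sqr. split; nra. }
  assert (Hy1' : y0 - rho < y1 < y0 + rho).
  { assert (0 <= (x1 - x0) * (x1 - x0)) by apply Rle_0_sqr. split; nra. }
  destruct (rect_margin _ _ _ Hx1') as [ex [Hex Mx]]. destruct (rect_margin _ _ _ Hy1') as [ey [Hey My]].
  set (U1 := second_diff h a). set (V1 := second_diff h b). set (U2 := second_diff h u). set (V2 := second_diff h v).
  assert (Ixr : forall s, x0 - rho < s < x0 + rho -> (x0 - r < s < x0 + r) /\ (x0 - r < s + h < x0 + r) /\ (x0 - r < s + - h < x0 + r)).
  { intros s Hs. unfold rho in Hs. lra. }
  assert (Iyr : forall s, y0 - rho < s < y0 + rho -> y0 - r < s < y0 + r) by (intros; lra).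
  assert (Dx : 2 * (U1 x1 y1 * U1 x1 y1 + V1 x1 y1 * V1 x1 y1 + U x1 y1 * U2 x1 y1 + V x1 y1 * V2 x1 y1) + 2 * (e / 2) <= 0).
  { assert (D : forall s, x0 - rho < s < x0 + rho ->
       derivable_pt_lim (fun s => U s y1) s (U1 s y1) /\ derivable_pt_lim (fun s => V s y1) s (V1 s y1) /\
       derivable_pt_lim (fun s => U1 s y1) s (U2 s y1) /\ derivable_pt_lim (fun s => V1 s y1) s (V2 s y1)).
    { intros s Hs. destruct (Ixr s Hs) as [J1 [J2 J3]]. assert (J4 := Iyr y1 Hy1').
      repeat split; apply second_diff_dx; first [apply Hcd|apply Hab]; auto. }
    apply (second_derivative_test (fun s => H s y1)
       (fun s => 2 * (U s y1 * U1 s y1 + V s y1 * V1 s y1) + (al + 2 * (e / 2) * (s - x0))) x1 _ ex Hex).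
    - intros s Hs. destruct (D s (Mx s Hs)) as [K1 [K2 _]].
      apply (derivable_pt_lim_ext (fun s => U s y1 * U s y1 + V s y1 * V s y1 + (al * (s - x0) + e / 2 * ((s - x0) * (s - x0))) +
        (be * (y1 - y0) + e / 2 * ((y1 - y0) * (y1 - y0))))).
      + intros t. unfold H. ring.
      + apply (derivable_pt_lim_sum_squares (fun s => U s y1) (fun s => V s y1) (fun s => U1 s y1) (fun s => V1 s y1)); auto.
    - destruct (D x1 Hx1') as [K1 [K2 [K3 K4]]].
      apply (derivable_pt_lim_sum_squares' (fun s => U s y1) (fun s => V s y1) (fun s => U1 s y1) (fun s => V1 s y1) (fun s => U2 s y1) (fun s => V2 s y1)); auto.
    - intros s Hs. apply Hm. assert (T := Mx s Hs). split; lra. }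
  assert (Dy : 2 * (- V1 x1 y1 * - V1 x1 y1 + U1 x1 y1 * U1 x1 y1 + U x1 y1 * - U2 x1 y1 + V x1 y1 * - V2 x1 y1) + 2 * (e / 2) <= 0).
  { assert (L : forall f g, (forall x y, x0 - r < x < x0 + r -> y0 - r < y < y0 + r -> derivable_pt_lim (fun s => f x s) y (g x y)) ->
       forall s, y0 - rho < s < y0 + rho -> derivable_pt_lim (fun s => second_diff h f x1 s) s (second_diff h g x1 s)).
    { intros f g Hfg s Hs. destruct (Ixr x1 Hx1') as [J1 [J2 J3]].
      apply (derivable_pt_lim_comb3 (fun s => f (x1 + h) s) (fun s => f x1 s) (fun s => f (x1 + - h) s)); apply Hfg; auto. }
    assert (Op : forall f x y, second_diff h (fun x y => - f x y) x y = - second_diff h f x y).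
    { intros f x y. unfold second_diff, Rdiv. ring. }
    assert (D : forall s, y0 - rho < s < y0 + rho ->
       derivable_pt_lim (fun s => U x1 s) s (- V1 x1 s) /\ derivable_pt_lim (fun s => V x1 s) s (U1 x1 s) /\
       derivable_pt_lim (fun s => - V1 x1 s) s (- U2 x1 s) /\ derivable_pt_lim (fun s => U1 x1 s) s (- V2 x1 s)).
    { intros s Hs. repeat split.
      - unfold V1. rewrite <- Op. apply L; auto. intros; apply Hcd; auto.
      - apply L; auto. intros; apply Hcd; auto.
      - apply (derivable_pt_lim_opp (fun s => V1 x1 s)). apply L; auto. intros; apply Hab; auto.
      - unfold V2. rewrite <- Op. apply L; auto. intros; apply Hab; auto. }
    apply (second_derivative_test (fun s => H x1 s)
       (fun s => 2 * (U x1 s * - V1 x1 s + V x1 s * U1 x1 s) + (be + 2 * (e / 2) * (s - y0))) y1 _ ey Hey).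
    - intros s Hs. destruct (D s (My s Hs)) as [K1 [K2 _]].
      apply (derivable_pt_lim_ext (fun s => U x1 s * U x1 s + V x1 s * V x1 s + (be * (s - y0) + e / 2 * ((s - y0) * (s - y0))) +
        (al * (x1 - x0) + e / 2 * ((x1 - x0) * (x1 - x0))))).
      + intros t. unfold H. ring.
      + apply (derivable_pt_lim_sum_squares (fun s => U x1 s) (fun s => V x1 s) (fun s => - V1 x1 s) (fun s => U1 x1 s)); auto.
    - destruct (D y1 Hy1') as [K1 [K2 [K3 K4]]].
      apply (derivable_pt_lim_sum_squares' (fun s => U x1 s) (fun s => V x1 s) (fun s => - V1 x1 s) (fun s => U1 x1 s) (fun s => - U2 x1 s) (fun s => - V2 x1 s)); auto.
    - intros s Hs. apply Hm. assert (T := My s Hs). split; lra. }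
  (* Adding [Dx] and [Dy]: the terms with [U2] and [V2] cancel because [U] and [V] are harmonic, and
     what remains is four times the squared modulus of the derivative plus [2 * e], which is
     positive. *)
  assert (0 <= U1 x1 y1 * U1 x1 y1) by apply Rle_0_sqr.
  assert (0 <= V1 x1 y1 * V1 x1 y1) by apply Rle_0_sqr. lra.
Qed.

(** * The Phragmen-Lindelof principle on a plane strip *)

Lemma weak_CR_local (u v u' v' : R -> R -> R) (x y del : R) : 0 < del ->
  (forall s t, near del x y s t -> u s t = u' s t /\ v s t = v' s t) ->
  weak_CR u v x y -> weak_CR u' v' x y.
Proof.
  intros Hd H [ux [uy [H1 [H2 [H3 H4]]]]].
  assert (Z : forall z, Rabs (z - z) < del) by (intros; rewrite Rminus_diag, Rabs_R0; auto).
  exists ux, uy. repeat split.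
  - apply (derivable_pt_lim_local (fun s => u s y) _ _ _ del); auto. intros s Hs. apply H. split; auto.
  - apply (derivable_pt_lim_local (fun s => u x s) _ _ _ del); auto. intros s Hs. apply H. split; auto.
  - apply (derivable_pt_lim_local (fun s => v s y) _ _ _ del); auto. intros s Hs. apply H. split; auto.
  - apply (derivable_pt_lim_local (fun s => v x s) _ _ _ del); auto. intros s Hs. apply H. split; auto.
Qed.

Lemma weak_CR_mult (u v a b : R -> R -> R) (x y : R) : weak_CR u v x y -> weak_CR a b x y ->
  weak_CR (fun x y => u x y * a x y - v x y * b x y) (fun x y => u x y * b x y + v x y * a x y) x y.
Proof.
  intros [ux [uy [H1 [H2 [H3 H4]]]]] [ax [ay [K1 [K2 [K3 K4]]]]].
  assert (P : forall f g f' g' z l m l' m', derivable_pt_lim f z l -> derivable_pt_lim g z m ->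
     derivable_pt_lim f' z l' -> derivable_pt_lim g' z m' ->
     derivable_pt_lim (fun s => f s * g s + f' s * g' s) z ((l * g z + f z * m) + (l' * g' z + f' z * m'))).
  { intros. apply (derivable_pt_lim_plus (fun s => f s * g s) (fun s => f' s * g' s)).
    - apply (derivable_pt_lim_mult f g); auto.
    - apply (derivable_pt_lim_mult f' g'); auto. }
  assert (Mi : forall f g f' g' z l m l' m', derivable_pt_lim f z l -> derivable_pt_lim g z m ->
     derivable_pt_lim f' z l' -> derivable_pt_lim g' z m' ->
     derivable_pt_lim (fun s => f s * g s - f' s * g' s) z ((l * g z + f z * m) - (l' * g' z + f' z * m'))).
  { intros. apply (derivable_pt_lim_minus (fun s => f s * g s) (fun s => f' s * g' s)).
    - apply (derivable_pt_lim_mult f g); auto.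
    - apply (derivable_pt_lim_mult f' g'); auto. }
  exists (ux * a x y + u x y * ax - (- uy * b x y + v x y * - ay)), (uy * a x y + u x y * ay - (ux * b x y + v x y * ax)).
  repeat split.
  - apply (Mi (fun s => u s y) (fun s => a s y) (fun s => v s y) (fun s => b s y)); auto.
  - apply (Mi (fun s => u x s) (fun s => a x s) (fun s => v x s) (fun s => b x s)); auto.
  - replace (- (uy * a x y + u x y * ay - (ux * b x y + v x y * ax))) with
      ((ux * b x y + u x y * - ay) + (- uy * a x y + v x y * ax)) by ring.
    apply (P (fun s => u s y) (fun s => b s y) (fun s => v s y) (fun s => a s y)); auto.
  - replace (ux * a x y + u x y * ax - (- uy * b x y + v x y * - ay)) with
      ((uy * b x y + u x y * ax) + (ux * a x y + v x y * ay)) by ring.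
    apply (P (fun s => u x s) (fun s => b x s) (fun s => v x s) (fun s => a x s)); auto.
Qed.

Lemma weak_CR_exp (a b : R -> R -> R) (x y : R) : weak_CR a b x y ->
  weak_CR (fun x y => exp (a x y) * cos (b x y)) (fun x y => exp (a x y) * sin (b x y)) x y.
Proof.
  intros [ax [ay [H1 [H2 [H3 H4]]]]].
  assert (E : forall f z l, derivable_pt_lim f z l -> derivable_pt_lim (fun s => exp (f s)) z (exp (f z) * l)).
  { intros. apply (derivable_pt_lim_comp f exp); auto. apply derivable_pt_lim_exp. }
  assert (Co : forall f z l, derivable_pt_lim f z l -> derivable_pt_lim (fun s => cos (f s)) z (- sin (f z) * l)).
  { intros. apply (derivable_pt_lim_comp f cos); auto. apply derivable_pt_lim_cos. }
  assert (Si : forall f z l, derivable_pt_lim f z l -> derivable_pt_lim (fun s => sin (f s)) z (cos (f z) * l)).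
  { intros. apply (derivable_pt_lim_comp f sin); auto. apply derivable_pt_lim_sin. }
  set (ea := exp (a x y)). set (cb := cos (b x y)). set (sb := sin (b x y)).
  exists (ea * ax * cb + ea * (- sb * - ay)), (ea * ay * cb + ea * (- sb * ax)). repeat split.
  - apply (derivable_pt_lim_mult (fun s => exp (a s y)) (fun s => cos (b s y))).
    + apply (E (fun s => a s y)); auto.
    + apply (Co (fun s => b s y)); auto.
  - apply (derivable_pt_lim_mult (fun s => exp (a x s)) (fun s => cos (b x s))).
    + apply (E (fun s => a x s)); auto.
    + apply (Co (fun s => b x s)); auto.
  - replace (- (ea * ay * cb + ea * (- sb * ax))) with (ea * ax * sb + ea * (cb * - ay)) by ring.
    apply (derivable_pt_lim_mult (fun s => exp (a s y)) (fun s => sin (b s y))).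
    + apply (E (fun s => a s y)); auto.
    + apply (Si (fun s => b s y)); auto.
  - replace (ea * ax * cb + ea * (- sb * - ay)) with (ea * ay * sb + ea * (cb * ax)) by ring.
    apply (derivable_pt_lim_mult (fun s => exp (a x s)) (fun s => sin (b x s))).
    + apply (E (fun s => a x s)); auto.
    + apply (Si (fun s => b x s)); auto.
Qed.

Section Strip.

(* Coordinates adapted to the strip: [(al - i be) (x + i y) = (across + ga) + i along]. *)
Variables (al be ga : R).
Hypothesis Hab : al * al + be * be = 1.

Definition across (x y : R) : R := al * x + be * y - ga.
Definition along (x y : R) : R := - be * x + al * y.
Definition abscissa (s t : R) : R := al * (s + ga) - be * t.
Definition ordinate (s t : R) : R := be * (s + ga) + al * t.

Lemma across_of (s t : R) : across (abscissa s t) (ordinate s t) = s.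
Proof.
  unfold across, abscissa, ordinate.
  replace (al * (al * (s + ga) - be * t) + be * (be * (s + ga) + al * t) - ga) with
    ((al * al + be * be) * (s + ga) - ga) by ring. rewrite Hab. ring.
Qed.

Lemma along_of (s t : R) : along (abscissa s t) (ordinate s t) = t.
Proof.
  unfold along, abscissa, ordinate.
  replace (- be * (al * (s + ga) - be * t) + al * (be * (s + ga) + al * t)) with
    ((al * al + be * be) * t) by ring. rewrite Hab. ring.
Qed.

Lemma abscissa_of (x y : R) : abscissa (across x y) (along x y) = x.
Proof.
  unfold across, along, abscissa.
  replace (al * (al * x + be * y - ga + ga) - be * (- be * x + al * y)) with ((al * al + be * be) * x) by ring.
  rewrite Hab. ring.
Qed.

Lemma ordinate_of (x y : R) : ordinate (across x y) (along x y) = y.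
Proof.
  unfold across, along, ordinate.
  replace (be * (al * x + be * y - ga + ga) + al * (- be * x + al * y)) with ((al * al + be * be) * y) by ring.
  rewrite Hab. ring.
Qed.

Lemma direction_bounds : Rabs al <= 1 /\ Rabs be <= 1.
Proof.
  assert (0 <= al * al) by apply Rle_0_sqr. assert (0 <= be * be) by apply Rle_0_sqr.
  split; apply Rabs_le; nra.
Qed.

Lemma lin_bound (a b x y : R) : Rabs a <= 1 -> Rabs b <= 1 -> Rabs (a * x + b * y) <= Rabs x + Rabs y.
Proof.
  intros Ha Hb. eapply Rle_trans; [apply Rabs_triang|]. rewrite !Rabs_mult.
  assert (P1 := Rabs_pos x). assert (P2 := Rabs_pos y). nra.
Qed.

Lemma across_lip (x y x' y' : R) : Rabs (across x y - across x' y') <= l1 x y x' y'.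
Proof.
  destruct direction_bounds. unfold across, l1.
  replace (al * x + be * y - ga - (al * x' + be * y' - ga)) with (al * (x - x') + be * (y - y')) by ring.
  apply lin_bound; auto.
Qed.

Lemma along_lip (x y x' y' : R) : Rabs (along x y - along x' y') <= l1 x y x' y'.
Proof.
  destruct direction_bounds. unfold along, l1.
  replace (- be * x + al * y - (- be * x' + al * y')) with (- be * (x - x') + al * (y - y')) by ring.
  apply lin_bound; auto. rewrite Rabs_Ropp; auto.
Qed.

Lemma abscissa_lip (s t s' t' : R) : Rabs (abscissa s t - abscissa s' t') <= l1 s t s' t'.
Proof.
  destruct direction_bounds. unfold abscissa, l1.
  replace (al * (s + ga) - be * t - (al * (s' + ga) - be * t')) with (al * (s - s') + - be * (t - t')) by ring.
  apply lin_bound; auto. rewrite Rabs_Ropp; auto.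
Qed.

Lemma ordinate_lip (s t s' t' : R) : Rabs (ordinate s t - ordinate s' t') <= l1 s t s' t'.
Proof.
  destruct direction_bounds. unfold ordinate, l1.
  replace (be * (s + ga) + al * t - (be * (s' + ga) + al * t')) with (be * (s - s') + al * (t - t')) by ring.
  apply lin_bound; auto.
Qed.

Lemma cont2_rotate (f : R -> R -> R) : cont2 f -> cont2 (fun x y => f (across x y) (along x y)).
Proof.
  intros Hf x y. apply near_cont2. intros eps He.
  destruct (cont2_near f _ _ eps (Hf (across x y) (along x y)) He) as [del [Hd H]].
  exists (del / 2). split; [lra|]. intros x' y' [N1 N2]. apply H.
  assert (T1 := across_lip x' y' x y). assert (T2 := along_lip x' y' x y). unfold l1 in *. split; lra.
Qed.

Lemma max_principle_rect (f g : R -> R -> R) (sig T B : R) : cont2 f -> cont2 g -> 0 < sig -> 0 < T ->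
  (forall x y, Rabs (across x y) < sig -> Rabs (along x y) < T ->
     weak_CR (fun x y => f (across x y) (along x y)) (fun x y => g (across x y) (along x y)) x y) ->
  (forall s t, Rabs s <= sig -> Rabs t <= T -> Rabs s = sig \/ Rabs t = T -> f s t * f s t + g s t * g s t <= B) ->
  forall s t, Rabs s <= sig -> Rabs t <= T -> f s t * f s t + g s t * g s t <= B.
Proof.
  intros Hf Hg Hsig HT HCR Hbd s0 t0 Hs0 Ht0.
  apply Rnot_lt_le. intro Hlt. set (eta := f s0 t0 * f s0 t0 + g s0 t0 * g s0 t0 - B).
  assert (Hpos : 0 < sig * sig + T * T) by nra.
  (* The quadratic term then adds at most [eta / 2] on the sides, so the maximum of [H] lies
     inside. *)
  set (e := eta / (2 * (sig * sig + T * T))).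
  assert (He : 0 < e) by (apply Rdiv_lt_0_compat; [unfold eta|]; lra).
  set (H := fun s t => f s t * f s t + g s t * g s t + e * (s * s + t * t)).
  assert (CH : cont2 H).
  { intros x y. unfold H.
    assert (I1 := continuity_2d_pt_id1 x y). assert (I2 := continuity_2d_pt_id2 x y).
    repeat first [exact (Hf x y) | exact (Hg x y) | exact I1 | exact I2 | apply continuity_2d_pt_const
      | apply continuity_2d_pt_plus | apply continuity_2d_pt_mult]. }
  destruct (usc_attains_max H (- sig) sig (- T) T) as [s1 [t1 [[Hs1 Ht1] Hm]]]; try lra.
  { intros x y v _ Hv. destruct (cont2_near H x y (v - H x y) (CH x y) ltac:(lra)) as [de [Hde Hn]].
    exists de; split; auto. intros x' y' _ Hn'. specialize (Hn x' y' Hn'). apply Rabs_def2 in Hn. lra. }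
  assert (H0 := Hm s0 t0 ltac:(apply Rabs_le_between in Hs0, Ht0; split; lra)).
  assert (As1 : Rabs s1 <= sig) by (apply Rabs_le; lra).
  assert (At1 : Rabs t1 <= T) by (apply Rabs_le; lra).
  assert (Hin : Rabs s1 < sig /\ Rabs t1 < T).
  { assert (Hno : ~ (Rabs s1 = sig \/ Rabs t1 = T)); [|lra].
    intro Hor. assert (Q := Hbd s1 t1 As1 At1 Hor). unfold H in H0.
    assert (0 <= e * (s0 * s0 + t0 * t0)) by (apply Rmult_le_pos; nra).
    assert (e * (s1 * s1 + t1 * t1) <= e * (sig * sig + T * T)) by (apply Rmult_le_compat_l; nra).
    assert (e * (sig * sig + T * T) = eta / 2) by (unfold e; field; lra).
    unfold eta in *. lra. }
  destruct Hin as [Is1 It1].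
  (* In a square of half side [r] both rotated coordinates move by less than [2 * r], since each has
     Lipschitz constant 1 for [l1]. *)
  set (r := Rmin (sig - Rabs s1) (T - Rabs t1) / 2).
  assert (Hr : 0 < r) by (unfold r; assert (0 < Rmin (sig - Rabs s1) (T - Rabs t1)) by (apply Rmin_pos; lra); lra).
  assert (Hr1 : 2 * r <= sig - Rabs s1) by (unfold r; assert (Z := Rmin_l (sig - Rabs s1) (T - Rabs t1)); lra).
  assert (Hr2 : 2 * r <= T - Rabs t1) by (unfold r; assert (Z := Rmin_r (sig - Rabs s1) (T - Rabs t1)); lra).
  set (x1 := abscissa s1 t1). set (y1 := ordinate s1 t1).
  assert (Es1 : across x1 y1 = s1) by apply across_of. assert (Et1 : along x1 y1 = t1) by apply along_of.
  assert (Hbox : forall x y, x1 - r < x < x1 + r -> y1 - r < y < y1 + r -> Rabs (across x y) < sig /\ Rabs (along x y) < T).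
  { intros x y Hx Hy. assert (T1 := across_lip x y x1 y1). assert (T2 := along_lip x y x1 y1).
    rewrite Es1 in T1. rewrite Et1 in T2. unfold l1 in T1, T2.
    assert (Rabs (x - x1) < r) by (apply Rabs_def1; lra). assert (Rabs (y - y1) < r) by (apply Rabs_def1; lra).
    assert (Z1 := Rabs_triang_inv (across x y) s1). assert (Z2 := Rabs_triang_inv (along x y) t1). lra. }
  apply (no_strict_local_max (fun x y => f (across x y) (along x y)) (fun x y => g (across x y) (along x y)) x1 y1 r
     (e * (2 * s1 * al - 2 * t1 * be)) (e * (2 * s1 * be + 2 * t1 * al)) e); auto using cont2_rotate.
  - intros x y Hx Hy. destruct (Hbox x y Hx Hy). apply HCR; auto.
  - intros x y Hx Hy. destruct (Hbox x y Hx Hy) as [B1 B2]. apply Rabs_def2 in B1, B2.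
    assert (Q := Hm (across x y) (along x y) ltac:(split; lra)). unfold H in Q. rewrite Es1, Et1.
    assert (D1 : across x y = s1 + (al * (x - x1) + be * (y - y1))) by (rewrite <- Es1; unfold across; ring).
    assert (D2 : along x y = t1 + (- be * (x - x1) + al * (y - y1))) by (rewrite <- Et1; unfold along; ring).
    assert (D3 : across x y * across x y + along x y * along x y = s1 * s1 + t1 * t1 +
       ((2 * s1 * al - 2 * t1 * be) * (x - x1) + (2 * s1 * be + 2 * t1 * al) * (y - y1)) +
       ((al * al + be * be) * ((x - x1) * (x - x1) + (y - y1) * (y - y1)))) by (rewrite D1, D2; ring).
    rewrite D3, Hab in Q. lra.
Qed.

(* The real part and minus the imaginary part of [cos (kap * (s + i t))]. *)
Definition re_cos (kap s t : R) : R := cos (kap * s) * ((exp (kap * t) + exp (- (kap * t))) / 2).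
Definition im_cos (kap s t : R) : R := sin (kap * s) * ((exp (kap * t) - exp (- (kap * t))) / 2).

(** The pair is [- del * cos (kap * zeta)] with [zeta = across + i along], an affine function of
    [x + i y]. *)
Lemma weak_CR_cos (kap del x y : R) :
  weak_CR (fun x y => - del * re_cos kap (across x y) (along x y)) (fun x y => del * im_cos kap (across x y) (along x y)) x y.
Proof.
  set (c := cos (kap * across x y)). set (s := sin (kap * across x y)).
  set (ch := (exp (kap * along x y) + exp (- (kap * along x y))) / 2).
  set (sh := (exp (kap * along x y) - exp (- (kap * along x y))) / 2).
  exists (del * kap * (al * s * ch + be * c * sh)), (del * kap * (be * s * ch - al * c * sh)).
  unfold c, s, ch, sh, re_cos, im_cos, across, along.
  repeat split; apply is_derive_Reals; auto_derive; auto; unfold Rminus; field.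
Qed.

Lemma cont2_of_C0 (f : R -> R) (L : R -> R -> R) : (forall x, continuity_pt f x) -> cont2 L -> cont2 (fun x y => f (L x y)).
Proof. intros Hf HL x y. apply continuity_1d_2d_pt_comp; auto. Qed.

Lemma cont2_mult (f g : R -> R -> R) : cont2 f -> cont2 g -> cont2 (fun x y => f x y * g x y).
Proof. intros Hf Hg x y. apply continuity_2d_pt_mult; auto. Qed.

Lemma cont2_cst (k : R) : cont2 (fun _ _ => k).
Proof. intros x y. apply continuity_2d_pt_const. Qed.

Lemma cont2_cos_parts (kap : R) : cont2 (re_cos kap) /\ cont2 (im_cos kap).
Proof.
  assert (L1 : cont2 (fun s _ => kap * s)) by (apply cont2_mult; [apply cont2_cst|intros x y; apply continuity_2d_pt_id1]).
  assert (L2 : cont2 (fun _ t => kap * t)) by (apply cont2_mult; [apply cont2_cst|intros x y; apply continuity_2d_pt_id2]).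
  assert (Ce : forall x, continuity_pt exp x) by (intros; apply derivable_continuous_pt, derivable_pt_exp).
  assert (E1 := cont2_of_C0 exp _ Ce L2). assert (E2 := cont2_of_C0 exp _ Ce (cont2_opp _ L2)).
  split; unfold re_cos, im_cos, Rdiv; apply cont2_mult.
  - apply (cont2_of_C0 cos); auto. intros; apply continuity_cos.
  - apply cont2_mult; [apply cont2_plus; auto|apply cont2_cst].
  - apply (cont2_of_C0 sin); auto. intros; apply continuity_sin.
  - apply cont2_mult; [apply cont2_minus; auto|apply cont2_cst].
Qed.

Lemma cont2_clamp (f : R -> R -> R) (a b c d : R) : a <= b -> c <= d ->
  (forall x y eps, in_rect a b c d x y -> 0 < eps -> exists del, 0 < del /\
     forall x' y', in_rect a b c d x' y' -> near del x y x' y' -> Rabs (f x' y' - f x y) < eps) ->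
  cont2 (fun x y => f (clamp a b x) (clamp c d y)).
Proof.
  intros Hab' Hcd H x y. apply near_cont2. intros eps He.
  destruct (H (clamp a b x) (clamp c d y) eps) as [del [Hd H']]; auto.
  { split; apply clamp_in; auto. }
  exists del; split; auto. intros x' y' [N1 N2]. apply H'.
  - split; apply clamp_in; auto.
  - split; eapply Rle_lt_trans; eauto using clamp_lip.
Qed.

(** The change of coordinates is a rotation followed by a shift by [ga], so growth in the norm
    becomes growth in the coordinate along the strip. *)
Lemma norm_le_along (s t : R) : sqrt (abscissa s t ^ 2 + ordinate s t ^ 2) <= Rabs t + (Rabs s + Rabs ga).
Proof.
  replace (abscissa s t ^ 2 + ordinate s t ^ 2) with ((al * al + be * be) * ((s + ga) ^ 2 + t ^ 2)) by (unfold abscissa, ordinate; ring).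
  rewrite Hab, Rmult_1_l.
  assert (P1 := Rabs_pos (s + ga)). assert (P2 := Rabs_pos t).
  assert (T := Rabs_triang s ga).
  apply Rle_trans with (Rabs t + Rabs (s + ga)); [|lra].
  rewrite <- (sqrt_Rsqr (Rabs t + Rabs (s + ga))) by lra. apply sqrt_le_1_alt.
  rewrite <- (pow2_abs (s + ga)), <- (pow2_abs t). unfold Rsqr. nra.
Qed.

(** The exponent is [exp (k * T)] times [exp (k * L) - c * exp ((kap - k) * T)]. Once the second
    factor is at most -1, the exponent is at most [- (k * T)]. *)
Lemma double_exp_decay (N k kap L c tau : R) : 0 <= N -> 0 < k -> k < kap -> 0 < c -> 0 < tau ->
  forall T0, exists T, T0 <= T /\ 0 < T /\ N * exp (exp (k * (T + L))) * exp (- (c * exp (kap * T))) <= tau.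
Proof.
  intros HN Hk Hkap Hc Htau T0.
  set (w := (exp (k * L) + 1) / c).
  assert (Hw : 0 < w) by (apply Rdiv_lt_0_compat; auto; assert (P := exp_pos (k * L)); lra).
  (* The second entry brings the factor described above to -1 or less, the third gives
     [N / (k * T) <= tau]. *)
  set (T := Rmax T0 (Rmax (w / (kap - k)) (N / (k * tau) + 1))).
  assert (T1 : T0 <= T) by apply Rmax_l.
  assert (T2 : w / (kap - k) <= T) by (eapply Rle_trans; [apply Rmax_l|apply Rmax_r]).
  assert (T3 : N / (k * tau) + 1 <= T) by (eapply Rle_trans; [apply Rmax_r|apply Rmax_r]).
  assert (Hkt : 0 < k * tau) by (apply Rmult_lt_0_compat; auto).
  assert (HN' : 0 <= N / (k * tau)) by (apply Rdiv_le_0_compat; auto).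
  clearbody T. exists T. split; auto. split; [lra|].
  assert (E1 : exp (kap * T) = exp (k * T) * exp ((kap - k) * T)) by (rewrite <- exp_plus; f_equal; ring).
  assert (E2 : exp (k * (T + L)) = exp (k * T) * exp (k * L)) by (rewrite <- exp_plus; f_equal; ring).
  assert (Hex : forall z, z <= exp z).
  { intros z. destruct (Req_dec z 0) as [->|Hn]; [rewrite exp_0; lra|]. assert (Q := exp_ineq1 z Hn). lra. }
  assert (G1 : w <= exp ((kap - k) * T)).
  { apply Rle_trans with ((kap - k) * T); auto. apply (Rmult_le_compat_l (kap - k)) in T2; [|lra].
    replace ((kap - k) * (w / (kap - k))) with w in T2 by (field; lra). auto. }
  assert (G2 : exp (k * L) + 1 <= c * exp ((kap - k) * T)).
  { apply (Rmult_le_compat_l c) in G1; [|lra]. unfold w in G1. replace (c * ((exp (k * L) + 1) / c)) with (exp (k * L) + 1) in G1 by (field; lra). auto. }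
  assert (Hp := exp_pos (k * T)).
  assert (G3 : exp (k * (T + L)) + - (c * exp (kap * T)) <= - (k * T)).
  { rewrite E1, E2. assert (Z := Hex (k * T)).
    apply (Rmult_le_compat_l (exp (k * T))) in G2; [|lra]. lra. }
  rewrite Rmult_assoc, <- exp_plus.
  apply Rle_trans with (N * exp (- (k * T))).
  { apply Rmult_le_compat_l; auto. destruct G3 as [G3|G3]; [left; apply exp_increasing; auto|right; f_equal; auto]. }
  rewrite exp_Ropp. assert (Z := Hex (k * T)).
  assert (HkT : 0 < k * T) by (apply Rmult_lt_0_compat; lra).
  apply Rle_trans with (N * / (k * T)).
  { apply Rmult_le_compat_l; auto. apply Rinv_le_contravar; auto. }
  apply Rle_div_l; auto.
  assert (Q : N / (k * tau) * (k * tau) = N) by (field; lra).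
  assert (N / (k * tau) * (k * tau) <= T * (k * tau)) by (apply Rmult_le_compat_r; lra). lra.
Qed.

Theorem phragmen_lindelof (u v : R -> R -> R) (sig k N B : R) : 0 < sig -> 0 < k -> k * (2 * sig) < PI ->
  0 <= N -> 0 <= B ->
  (forall x y, Rabs (across x y) < sig -> weak_CR u v x y) ->
  (forall x y eps, Rabs (across x y) <= sig -> 0 < eps -> exists del, 0 < del /\
     forall x' y', Rabs (across x' y') <= sig -> near del x y x' y' ->
       Rabs (u x' y' - u x y) < eps /\ Rabs (v x' y' - v x y) < eps) ->
  (forall x y, Rabs (across x y) < sig -> u x y * u x y + v x y * v x y <= (N * exp (exp (k * sqrt (x ^ 2 + y ^ 2)))) ^ 2) ->
  (forall x y, Rabs (across x y) = sig -> u x y * u x y + v x y * v x y <= B ^ 2) ->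
  forall x y, Rabs (across x y) < sig -> u x y * u x y + v x y * v x y <= B ^ 2.
Proof.
  intros Hsig Hk HkP HN HB HCR Hcont Hgr Hbd x0 y0 H0.
  (* Any rate strictly between [k] and [PI / (2 * sig)] would do: [cos (kap * s)] stays at least
     [c0 > 0] on the closed strip, and [kap > k] wins against the growth. *)
  set (kap := (k + PI / (2 * sig)) / 2).
  assert (HkP' : k < PI / (2 * sig)) by (apply Rlt_div_r; lra).
  assert (Hkap1 : k < kap) by (unfold kap; lra).
  assert (Hkap2 : kap * sig < PI / 2).
  { assert (kap < PI / (2 * sig)) by (unfold kap; lra).
    apply (Rmult_lt_compat_r sig) in H; auto. replace (PI / (2 * sig) * sig) with (PI / 2) in H by (field; lra). auto. }
  assert (Hkap0 : 0 < kap * sig) by (apply Rmult_lt_0_compat; lra).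
  set (c0 := cos (kap * sig)).
  assert (Hc0 : 0 < c0) by (apply cos_gt_0; lra).
  assert (Hcos : forall s, Rabs s <= sig -> c0 <= cos (kap * s)).
  { intros s Hs. assert (Hp := Rabs_pos s).
    assert (E : cos (kap * s) = cos (kap * Rabs s)).
    { unfold Rabs. destruct (Rcase_abs s); auto. rewrite <- (cos_neg (kap * s)). f_equal; ring. }
    rewrite E. assert (0 <= kap * Rabs s) by (apply Rmult_le_pos; lra).
    assert (kap * Rabs s <= kap * sig) by (apply Rmult_le_compat_l; lra).
    apply cos_decr_1; lra. }
  assert (Hre : forall s t, Rabs s <= sig -> c0 / 2 * exp (kap * Rabs t) <= re_cos kap s t).
  { intros s t Hs. unfold re_cos. assert (Z := Hcos s Hs).
    assert (P1 := exp_pos (kap * t)). assert (P2 := exp_pos (- (kap * t))).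
    assert (Q : exp (kap * Rabs t) <= exp (kap * t) + exp (- (kap * t))).
    { unfold Rabs. destruct (Rcase_abs t); [replace (kap * - t) with (- (kap * t)) by ring|]; lra. }
    apply Rle_trans with (c0 * ((exp (kap * t) + exp (- (kap * t))) / 2)).
    - replace (c0 / 2 * exp (kap * Rabs t)) with (c0 * (exp (kap * Rabs t) / 2)) by field.
      apply Rmult_le_compat_l; lra.
    - apply Rmult_le_compat_r; lra. }
  set (s0 := across x0 y0) in *. set (t0 := along x0 y0).
  set (m := sqrt (u x0 y0 * u x0 y0 + v x0 y0 * v x0 y0)).
  assert (Hsum : 0 <= u x0 y0 * u x0 y0 + v x0 y0 * v x0 y0) by nra.
  assert (Hm0 : 0 <= m) by apply sqrt_pos.
  assert (Hmm : m * m = u x0 y0 * u x0 y0 + v x0 y0 * v x0 y0) by (apply sqrt_sqrt; auto).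
  assert (Hdel : forall del tau, 0 < del -> 0 < tau -> m * exp (- (del * re_cos kap s0 t0)) <= B + tau).
  { intros del tau Hdel Htau.
    (* [sig + Rabs ga] bounds the excess of the norm over [Rabs t] in the strip, [del * c0 / 2] is
       the decay rate provided by [Hre], and [Rabs t0 + 1] keeps the given point inside the
       rectangle. *)
    destruct (double_exp_decay N k kap (sig + Rabs ga) (del * c0 / 2) tau HN Hk Hkap1 ltac:(assert (0 < del * c0) by (apply Rmult_lt_0_compat; auto); lra) Htau (Rabs t0 + 1)) as [T [HT1 [HT2 HT3]]].
    (* [u] and [v] are controlled on the closed strip only; clamping produces functions continuous
       on the plane with the same values on the rectangle. *)
    set (f0 := fun s t => u (abscissa (clamp (- sig) sig s) (clamp (- T) T t)) (ordinate (clamp (- sig) sig s) (clamp (- T) T t))).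
    set (g0 := fun s t => v (abscissa (clamp (- sig) sig s) (clamp (- T) T t)) (ordinate (clamp (- sig) sig s) (clamp (- T) T t))).
    assert (Hst : forall s t eps, in_rect (- sig) sig (- T) T s t -> 0 < eps -> exists del, 0 < del /\
      forall s' t', in_rect (- sig) sig (- T) T s' t' -> near del s t s' t' ->
        Rabs (u (abscissa s' t') (ordinate s' t') - u (abscissa s t) (ordinate s t)) < eps /\
        Rabs (v (abscissa s' t') (ordinate s' t') - v (abscissa s t) (ordinate s t)) < eps).
    { intros s t eps [Hs Ht] He. destruct (Hcont (abscissa s t) (ordinate s t) eps) as [de [Hde Hn]]; auto.
      { rewrite across_of. apply Rabs_le; lra. }
      exists (de / 2). split; [lra|]. intros s' t' [Hs' Ht'] [N1 N2]. apply Hn.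
      - rewrite across_of. apply Rabs_le; lra.
      - assert (Z1 := abscissa_lip s' t' s t). assert (Z2 := ordinate_lip s' t' s t). unfold l1 in *. split; lra. }
    assert (Cf0 : cont2 f0).
    { apply (cont2_clamp (fun s t => u (abscissa s t) (ordinate s t))); try lra. intros s t eps Hin He.
      destruct (Hst s t eps Hin He) as [de [Hde Hn]]. exists de; split; auto. intros s' t' H1 H2. apply (Hn s' t' H1 H2). }
    assert (Cg0 : cont2 g0).
    { apply (cont2_clamp (fun s t => v (abscissa s t) (ordinate s t))); try lra. intros s t eps Hin He.
      destruct (Hst s t eps Hin He) as [de [Hde Hn]]. exists de; split; auto. intros s' t' H1 H2. apply (Hn s' t' H1 H2). }
    set (e1 := fun s t => exp (- del * re_cos kap s t) * cos (del * im_cos kap s t)).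
    set (e2 := fun s t => exp (- del * re_cos kap s t) * sin (del * im_cos kap s t)).
    destruct (cont2_cos_parts kap) as [Cr Ci].
    assert (Ce : forall x, continuity_pt exp x) by (intros; apply derivable_continuous_pt, derivable_pt_exp).
    assert (Cexp : cont2 (fun s t => exp (- del * re_cos kap s t))).
    { apply (cont2_of_C0 exp); auto. apply cont2_mult; auto. apply cont2_cst. }
    assert (Ce1 : cont2 e1).
    { apply cont2_mult; auto. apply (cont2_of_C0 cos); [intros; apply continuity_cos|]. apply cont2_mult; auto. apply cont2_cst. }
    assert (Ce2 : cont2 e2).
    { apply cont2_mult; auto. apply (cont2_of_C0 sin); [intros; apply continuity_sin|]. apply cont2_mult; auto. apply cont2_cst. }
    set (f := fun s t => f0 s t * e1 s t - g0 s t * e2 s t).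
    set (g := fun s t => f0 s t * e2 s t + g0 s t * e1 s t).
    assert (Hmod : forall s t, Rabs s <= sig -> Rabs t <= T -> f s t * f s t + g s t * g s t =
      (u (abscissa s t) (ordinate s t) * u (abscissa s t) (ordinate s t) + v (abscissa s t) (ordinate s t) * v (abscissa s t) (ordinate s t)) *
      (exp (- del * re_cos kap s t) ^ 2)).
    { intros s t Hs Ht. apply Rabs_le_between in Hs, Ht. unfold f, g, e1, e2, f0, g0. rewrite !clamp_id by lra.
      assert (Z := sin2_cos2 (del * im_cos kap s t)). unfold Rsqr in Z.
      set (uu := u (abscissa s t) (ordinate s t)). set (vv := v (abscissa s t) (ordinate s t)).
      set (E := exp (- del * re_cos kap s t)). set (cc := cos (del * im_cos kap s t)) in *. set (ss := sin (del * im_cos kap s t)) in *.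
      replace ((uu * (E * cc) - vv * (E * ss)) * (uu * (E * cc) - vv * (E * ss)) + (uu * (E * ss) + vv * (E * cc)) * (uu * (E * ss) + vv * (E * cc)))
        with ((uu * uu + vv * vv) * E ^ 2 * (ss * ss + cc * cc)) by ring.
      rewrite Z. ring. }
    assert (Hre0 : forall s t, Rabs s <= sig -> 0 <= re_cos kap s t).
    { intros s t Hs. eapply Rle_trans; [|apply Hre; auto]. apply Rmult_le_pos; [lra|]. apply Rlt_le, exp_pos. }
    assert (Hexp1 : forall s t, Rabs s <= sig -> exp (- del * re_cos kap s t) <= 1).
    { intros s t Hs. assert (Z := Hre0 s t Hs). assert (0 <= del * re_cos kap s t) by (apply Rmult_le_pos; lra).
      rewrite <- exp_0. destruct (Req_dec (del * re_cos kap s t) 0) as [E|E].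
      - right. f_equal. lra.
      - left. apply exp_increasing. lra. }
    assert (Hmp := max_principle_rect f g sig T ((B + tau) ^ 2)).
    assert (Cf : cont2 f) by (apply cont2_minus; apply cont2_mult; auto).
    assert (Cg : cont2 g) by (apply cont2_plus; apply cont2_mult; auto).
    specialize (Hmp Cf Cg Hsig HT2).
    assert (Hfin : f s0 t0 * f s0 t0 + g s0 t0 * g s0 t0 <= (B + tau) ^ 2).
    { apply Hmp; try lra.
      - intros x y Hx Hy.
        set (de := Rmin (sig - Rabs (across x y)) (T - Rabs (along x y)) / 2).
        assert (Hde : 0 < Rmin (sig - Rabs (across x y)) (T - Rabs (along x y))) by (apply Rmin_pos; lra).
        assert (Z1 := Rmin_l (sig - Rabs (across x y)) (T - Rabs (along x y))).
        assert (Z2 := Rmin_r (sig - Rabs (across x y)) (T - Rabs (along x y))).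
        apply (weak_CR_local (fun x y => u x y * e1 (across x y) (along x y) - v x y * e2 (across x y) (along x y))
           (fun x y => u x y * e2 (across x y) (along x y) + v x y * e1 (across x y) (along x y)) _ _ x y de).
        + unfold de; lra.
        + intros s t [N1 N2].
          assert (Z3 := across_lip s t x y). assert (Z4 := along_lip s t x y). unfold l1 in Z3, Z4. unfold de in N1, N2.
          assert (Z5 := Rabs_triang_inv (across s t) (across x y)). assert (Z6 := Rabs_triang_inv (along s t) (along x y)).
          assert (Y1 : Rabs (across s t) <= sig) by lra. assert (Y2 : Rabs (along s t) <= T) by lra.
          apply Rabs_le_between in Y1, Y2.
          unfold f, g, f0, g0. rewrite !clamp_id by lra. rewrite abscissa_of, ordinate_of. auto.
        + apply weak_CR_mult; [apply HCR; auto|]. apply weak_CR_exp. apply weak_CR_cos.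
      - intros s t Hs Ht Hor. rewrite Hmod by auto.
        assert (Px := exp_pos (- del * re_cos kap s t)).
        (* On the edges of the strip the damping factor is at most 1 and the bound [B] applies; on
           the two ends [Rabs t = T] the damping beats the growth and leaves at most [tau]. *)
        destruct (Req_dec (Rabs s) sig) as [Es|Es].
        + assert (Q := Hbd (abscissa s t) (ordinate s t) ltac:(rewrite across_of; auto)).
          assert (Z := Hexp1 s t Hs). set (E := exp (- del * re_cos kap s t)) in *.
          apply Rle_trans with (B ^ 2 * 1).
          * apply Rmult_le_compat; auto; try nra.
          * nra.
        + assert (Et : Rabs t = T) by tauto.
          assert (Q := Hgr (abscissa s t) (ordinate s t) ltac:(rewrite across_of; lra)).
          apply Rle_trans with ((N * exp (exp (k * (T + (sig + Rabs ga)))) * exp (- (del * c0 / 2 * exp (kap * T)))) ^ 2).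
          * rewrite (Rpow_mult_distr _ (exp (- (del * c0 / 2 * exp (kap * T))))).
            apply Rmult_le_compat; try nra.
            -- eapply Rle_trans; [apply Q|]. apply pow_incr. split.
               ++ apply Rmult_le_pos; auto. apply Rlt_le, exp_pos.
               ++ apply Rmult_le_compat_l; auto.
                  assert (Mono : forall p q, p <= q -> exp p <= exp q).
                  { intros p q [Hpq|Hpq]; [left; apply exp_increasing; auto|right; f_equal; auto]. }
                  apply Mono, Mono. apply Rmult_le_compat_l; [lra|].
                  eapply Rle_trans; [apply norm_le_along|]. lra.
            -- apply pow_incr. split; [lra|].
               assert (Z := Hre s t Hs). rewrite Et in Z. apply (Rmult_le_compat_l del) in Z; [|lra].
               destruct (Req_dec (- del * re_cos kap s t) (- (del * c0 / 2 * exp (kap * T)))) as [E|E].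
               ++ right. f_equal; auto.
               ++ left. apply exp_increasing. lra.
          * assert (0 <= N * exp (exp (k * (T + (sig + Rabs ga)))) * exp (- (del * c0 / 2 * exp (kap * T)))).
            { repeat apply Rmult_le_pos; auto; apply Rlt_le, exp_pos. }
            apply pow_incr. lra. }
    rewrite Hmod in Hfin by lra. unfold s0, t0 in Hfin. rewrite abscissa_of, ordinate_of in Hfin. fold s0 t0 in Hfin.
    rewrite <- Hmm in Hfin. replace (- (del * re_cos kap s0 t0)) with (- del * re_cos kap s0 t0) by ring.
    assert (Px := exp_pos (- del * re_cos kap s0 t0)).
    apply Rsqr_incr_0_var; [|lra]. unfold Rsqr. lra. }
  set (P := re_cos kap s0 t0) in *.
  assert (HmB : m <= B).
  { apply Rle_plus_epsilon. intros eps He.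
    assert (HP : 0 <= P).
    { unfold P. eapply Rle_trans; [|apply Hre; lra]. apply Rmult_le_pos; [lra|]. apply Rlt_le, exp_pos. }
    (* From [1 - del * P <= exp (- (del * P))] the loss caused by the damping at the point is at
       most [m * del * P <= eps / 2]. *)
    set (del := eps / 2 / (m * P + 1)).
    assert (HmP : 0 <= m * P) by (apply Rmult_le_pos; auto).
    assert (Hd : 0 < del) by (apply Rdiv_lt_0_compat; lra).
    assert (Q := Hdel del (eps / 2) Hd ltac:(lra)).
    assert (Z : 1 - del * P <= exp (- (del * P))).
    { destruct (Req_dec (- (del * P)) 0) as [E|E]; [rewrite E, exp_0; lra|]. assert (Y := exp_ineq1 _ E). lra. }
    apply (Rmult_le_compat_l m) in Z; auto.
    assert (E : del * (m * P + 1) = eps / 2) by (unfold del; field; lra). lra. }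
  rewrite <- Hmm. nra.
Qed.

End Strip.

(** * Quaternions *)

Definition qdot (p q : quat) : R := qr p * qr q + qi p * qi q + qj p * qj q + qk p * qk q.

Lemma qnorm_pos (q : quat) : 0 <= qnorm q.
Proof. apply sqrt_pos. Qed.

Lemma qnorm_sqr (q : quat) : qnorm q * qnorm q = qdot q q.
Proof.
  unfold qnorm. rewrite sqrt_sqrt; [unfold qdot; ring|].
  repeat apply Rplus_le_le_0_compat; apply pow2_ge_0.
Qed.

Lemma qdot_cauchy_schwarz (p q : quat) : Rabs (qdot p q) <= qnorm p * qnorm q.
Proof.
  apply Rsqr_incr_0_var; [|apply Rmult_le_pos; apply qnorm_pos].
  rewrite <- Rsqr_abs. unfold Rsqr.
  replace (qnorm p * qnorm q * (qnorm p * qnorm q)) with ((qnorm p * qnorm p) * (qnorm q * qnorm q)) by ring.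
  rewrite !qnorm_sqr. unfold qdot.
  destruct p as [a b c d], q as [a' b' c' d']; simpl.
  assert (0 <= (a * b' - b * a') * (a * b' - b * a')) by apply Rle_0_sqr.
  assert (0 <= (a * c' - c * a') * (a * c' - c * a')) by apply Rle_0_sqr.
  assert (0 <= (a * d' - d * a') * (a * d' - d * a')) by apply Rle_0_sqr.
  assert (0 <= (b * c' - c * b') * (b * c' - c * b')) by apply Rle_0_sqr.
  assert (0 <= (b * d' - d * b') * (b * d' - d * b')) by apply Rle_0_sqr.
  assert (0 <= (c * d' - d * c') * (c * d' - d * c')) by apply Rle_0_sqr.
  lra.
Qed.

Lemma qdot_mul_mul (I a b : quat) : in_S I -> qdot (qmul I a) (qmul I b) = qdot a b.
Proof.
  intros [H0 H1]. transitivity ((qr I ^ 2 + (qi I ^ 2 + qj I ^ 2 + qk I ^ 2)) * qdot a b).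
  - unfold qdot, qmul; simpl. ring.
  - rewrite H0, H1. ring.
Qed.

Lemma qdot_mul_l (I a b : quat) : in_S I -> qdot (qmul I a) b = - qdot a (qmul I b).
Proof. intros [H0 _]. unfold qdot, qmul; simpl. rewrite H0. ring. Qed.

(* [c] and [I c] are orthogonal of the same norm, so this is Bessel's inequality. *)
Lemma qdot_bessel (I p c : quat) : in_S I ->
  qdot p c * qdot p c + qdot p (qmul I c) * qdot p (qmul I c) <= (qnorm p * qnorm c) ^ 2.
Proof.
  intros HI. set (e := qmul I c).
  assert (Hee : qdot e e = qdot c c) by (apply qdot_mul_mul; auto).
  assert (Hce : qdot c e = 0).
  { assert (H := qdot_mul_l I c c HI). fold e in H. assert (qdot e c = qdot c e) by (unfold qdot; ring). lra. }
  assert (Hcc : 0 <= qdot c c) by (rewrite <- qnorm_sqr; apply Rle_0_sqr).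
  replace ((qnorm p * qnorm c) ^ 2) with ((qnorm p * qnorm p) * (qnorm c * qnorm c)) by ring.
  rewrite !qnorm_sqr.
  set (A := qdot p c). set (B := qdot p e). set (n := qdot c c) in *. set (P := qdot p p).
  assert (H : 0 <= n * (n * P - A * A - B * B)).
  (* Squared norm of [n] times the residual of the projection of [p] onto the span of [c] and [e];
     the factor [n] avoids dividing before [n = 0] is set apart. *)
  { assert (Hr : 0 <= qdot (qsub (qscal n p) (qadd (qscal A c) (qscal B e))) (qsub (qscal n p) (qadd (qscal A c) (qscal B e))))
      by (rewrite <- qnorm_sqr; apply Rle_0_sqr).
    replace (qdot (qsub (qscal n p) (qadd (qscal A c) (qscal B e))) (qsub (qscal n p) (qadd (qscal A c) (qscal B e))))
      with (n * n * P - 2 * n * (A * A + B * B) + A * A * qdot c c + 2 * A * B * qdot c e + B * B * qdot e e) in Hr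
      by (unfold A, B, P, qdot, qsub, qadd, qscal; simpl; ring).
    rewrite Hce, Hee in Hr. fold n in Hr. lra. }
  destruct (Req_dec n 0) as [E|E].
  - assert (CA := qdot_cauchy_schwarz p c). assert (CB := qdot_cauchy_schwarz p e).
    assert (Nc : qnorm c = 0) by (assert (Q := qnorm_sqr c); fold n in Q; nra).
    assert (Ne : qnorm e = 0) by (assert (Q := qnorm_sqr e); rewrite Hee in Q; nra).
    fold A in CA. fold B in CB. rewrite Nc in CA. rewrite Ne in CB.
    rewrite Rmult_0_r in CA, CB. apply Rabs_le_between in CA, CB.
    replace A with 0 by lra. replace B with 0 by lra. rewrite E. lra.
  - assert (0 < n) by lra. apply Rmult_le_reg_l with n; auto. lra.
Qed.

Lemma qdot_sub (p q c : quat) : qdot (qsub p q) c = qdot p c - qdot q c.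
Proof. unfold qdot, qsub; simpl; ring. Qed.

Lemma qderiv_dot (h : R -> quat) (t : R) (d c : quat) : qderiv_lim h t d ->
  derivable_pt_lim (fun s => qdot (h s) c) t (qdot d c).
Proof.
  intros [H1 [H2 [H3 H4]]]. unfold qdot.
  assert (Sc : forall f l k, derivable_pt_lim f t l -> derivable_pt_lim (fun s => f s * k) t (l * k)).
  { intros f l k Hf. replace (l * k) with (l * k + f t * 0) by ring.
    apply (derivable_pt_lim_mult f (fun _ => k)); auto. apply derivable_pt_lim_const. }
  apply (derivable_pt_lim_plus (fun s => qr (h s) * qr c + qi (h s) * qi c + qj (h s) * qj c)); [|apply (Sc (fun s => qk (h s))); auto].
  apply (derivable_pt_lim_plus (fun s => qr (h s) * qr c + qi (h s) * qi c)); [|apply (Sc (fun s => qj (h s))); auto].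
  apply (derivable_pt_lim_plus (fun s => qr (h s) * qr c)); [apply (Sc (fun s => qr (h s)))|apply (Sc (fun s => qi (h s)))]; auto.
Qed.

Lemma slice_norm (I : quat) (x y : R) : in_S I -> qnorm (slice I x y) = sqrt (x ^ 2 + y ^ 2).
Proof.
  intros [H0 H1]. unfold qnorm, slice, qadd, qreal, qscal; simpl. f_equal. rewrite H0.
  transitivity (x ^ 2 + y ^ 2 * (qi I ^ 2 + qj I ^ 2 + qk I ^ 2)); [ring|rewrite H1; ring].
Qed.

Lemma slice_dist (I : quat) (x y x' y' : R) : in_S I -> qnorm (qsub (slice I x y) (slice I x' y')) <= l1 x y x' y'.
Proof.
  intros HI. replace (qsub (slice I x y) (slice I x' y')) with (slice I (x - x') (y - y')).
  - rewrite slice_norm by auto. unfold l1.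
    rewrite <- (pow2_abs (x - x')), <- (pow2_abs (y - y')).
    assert (P1 := Rabs_pos (x - x')). assert (P2 := Rabs_pos (y - y')).
    rewrite <- (sqrt_Rsqr (Rabs (x - x') + Rabs (y - y'))) by lra. apply sqrt_le_1_alt. unfold Rsqr. nra.
  - unfold slice, qsub, qadd, qreal, qscal; simpl. f_equal; ring.
Qed.

Lemma quat_slice (q : quat) : exists I x y, in_S I /\ q = slice I x y.
Proof.
  destruct q as [a b c d]. set (n := sqrt (b ^ 2 + c ^ 2 + d ^ 2)).
  assert (Hs : 0 <= b ^ 2 + c ^ 2 + d ^ 2) by (repeat apply Rplus_le_le_0_compat; apply pow2_ge_0).
  assert (Hn : n * n = b ^ 2 + c ^ 2 + d ^ 2) by (apply sqrt_sqrt; auto).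
  destruct (Req_dec n 0) as [E|E].
  (* A real quaternion lies on every slice; the one through [i] is chosen. *)
  - exists (Quat 0 1 0 0), a, 0. split.
    + split; simpl; ring.
    + unfold slice, qadd, qreal, qscal; simpl.
      assert (b = 0 /\ c = 0 /\ d = 0) as [-> [-> ->]] by (repeat split; nra). f_equal; ring.
  - exists (Quat 0 (b / n) (c / n) (d / n)), a, n. split.
    + split; simpl; auto.
      transitivity ((b ^ 2 + c ^ 2 + d ^ 2) / (n * n)); [field; auto|]. rewrite <- Hn. field; auto.
    + unfold slice, qadd, qreal, qscal; simpl. f_equal; field; auto.
Qed.

(** Regularity says that the [x] derivative of [f] is minus [I] times its [y] derivative. Left
    multiplication by [I] is skew for [qdot] and an isometry, and these two facts give the two
    Cauchy-Riemann equations. *)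
Lemma slice_weak_CR (Om : quat -> Prop) (f : quat -> quat) (I c : quat) (x y : R) :
  in_S I -> slice_regular Om f -> Om (slice I x y) ->
  weak_CR (fun x y => qdot (f (slice I x y)) c) (fun x y => qdot (f (slice I x y)) (qmul I c)) x y.
Proof.
  intros HI Hreg Hom. destruct (Hreg I HI x y Hom) as [dx [dy [H1 [H2 H3]]]].
  assert (E : forall e, qdot dx e = - qdot (qmul I dy) e).
  { intros e. revert H3. generalize (qmul I dy). intros w H3.
    assert (E1 := f_equal qr H3). assert (E2 := f_equal qi H3).
    assert (E3 := f_equal qj H3). assert (E4 := f_equal qk H3). simpl in E1, E2, E3, E4.
    unfold qdot. replace (qr dx) with (- qr w) by lra. replace (qi dx) with (- qi w) by lra.
    replace (qj dx) with (- qj w) by lra. replace (qk dx) with (- qk w) by lra. ring. }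
  exists (qdot dx c), (qdot dy c). repeat split.
  - apply (qderiv_dot (fun s => f (slice I s y))); auto.
  - apply (qderiv_dot (fun s => f (slice I x s))); auto.
  - replace (- qdot dy c) with (qdot dx (qmul I c)).
    + apply (qderiv_dot (fun s => f (slice I s y))); auto.
    + rewrite E, qdot_mul_mul; auto.
  - replace (qdot dx c) with (qdot dy (qmul I c)).
    + apply (qderiv_dot (fun s => f (slice I x s))); auto.
    + rewrite E, qdot_mul_l by auto. ring.
Qed.

Theorem theorem4p8 (Om : quat -> Prop) (gam : R) (f : quat -> quat)
  (N k M : R) :
  strip_width Om gam ->
  slice_regular Om f ->
  continuous_on_closure Om f ->
  N > 0 -> k > 0 -> k < PI / gam ->
  (forall q, Om q -> qnorm (f q) <= N * exp (exp (k * qnorm q))) ->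
  M >= 0 ->
  (forall q, boundary Om q -> qnorm (f q) <= M) ->
  forall q, Om q -> qnorm (f q) <= M.
Proof.
  intros [[Hdom Hstrip] [Hub _]] Hreg Hcont HN Hk HkP Hgrow HM Hbd q Hq.
  destruct (quat_slice q) as [I [x0 [y0 [HI Hq0]]]].
  destruct (Hstrip I HI) as [g Hg].
  assert (Hgg : g <= gam) by (apply Hub; exists I; auto).
  destruct Hg as [Hg0 [a [b [c [Habn Hslice]]]]].
  set (n := sqrt (a ^ 2 + b ^ 2)).
  assert (Hab2 : 0 < a ^ 2 + b ^ 2) by (destruct Habn; nra).
  assert (Hn : 0 < n) by (apply sqrt_lt_R0; auto).
  assert (Hnn : n * n = a ^ 2 + b ^ 2) by (apply sqrt_sqrt; lra).
  set (al := a / n). set (be := b / n). set (ga := c / n).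
  assert (Hab : al * al + be * be = 1).
  { unfold al, be. replace (a / n * (a / n) + b / n * (b / n)) with ((a ^ 2 + b ^ 2) / (n * n)) by (field; lra).
    rewrite Hnn. field. lra. }
  assert (Hdist : forall x y, line_dist a b c x y = Rabs (across al be ga x y)).
  { intros x y. unfold line_dist. fold n. unfold across, al, be, ga.
    replace (a / n * x + b / n * y - c / n) with ((a * x + b * y - c) / n) by (field; lra).
    unfold Rdiv. rewrite Rabs_mult, (Rabs_right (/ n)); auto. left. apply Rinv_0_lt_compat; auto. }
  set (sig := g / 2). assert (Hsig : 0 < sig) by (unfold sig; lra).
  assert (HOm : forall x y, Om (slice I x y) <-> Rabs (across al be ga x y) < sig).
  { intros x y. rewrite <- Hdist. apply Hslice. }
  assert (Hcl : forall x y, Rabs (across al be ga x y) <= sig -> closure Om (slice I x y)).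
  { intros x y Hs eps He.
    set (s := across al be ga x y) in *. set (t := along al be x y).
    (* A point of the closed strip is contracted towards the centre line by the factor [1 - th],
       which brings it inside and moves it by at most [eps / 2] across. *)
    set (th := Rmin (1 / 2) (eps / (2 * sig))).
    assert (Hth : 0 < th) by (apply Rmin_pos; [lra|apply Rdiv_lt_0_compat; lra]).
    assert (Hth1 : th <= 1 / 2) by apply Rmin_l.
    assert (Hth2 : th * sig <= eps / 2).
    { apply Rle_trans with (eps / (2 * sig) * sig); [apply Rmult_le_compat_r; [lra|apply Rmin_r]|]. right; field; lra. }
    exists (slice I (abscissa al be ga ((1 - th) * s) t) (ordinate al be ga ((1 - th) * s) t)). split.
    - apply HOm. rewrite across_of by auto. rewrite Rabs_mult, (Rabs_right (1 - th)) by lra.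
      assert (P := Rabs_pos s). nra.
    - assert (Ex : x = abscissa al be ga s t) by (symmetry; apply abscissa_of; auto).
      assert (Ey : y = ordinate al be ga s t) by (symmetry; apply ordinate_of; auto).
      eapply Rle_lt_trans; [apply slice_dist; auto|].
      assert (D : Rabs ((1 - th) * s - s) <= eps / 2).
      { replace ((1 - th) * s - s) with (- (th * s)) by ring. rewrite Rabs_Ropp, Rabs_mult, (Rabs_right th) by lra.
        eapply Rle_trans; [|apply Hth2]. apply Rmult_le_compat_l; lra. }
      assert (A1 := direction_bounds al be Hab).
      replace (l1 (abscissa al be ga ((1 - th) * s) t) (ordinate al be ga ((1 - th) * s) t) x y)
        with ((Rabs al + Rabs be) * Rabs ((1 - th) * s - s)).
      + assert (P := Rabs_pos ((1 - th) * s - s)).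
        (* The closure asks for a distance strictly below [eps]; the two coordinates of a unit
           vector cannot both have modulus 1. *)
        assert (Hlt : Rabs al + Rabs be < 2).
        { assert (Q1 := pow2_abs al). assert (Q2 := pow2_abs be). destruct A1.
          assert (Rabs al + Rabs be <= 2) by lra.
          apply Rnot_le_lt. intro. assert (Rabs al = 1) by lra. assert (Rabs be = 1) by lra. rewrite H3 in Q1. rewrite H4 in Q2. lra. }
        assert (P1 := Rabs_pos al). assert (P2 := Rabs_pos be).
        apply Rle_lt_trans with ((Rabs al + Rabs be) * (eps / 2)); [apply Rmult_le_compat_l; lra|]. nra.
      + unfold l1. rewrite Ex at 1. rewrite Ey at 1. unfold abscissa, ordinate.
        replace (al * ((1 - th) * s + ga) - be * t - (al * (s + ga) - be * t)) with (al * ((1 - th) * s - s)) by ring.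
        replace (be * ((1 - th) * s + ga) + al * t - (be * (s + ga) + al * t)) with (be * ((1 - th) * s - s)) by ring.
        rewrite !Rabs_mult. ring. }
  (* Pairing with the value of [f] at the given point makes [u] equal to the squared norm of [d]
     there, so no modulus is lost. *)
  set (d := f q). assert (Hd0 := qnorm_pos d).
  set (u := fun x y => qdot (f (slice I x y)) d). set (v := fun x y => qdot (f (slice I x y)) (qmul I d)).
  assert (Hid : qnorm (qmul I d) = qnorm d).
  { apply Rsqr_inj; try apply qnorm_pos. unfold Rsqr. rewrite !qnorm_sqr. apply qdot_mul_mul; auto. }
  assert (Hfin : u x0 y0 * u x0 y0 + v x0 y0 * v x0 y0 <= (M * qnorm d) ^ 2).
  { apply (phragmen_lindelof al be ga Hab u v sig k (N * qnorm d) (M * qnorm d)); auto; try lra.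
    - assert (Hgam : 0 < gam) by lra.
      apply (Rmult_lt_compat_r gam) in HkP; auto. replace (PI / gam * gam) with PI in HkP by (field; lra).
      unfold sig. apply Rle_lt_trans with (k * gam); auto. apply Rmult_le_compat_l; lra.
    - apply Rmult_le_pos; lra.
    - apply Rmult_le_pos; lra.
    - intros x y Hs. apply (slice_weak_CR Om f I d x y HI Hreg). apply HOm; auto.
    - intros x y eps Hs He.
      destruct (Hcont (slice I x y) (Hcl x y Hs) (eps / (qnorm d + 1))) as [del [Hdel H]].
      { apply Rdiv_lt_0_compat; lra. }
      exists (del / 2). split; [lra|]. intros x' y' Hs' [N1 N2].
      assert (Hc := H (slice I x' y') (Hcl x' y' Hs')).
      assert (Hlt : qnorm (qsub (slice I x' y') (slice I x y)) < del).
      { eapply Rle_lt_trans; [apply slice_dist; auto|]. unfold l1. lra. }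
      specialize (Hc Hlt).
      assert (Ee : eps / (qnorm d + 1) * (qnorm d + 1) = eps) by (field; lra).
      assert (P := qnorm_pos (qsub (f (slice I x' y')) (f (slice I x y)))).
      assert (C1 := qdot_cauchy_schwarz (qsub (f (slice I x' y')) (f (slice I x y))) d).
      assert (C2 := qdot_cauchy_schwarz (qsub (f (slice I x' y')) (f (slice I x y))) (qmul I d)).
      rewrite qdot_sub in C1, C2. rewrite Hid in C2. unfold u, v. split; nra.
    - intros x y Hs. eapply Rle_trans; [apply qdot_bessel; auto|].
      assert (Q := Hgrow (slice I x y) (proj2 (HOm x y) Hs)). rewrite slice_norm in Q by auto.
      apply pow_incr. split; [apply Rmult_le_pos; auto using qnorm_pos|].
      replace (N * qnorm d * exp (exp (k * sqrt (x ^ 2 + y ^ 2)))) with (N * exp (exp (k * sqrt (x ^ 2 + y ^ 2))) * qnorm d) by ring.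
      apply Rmult_le_compat_r; auto.
    - intros x y Hs. eapply Rle_trans; [apply qdot_bessel; auto|].
      apply pow_incr. split; [apply Rmult_le_pos; auto using qnorm_pos|].
      (* The edges of the planar strip belong to the boundary of [Om] in the quaternions: they are
         limits of points of [Om] by [Hcl] and lie outside it by [HOm]. *)
      apply Rmult_le_compat_r; auto. apply Hbd. split; [apply Hcl; lra|].
      intro Ho. apply HOm in Ho. lra.
    - apply HOm. rewrite <- Hq0. auto. }
  assert (Hu : u x0 y0 = qnorm d * qnorm d) by (unfold u; rewrite <- Hq0; symmetry; apply qnorm_sqr).
  (* What remains is that the fourth power of the norm of [d] is at most the square of [M] times
     that norm, which fails if the norm exceeds [M]. *)
  rewrite Hu in Hfin. clear -Hfin Hd0 HM.
  assert (Hv : 0 <= v x0 y0 * v x0 y0) by apply Rle_0_sqr.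
  apply Rnot_lt_le. intro Hlt.
  assert (0 < qnorm d) by lra.
  assert (M * qnorm d < qnorm d * qnorm d) by (apply Rmult_lt_compat_r; auto).
  assert (0 <= M * qnorm d) by (apply Rmult_le_pos; lra). nra.
Qed.
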